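(* Assume that $f$ admits a continuous fourth-order derivative $f^{(4)}$ on $[0,1]$; that $(\gamma_n)\in\mathcal{GS}(-\alpha)$ with $\alpha\in(\frac12,1]$; that $(m_n)\in\mathcal{GS}(a)$ with $a\in(0,1)$; and that $\lim_{n\to\infty}(n\gamma_n)\in\left(\min\left(2a,\frac{2\alpha-a}{4}\right),\infty\right]$. Put $\xi=\lim_{n\to\infty}(n\gamma_n)^{-1}$, and let $f_n$ be the recursive Bernstein density estimator with stepsize $(\gamma_n)$ and order $(m_n)$. To minimize the $\mathrm{MISE}$ of $f_n$, the stepsize $(\gamma_n)$ must be chosen in $\mathcal{GS}(-1)$ and $(m_n)$ must be in $\mathcal{GS}(2/9)$, such that $$(m_n)=\left(2^{2/9}\left(1-\frac49\xi\right)^{-2/9}\left[\frac{32C_2}{C_1C_3}\right]^{2/9}\gamma_n^{-2/9}\right),$$ and then the corresponding $\mathrm{MISE}$ is equal to $$\mathrm{MISE}[f_n]=\frac{9(32C_1^8C_3^8C_2)^{1/9}}{8}\,\frac{1}{2^{8/9}\left(1-\frac49\xi\right)^{10/9}}\,\gamma_n^{8/9}+o\left(\gamma_n^{8/9}\right).$$ Moreover, in the case when $(\gamma_n)=(\gamma_0n^{-1})$, the optimal order $(m_n)$ must be equal to $$\left(2^{2/9}\left(\gamma_0-\frac49\right)^{-2/9}\left[\frac{32C_2}{C_1C_3}\right]^{2/9}n^{2/9}\right),$$ and the corresponding $\mathrm{MISE}$ is given by $$\mathrm{MISE}[f_n]=\frac{9(8C_1^8C_3^8C_2)^{1/9}}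{8}\,\frac{\gamma_0^2}{2^{6/9}\left(\gamma_0-\frac49\right)^{10/9}}\,n^{-8/9}+o\left(n^{-8/9}\right).$$
   Context: Class $\mathcal{GS}$: for $\gamma\in\mathbb{R}$, a nonrandom positive sequence $(v_n)_{n\ge1}$ belongs to $\mathcal{GS}(\gamma)$ if $\lim_{n\to\infty}n\left[1-\frac{v_{n-1}}{v_n}\right]=\gamma$. Estimator: $X_1,X_2,\dots$ are i.i.d. random variables with common unknown density $f$ supported on $[0,1]$. Let $b_k(m,x)=\binom mk x^k(1-x)^{m-k}$ be the Bernstein polynomial of order $m$, and set $$T_{n,m}(x)=m\sum_{k=0}^{m-1}\mathbb{I}\left\{\tfrac km<X_n\le\tfrac{k+1}m\right\}b_k(m-1,x).$$ Given a stepsize sequence $(\gamma_n)$ and an order sequence $(m_n)$, put $Z_n(x)=2T_{n,m}(x)-T_{n,m/2}(x)$ with $m=m_n$. The recursive estimator is defined by $f_0(x)=0$ and, for $n\ge1$, $f_n(x)=(1-\gamma_n)f_{n-1}(x)+\gamma_nZ_n(x)$. Notation: $\mathrm{MISE}[f_n]=\mathbb{E}\int_0^1(f_n(x)-f(x))^2dx$ is the mean integrated squared error; $\psi(x)=(4\pi x(1-x))^{-1/2}$; $$\Delta_2(x)=\tfrac16(1-6x(1-x))f''(x)+\tfrac5{12}x(1-x)(1-2x)f^{(3)}(x)+\tfrac18x^2(1-x)^2f^{(4)}(x);$$ $C_1=\int_0^1f(x)\psi(x)dx$; $C_2=\int_0^1\Delta_2^2(x)dx$; $C_3=\frac1{\sqrt2}+4\left(1-\sqrt{\frac23}\right)$.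 Asymptotic statements are as $n\to\infty$.
   Formalization: C_2>0 is assumed (if C_2=0, e.g. uniform f, the stated m_n is 0, not in GS(2/9)); m_n is real and the Bernstein orders are any even integers asymptotic to m_n (no integer sequence is in GS(a), 0<a<1); optimality and uniqueness of (m_n) are asymptotic. *)

(* Defs.v *)
From HB Require Import structures.
From mathcomp Require Import all_boot all_order all_algebra.
From mathcomp Require Import all_classical all_reals all_analysis.

Set Implicit Arguments.
Unset Strict Implicit.
Unset Printing Implicit Defensive.

Import Order.TTheory GRing.Theory Num.Theory.
Import numFieldNormedType.Exports.

Local Open Scope classical_set_scope.
Local Open Scope ring_scope.

Section Analysis.
Context {R : realType}.
Implicit Types (f : R -> R) (x : R) (u v : nat -> R).

(* Sequences (v_n)_(n >= 1) are functions on nat; the value at 0 is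
   irrelevant. *)
Definition GS (c : R) v : Prop :=
  (forall n, (1 <= n)%N -> 0 < v n) /\
  (n%:R * (1 - v n.-1 / v n)) @[n --> \oo] --> c.

Definition asymp_equiv u v : Prop := (u n / v n) @[n --> \oo] --> (1 : R).

(* Derivative on the segment [0, 1]: one-sided at the end points, where f may
   jump to 0. *)
Definition diffquot f x y : R := (f y - f x) / (y - x).

Definition derivable01 f x : Prop :=
  cvg (diffquot f x @ within `[0, 1] x^').

Definition der01 f x : R := lim (diffquot f x @ within `[0, 1] x^').

Definition dern01 (k : nat) f : R -> R := iter k der01 f.

Definition C4_01 f : Prop :=
  (forall k x, (k < 4)%N -> x \in `[0, 1] -> derivable01 (dern01 k f) x) /\
  {within `[0, 1], continuous (dern01 4 f)}.

Definition bernstein (k m : nat) x : R :=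
  'C(m, k)%:R * x ^+ k * (1 - x) ^+ (m - k).

Definition psi x : R := (4 * pi * x * (1 - x)) `^ (- 2^-1).

Definition Delta2 f x : R :=
  6^-1 * (1 - 6 * x * (1 - x)) * dern01 2 f x
  + 5 / 12 * x * (1 - x) * (1 - 2 * x) * dern01 3 f x
  + 8^-1 * x ^+ 2 * (1 - x) ^+ 2 * dern01 4 f x.

Definition C1 f : R := \int[lebesgue_measure]_(x in `[0, 1]) (f x * psi x).
Definition C2 f : R := \int[lebesgue_measure]_(x in `[0, 1]) (Delta2 f x ^+ 2).
Definition C3 : R := (Num.sqrt 2)^-1 + 4 * (1 - Num.sqrt (2 / 3)).

Definition density01 f : Prop :=
  [/\ measurable_fun setT f,
      (forall x, 0 <= f x),
      (forall x, x \notin `[0, 1] -> f x = 0)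
    & (\int[lebesgue_measure]_x (f x)%:E = 1)%E].

Definition xi_of (g : nat -> R) : R := lim ((n%:R * g n)^-1 @[n --> \oo]).

Definition stepsize_limit (alpha a : R) (g : nat -> R) : Prop :=
  exists2 L : \bar R, (n%:R * g n)%:E @[n --> \oo] --> L
    & ((Num.min (2 * a) ((2 * alpha - a) / 4))%:E < L)%E.

Definition admissible (alpha a : R) (g m : nat -> R) : Prop :=
  [/\ 1 / 2 < alpha <= 1, 0 < a < 1, GS (- alpha) g, GS a m
    & stepsize_limit alpha a g].

(* No integer-valued sequence is in GS(a) for 0 < a < 1 (it would be eventually
   constant), so an order sequence m in GS(a) is real valued, and the Bernstein
   polynomials have as orders positive even integers N_n with N_n ~ m_n. *)
Definition integer_order (N : nat -> nat) (m : nat -> R) : Prop :=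
  (forall n, (1 <= n)%N -> (0 < N n)%N && ~~ odd (N n)) /\
  asymp_equiv (fun n => (N n)%:R) m.

Definition m_opt f (g : nat -> R) (n : nat) : R :=
  2 `^ (2 / 9) * (1 - 4 / 9 * xi_of g) `^ (- (2 / 9))
  * (32 * C2 f / (C1 f * C3)) `^ (2 / 9) * g n `^ (- (2 / 9)).

(* limsup u / v <= 1, and u = o(v), for nonnegative sequences *)
Definition asymp_le (u v : nat -> \bar R) : Prop :=
  forall e : R, 0 < e -> \forall n \near \oo, (u n <= (1 + e)%:E * v n)%E.

Definition asymp_negligible (u v : nat -> \bar R) : Prop :=
  forall e : R, 0 < e -> \forall n \near \oo, (u n <= e%:E * v n)%E.

(* u = K w + o(w) *)
Definition expansion (u : nat -> \bar R) (K : R) (w : nat -> R) : Prop :=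
  exists2 e : nat -> R, e =o_\oo w & forall n, u n = (K * w n + e n)%:E.

End Analysis.

Section Estimator.
Context {R : realType} {d : measure_display} {T : measurableType d}.
Variable P : probability T R.
Implicit Types X : nat -> {RV P >-> R}.

Definition mutually_independent X : Prop :=
  forall (J : seq nat) (A : nat -> set R), uniq J ->
    (forall i, measurable (A i)) ->
    (P (\bigcap_(i in [set` J]) (X i @^-1` A i))
     = \prod_(i <- J) P (X i @^-1` A i))%E.

Definition iid_with_density X (f : R -> R) : Prop :=
  mutually_independent X /\
  forall i (A : set R), measurable A ->
    (distribution P (X i) A = \int[lebesgue_measure]_(x in A) (f x)%:E)%E.

(* T_{n,m}(x) on the event X_n = y *)
Definition Tker (m : nat) (y x : R) : R :=
  m%:R * \sum_(k < m)
    \1_(`]k%:R / m%:R, k.+1%:R / m%:R]) y * bernstein k m.-1 x.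

Definition Zker (m : nat) (y x : R) : R := 2 * Tker m y x - Tker m./2 y x.

Fixpoint estimator X (g : nat -> R) (N : nat -> nat) (n : nat) (x : R) (w : T)
    : R :=
  if n is n'.+1 then
    (1 - g n) * estimator X g N n' x w + g n * Zker (N n) (X n w) x
  else 0.

Definition ISE X (f : R -> R) (g : nat -> R) (N : nat -> nat) (n : nat) (w : T)
    : R :=
  \int[lebesgue_measure]_(x in `[0, 1]) (estimator X g N n x w - f x) ^+ 2.

Definition MISE X (f : R -> R) (g : nat -> R) (N : nat -> nat) (n : nat)
    : \bar R := ('E_P[ISE X f g N n])%E.

(* Given the stepsize g, the order m asymptotically minimizes the MISE among
   all admissible orders, and every other minimizing order is equivalent to m
   (an exact formula can only be pinned down up to equivalence). *)
Definition optimal_order X (f : R -> R) (g m : nat -> R) : Prop :=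
  forall N, integer_order N m ->
  forall alpha a m' N', admissible alpha a g m' -> integer_order N' m' ->
    asymp_le (MISE X f g N) (MISE X f g N') /\
    (asymp_le (MISE X f g N') (MISE X f g N) -> asymp_equiv m' m).

End Estimator.

(* Main.v *)
(* The estimator is a deterministic combination of the independent variables Z_i,
   so its MISE is the squared L2 norm of the bias B_n plus an integrated variance
   V_n, with
     B_n = (1 - g_n) B_(n-1) + g_n (E Z_n - f),
     V_n = (1 - g_n)^2 V_(n-1) + g_n^2 var Z_n.
   A recursion x_n = (1 - g_n)^j x_(n-1) + g_n y_n with y ~ t v and v in GS(-c)
   gives x ~ t v / (j - c xi).
   Bias: E T_m is a binomial mean of increments of the distribution function; a
   Taylor expansion and the binomial moments give, uniformly in x,
   E Z_m = f - 2 Delta2 / m^2 + o(m^-2).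
   Variance: the L2 norm of Z_m given X = y in the k-th cell is a combination of
   beta integrals, that is of central binomial coefficients C(2n, n), C(3n, n),
   evaluated by Stirling's formula; the pointwise limit in y is integrated against
   f by dominated convergence (majorant (y (1 - y))^(-1/2)), hence
   var Z_m ~ C1 C3 m^(1/2).
   So MISE ~ A g_n m_n^(1/2) + B m_n^(-4), which is minimized through
   8 t + t^(-8) >= 9. For other exponents (alpha, a) either the bias or the
   variance alone decays more slowly than g_n^(8/9). *)

Require Import Defs.
From HB Require Import structures.
From mathcomp Require Import all_boot all_order all_algebra.
From mathcomp Require Import all_classical all_reals all_analysis.
From mathcomp Require Import measurable_realfun lebesgue_integral_dominated_convergence.
From mathcomp Require Import ring lra zify.

Import Order.TTheory GRing.Theory Num.Theory.
Import numFieldNormedType.Exports.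

Set Implicit Arguments.
Unset Strict Implicit.
Unset Printing Implicit Defensive.

Local Open Scope classical_set_scope.
Local Open Scope ring_scope.

(** * Regularly varying sequences and recursions *)

(** The stepsize condition only guarantees the smaller of two thresholds for lim n g_n, so away from
    the optimal exponents one of the two recursions may leave the range j > c xi in which its ratio
    has a limit. The smaller threshold belongs to the bias when 9 a <= 2 alpha and to the variance
    otherwise. The term that stays under control is then always the one that decays more slowly,
    which suffices for a lower bound on the MISE. At (alpha, a) = (1, 2/9) both thresholds equal 4/9
    and both limits are available. The bias is a function of x, whereas the recursion lemma concerns
    numbers; it is therefore compared, uniformly in x, with a scalar sequence times [Delta2]. The
    constant [C3] comes from expanding (4 b - c)^2 for Bernstein polynomials b of order m - 1 and c
    of order m/2 - 1: the squares produce central binomial coefficients, the cross product produces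
    C(3n, n). Stirling's constant is never computed, since Wallis' integrals eliminate it.
    Positivity of [C2] keeps the optimal order positive and the squared bias of exact order
    m^(-4). *)

Section Averaging.
Context {R : realType}.
Implicit Types (u v g r s d x y : nat -> R).

(** Multiplication by 1 + k S_n, with S_n a tail of the harmonic series, keeps the sequence below
    its initial value because (1 - k t) (1 + k (s + t)) <= 1 + k s. Divergence of S_n concludes. *)
Lemma near_contraction_cvg0 r d (k : R) : 0 < k ->
  (forall n, 0 <= r n) ->
  (\forall n \near \oo, r n <= (1 - d n) * r n.-1) ->
  (\forall n \near \oo, k / n%:R <= d n <= 1) ->
  r @ \oo --> 0.
Proof.
move=> k0 r0 [n0 _ rec] [n1 _ dk].
pose N := (maxn n0 n1).+1.
pose S n := \sum_(0 <= i < n) @harmonic R (N + i).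
have S0 n : 0 <= S n by apply: sumr_ge0 => i _; exact: harmonic_ge0.
have H n : r (N + n)%N * (1 + k * S n) <= r N.
  elim: n => [|n IH]; first by rewrite /S big_geq// mulr0 addr0 mulr1 addn0.
  apply: le_trans IH.
  have Nn0 : (n0 <= N + n.+1)%N by rewrite /N; lia.
  have Nn1 : (n1 <= N + n.+1)%N by rewrite /N; lia.
  have := rec _ Nn0; rewrite addnS /= => h1.
  have /andP[h2 h3] := dk _ Nn1; rewrite addnS in h2 h3.
  have -> : S n.+1 = S n + (N + n).+1%:R^-1.
    by rewrite /S big_nat_recr//= .
  set t := (N + n).+1%:R^-1; rewrite -/t in h2.
  have t0 : 0 <= t by rewrite invr_ge0.
  set q := r (N + n)%N in h1 *.
  have q0 : 0 <= q by exact: r0.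
  have Sn := S0 n.
  have h4 : r (N + n).+1 <= (1 - k * t) * q.
    by apply: le_trans h1 _; rewrite ler_wpM2r// lerB.
  have h5 : 0 <= 1 + k * (S n + t).
    by rewrite addr_ge0// mulr_ge0 ?addr_ge0// ltW.
  apply: le_trans (ler_wpM2r h5 h4) _.
  rewrite mulrAC [leRHS]mulrC ler_wpM2r//.
  have : 0 <= k * t by rewrite mulr_ge0// ltW.
  have : 0 <= k * S n by rewrite mulr_ge0// ltW.
  rewrite [k * (_ + _)]mulrDr; move: (k * S n) (k * t) => a b a0 b0; nra.
have Sy : S @ \oo --> +oo.
  apply/cvgryPge => A.
  (* Otherwise [S] stays below A, and the harmonic series would be bounded and hence convergent. *)
  have [//|h] := pselect (exists n, A <= S n); last first.
    exfalso; apply: (@dvg_harmonic R); apply: nondecreasing_is_cvgn.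
      by apply/nondecreasing_seqP => n; rewrite /series /= big_nat_recr//= lerDl.
    exists (series (@harmonic R) N + A) => _ [n _ <-].
    have : series (@harmonic R) n <= series (@harmonic R) (N + n).
      by rewrite /series /= (big_cat_nat (n := n) (p := (N+n)%N)) ?leq_addl//= lerDl sumr_ge0// => i _;
         exact: harmonic_ge0.
    move=> /le_trans; apply.
    rewrite /series /= (big_cat_nat (n := N) (p := (N+n)%N)) ?leq_addr//= lerD2l.
    have -> : \sum_(N <= i < N + n) (i.+1%:R^-1 : R) = S n.
      rewrite /S -{1}[N]add0n [(N+n)%N]addnC big_addn addnK.
      by apply: eq_bigr => i _; rewrite /= addnC.
    by apply/ltW; rewrite ltNge; apply/negP => ?; apply: h; exists n.
  move=> [n An]; exists n => // m /= nm; apply: le_trans An _.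
  rewrite /S (big_cat_nat (n := n) (p := m))//= lerDl sumr_ge0// => i _; exact: harmonic_ge0.
suff : r (n + N)%N @[n --> \oo] --> (0 : R) by rewrite cvg_shiftn.
apply: (@squeeze_cvgr _ _ _ _ (fun=> 0) (fun n => r N / k * (S n)^-1)); last 2 first.
- exact: cvg_cst.
- rewrite -[X in _ --> X](mulr0 (r N / k)); apply: cvgM; first exact: cvg_cst.
  apply/gtr0_cvgV0; last exact: Sy.
  by apply: (cvgryPgt _).1 Sy 0.
have : \forall n \near \oo, 0 < S n by apply: (cvgryPgt _).1 Sy 0.
apply: filterS => n Sn; rewrite r0 /= addnC -mulrA -invfM ler_pdivlMr ?mulr_gt0//.
apply: le_trans (H n); rewrite ler_wpM2l//.
by rewrite lerDr.
Qed.

(** Once s n <= e / 2, the excess of r over e / 2, truncated at 0, satisfies the pure contraction of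
    [near_contraction_cvg0]. *)
Lemma averaging_cvg0 r d s (k : R) : 0 < k ->
  (forall n, 0 <= r n) ->
  (\forall n \near \oo, r n <= (1 - d n) * r n.-1 + d n * s n) ->
  (\forall n \near \oo, k / n%:R <= d n <= 1) ->
  s @ \oo --> 0 -> r @ \oo --> 0.
Proof.
move=> k0 r0 rec dk s0.
apply/cvgrPdist_le => e e0.
pose t n := Num.max (r n - e / 2) 0.
have t0 : t @ \oo --> 0.
  apply: (@near_contraction_cvg0 t d k) => // [n|]; first by rewrite le_max lexx orbT.
  have se : \forall n \near \oo, s n <= e / 2.
    by apply: (cvgr_le 0); rewrite ?divr_gt0.
  near=> n.
  have h1 : r n <= (1 - d n) * r n.-1 + d n * s n by near: n.
  have /andP[h2 h3] : k / n%:R <= d n <= 1 by near: n.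
  have h4 : s n <= e / 2 by near: n.
  have d0 : 0 <= d n by apply: le_trans h2; rewrite divr_ge0// ltW.
  have d1 : 0 <= 1 - d n by rewrite subr_ge0.
  rewrite /t ge_max; apply/andP; split; last by rewrite mulr_ge0// le_max lexx orbT.
  apply: (@le_trans _ _ ((1 - d n) * (r n.-1 - e / 2))); last first.
    by rewrite ler_wpM2l// le_max lexx.
  have : d n * s n <= d n * (e / 2) by rewrite ler_wpM2l.
  lra.
have : \forall n \near \oo, t n <= e / 2 by apply: (cvgr_le 0); rewrite ?divr_gt0.
apply: filterS => n; rewrite /t ge_max => /andP[+ _].
rewrite sub0r normrN ger0_norm//; lra.
Unshelve. all: by end_near.
Qed.

End Averaging.

Section RegularVariation.
Context {R : realType}.
Implicit Types (u v g w x y : nat -> R).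

Lemma near_cvg u v (l : R) : u @ \oo --> l ->
  (\forall n \near \oo, u n = v n) -> v @ \oo --> l.
Proof. by move=> ul uv; apply: cvg_trans ul; exact: near_eq_cvg. Qed.

Lemma cvg_exprn u (l : R) (k : nat) : u @ \oo --> l ->
  u n ^+ k @[n --> \oo] --> l ^+ k.
Proof.
move=> ul; elim: k => [|k IH]; first exact: cvg_cst.
by rewrite exprS; under eq_fun do rewrite exprS; exact: cvgM.
Qed.

Lemma invn_cvg0 : (n%:R^-1 : R) @[n --> \oo] --> (0 : R).
Proof. by rewrite -cvg_shiftS; exact: cvg_harmonic. Qed.

Lemma near_gt0n : \forall n \near \oo, (0 < n)%N.
Proof. by exists 1%N. Qed.

Lemma GS_ratio_cvg1 (c : R) v : GS c v -> v n.-1 / v n @[n --> \oo] --> (1 : R).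
Proof.
move=> [v0 vc].
have -> : (1 : R) = 1 - c * 0 by rewrite mulr0 subr0.
apply: (near_cvg (cvgB (cvg_cst (1 : R)) (cvgM vc invn_cvg0))); near=> n.
have n0 : (n%:R : R) != 0 by rewrite pnatr_eq0 -lt0n; near: n; exact: near_gt0n.
by rewrite !fctE /= mulrAC mulfV// mul1r opprB addrC subrK.
Unshelve. all: by end_near. Qed.

Lemma GS_mul (a b : R) u v : GS a u -> GS b v -> GS (a + b) (fun n => u n * v n).
Proof.
move=> gu gv; have [u0 ua] := gu; have [v0 vb] := gv.
split=> [n n1|]; first by rewrite mulr_gt0 ?u0 ?v0.
have -> : a + b = a + 1 * b by rewrite mul1r.
apply: (near_cvg (cvgD ua (cvgM (GS_ratio_cvg1 gu) vb))); near=> n => /=.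
have n0 : (0 < n)%N by near: n; exact: near_gt0n.
have := u0 _ n0; have := v0 _ n0 => vn un.
by rewrite !fctE /=; field; rewrite !gt_eqF.
Unshelve. all: by end_near. Qed.

Lemma GS_cst (k : R) : 0 < k -> GS 0 (fun=> k).
Proof.
move=> k0; split=> //; rewrite divff ?gt_eqF// subrr.
under eq_fun do rewrite mulr0.
exact: cvg_cst.
Qed.

Lemma GS_scale (a k : R) v : 0 < k -> GS a v -> GS a (fun n => k * v n).
Proof. by move=> k0 gv; rewrite -[a]add0r; apply: GS_mul => //; exact: GS_cst. Qed.

(** s n is the difference quotient of the power function at 1, completed by its limit p so that the
    identity also holds when t n = 1. *)
Lemma powR_slope_cvg (p : R) (t : nat -> R) : t @ \oo --> (1 : R) ->
  exists2 s : nat -> R, s @ \oo --> p &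
    forall n, 1 - t n `^ p = s n * (1 - t n).
Proof.
move=> t1.
pose phi (h : R) : R := if h == 0 then p else h^-1 * ((h + 1) `^ p - 1).
have phic : phi @ 0 --> phi 0.
  apply/continuous_withinNx; rewrite {2}/phi eqxx.
  have [h1 h2] := is_derive1_powR p (@ltr01 R).
  move: h1; rewrite /derivable -/(derive _ _ _) h2 powR1 mulr1 => hl.
  apply: cvg_trans hl; apply: near_eq_cvg.
  near=> h; rewrite /phi /= ifF; last first.
    by apply/negbTE; near: h; exact: nbhs_dnbhs_neq.
  by rewrite [h%:A]mulr1.
exists (fun n => phi (t n - 1)).
  have : t n - 1 @[n --> \oo] --> (0 : R) by rewrite -(subrr 1); apply: cvgB => //; exact: cvg_cst.
  rewrite (_ : phi 0 = p) in phic; last by rewrite /phi eqxx.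
  by move=> h; exact: (cvg_comp _ _ h phic).
move=> n; rewrite /phi subr_eq0; case: eqVneq => [->|tn].
  by rewrite powR1 !subrr mulr0.
rewrite subrK; field.
by rewrite subr_eq0.
Unshelve. all: by end_near. Qed.

Lemma powRV (z p : R) : 0 <= z -> z^-1 `^ p = (z `^ p)^-1.
Proof. by move=> z0; rewrite -powRN -mulN1r powRrM powR_inv1. Qed.

(** Consecutive ratios tend to 1, so raising them to the power p multiplies their distance to 1
    asymptotically by p. *)
Lemma GS_powR (c p : R) v : GS c v -> GS (p * c) (fun n => v n `^ p).
Proof.
move=> gv; have [v0 vc] := gv.
have [s sp hs] := powR_slope_cvg p (GS_ratio_cvg1 gv).
split=> [n n1|]; first by rewrite powR_gt0 ?v0.
apply: (near_cvg (cvgM sp vc)); near=> n => /=.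
have n2 : (1 < n)%N by near: n; exists 2%N.
have vn := v0 n (ltnW n2).
have vn1 : 0 < v n.-1 by apply: v0; lia.
rewrite mulrCA -hs; congr (_ * (1 - _)).
by rewrite powRM ?invr_ge0 ?ltW// powRV ?ltW.
Unshelve. all: by end_near. Qed.

Lemma GS_cvg0 (c : R) v : c < 0 -> GS c v -> v @ \oo --> (0 : R).
Proof.
move=> c0 gv; have [v0 vc] := gv.
pose d n : R := 1 - v n / v n.-1.
have r1 := GS_ratio_cvg1 gv.
have r1' : v n / v n.-1 @[n --> \oo] --> (1 : R).
  rewrite -invr1; apply: (near_cvg (cvgV (oner_neq0 R) r1)).
  by apply: nearW => n; rewrite /= invf_div.
(* [GS] leaves v 0 unconstrained, whereas the contraction lemma needs nonnegative values
   everywhere. *)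
pose v' n := if n is 0%N then 1 else v n.
have vv' : \forall n \near \oo, v' n = v n by exists 1%N => // -[].
suff : v' @ \oo --> (0 : R).
  by move=> h; exact: near_cvg h vv'.
have d0 : d @ \oo --> (0 : R) by rewrite -(subrr 1); apply: cvgB => //; exact: cvg_cst.
have nd : n%:R * d n @[n --> \oo] --> - c.
  rewrite -[- c]mulr1; apply: (near_cvg (cvgM (cvgN vc) r1')).
  near=> n => /=.
  have n2 : (1 < n)%N by near: n; exists 2%N.
  have vn := v0 n (ltnW n2).
  have vn1 : 0 < v n.-1 by apply: v0; lia.
  by rewrite ?fctE /= /d; field; rewrite !gt_eqF.
apply: (@near_contraction_cvg0 _ _ d (- c / 2)).
- by rewrite divr_gt0// oppr_gt0.
- by case=> [|n]//=; rewrite ltW// v0.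
- exists 2%N => // -[|[|n]]//= _.
  by rewrite /d /= opprB addrC subrK divfK// gt_eqF// v0.
- near=> n; apply/andP; split; last by near: n; apply: (cvgr_le 0).
  rewrite ler_pdivrMr; last by rewrite ltr0n; near: n; exact: near_gt0n.
  by rewrite [leRHS]mulrC; near: n; apply: (cvgr_ge (- c)) => //; lra.
Unshelve. all: by end_near. Qed.

(* The ratio x / v satisfies, up to negligible terms, the averaging recursion with
   weights (j - c xi) g_n towards t / (j - c xi). *)
Lemma GS_recursion (c j t xi k al : R) (J : nat) g v x y : j = J%:R ->
  al < 0 -> GS al g -> 0 < k ->
  (n%:R * g n)^-1 @[n --> \oo] --> xi ->
  (\forall n \near \oo, k <= n%:R * g n) ->
  c * xi < j ->
  GS (- c) v ->
  (\forall n \near \oo, x n = (1 - g n) ^+ J * x n.-1 + g n * y n) ->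
  y n / v n @[n --> \oo] --> t ->
  x n / v n @[n --> \oo] --> t / (j - c * xi).
Proof.
move=> jE al0 gg k0 gxi gk cxi gv rec yv.
have [g0 _] := gg; have [v0 vc] := gv.
have gto0 : g @ \oo --> (0 : R) by exact: GS_cvg0 gg.
pose D := j - c * xi; have D0 : 0 < D by rewrite subr_gt0.
set l := t / (j - c * xi).
(* Dividing the recursion by v n makes A n the coefficient of the previous ratio x n.-1 / v n.-1. *)
pose A n : R := (1 - g n) ^+ J * (v n.-1 / v n).
have gpos : \forall n \near \oo, 0 < g n by exists 1%N.
(* A finite geometric sum: (1 - z^J) / (1 - z) tends to J as z = 1 - g n tends to 1. *)
have slope : (1 - (1 - g n) ^+ J) / g n @[n --> \oo] --> j.
  have : \sum_(i < J) (1 - g n) ^+ i @[n --> \oo] --> j.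
    rewrite jE -[X in _ --> X](_ : \sum_(i < J) (1 : R) = _); last by rewrite sumr_const card_ord.
    apply: cvg_big => [|i _]; first exact: add_continuous.
    rewrite -[1 in X in _ --> X](expr1n R i).
    apply: cvg_exprn.
    by rewrite -[1 in X in _ --> X]subr0; apply: cvgB => //; exact: cvg_cst.
  move=> /near_cvg; apply; near=> n => /=.
  have gn : 0 < g n by near: n.
  by rewrite -[1 - _ ^+ J]opprB subrX1; set S := \sum_(_ < _) _; field; rewrite gt_eqF.
have oneg : (1 - g n) ^+ J @[n --> \oo] --> (1 : R).
  rewrite -[1 in X in _ --> X](expr1n R J).
  apply: cvg_exprn.
  by rewrite -[1 in X in _ --> X]subr0; apply: cvgB => //; exact: cvg_cst.
(* 1 - A n splits into 1 - (1 - g n)^J and (1 - g n)^J (1 - v n.-1 / v n). Divided by g n, the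
   second part is n (1 - v n.-1 / v n) times (n g n)^-1, whose limit is - c xi. *)
have AD : (1 - A n) / g n @[n --> \oo] --> D.
  have -> : D = j + 1 * (- c * xi) by rewrite mul1r mulNr.
  apply: (near_cvg (cvgD slope (cvgM oneg (cvgM vc gxi)))); near=> n => /=.
  have gn : 0 < g n by near: n.
  have nn : (n%:R : R) != 0 by rewrite pnatr_eq0 -lt0n; near: n; exact: near_gt0n.
  have vn : 0 < v n by apply: v0; near: n; exact: near_gt0n.
  rewrite fctE /= /A; move: (_ ^+ J) => q; field.
  by rewrite nn !gt_eqF.
(* The forcing term g n * y n / v n equals 1 - A n times (y n / v n) / ((1 - A n) / g n), so s n
   measures how far the quantity being averaged is from l. *)
pose s n : R := `| (y n / v n) / ((1 - A n) / g n) - l |.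
have s0 : s @ \oo --> (0 : R).
  rewrite -(normr0 R) -(subrr l); apply: cvg_norm; apply: cvgB; last exact: cvg_cst.
  by apply: cvgM => //; apply: cvgV => //; rewrite gt_eqF.
have AD0 : \forall n \near \oo, 0 < (1 - A n) / g n by exact: (cvgr_gt D AD _ D0).
have AD2 : \forall n \near \oo, D / 2 <= (1 - A n) / g n.
  by apply: (cvgr_ge D AD); lra.
have A1 : A @ \oo --> (1 : R) by rewrite -[1 in X in _ --> X]mulr1; apply: cvgM => //; exact: GS_ratio_cvg1 gv.
pose r n : R := `| x n / v n - l |.
suff r0 : r @ \oo --> (0 : R).
  have /norm_cvg0P h : (r @ \oo --> (0:R)) := r0.
  rewrite -[l]add0r; apply: (near_cvg (cvgD h (cvg_cst l))).
  by apply: nearW => n; rewrite fctE /= subrK.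
apply: (@averaging_cvg0 _ r (fun n => 1 - A n) s (D / 2 * k)).
- by rewrite mulr_gt0// divr_gt0.
- by move=> n; rewrite normr_ge0.
- near=> n.
  have n2 : (1 < n)%N by near: n; exists 2%N.
  have vn := v0 n (ltnW n2).
  have vn1 : 0 < v n.-1 by apply: v0; lia.
  have gn : 0 < g n by near: n.
  have A0 : 0 <= A n by near: n; apply: (cvgr_ge 1).
  have A1' : 0 < (1 - A n) / g n by near: n; exact: AD0.
  have {}A1' : 0 < 1 - A n by move: A1'; rewrite pmulr_lgt0// invr_gt0.
  have xn : x n = (1 - g n) ^+ J * x n.-1 + g n * y n by near: n.
  have -> : r n = `| A n * (x n.-1 / v n.-1 - l) + (1 - A n) * ((y n / v n) / ((1 - A n) / g n) - l)|.
    rewrite /r xn; congr (`|_|).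
    move: A1'; rewrite /A; move: (_ ^+ J) => q A1'; field.
    have q1 : 0 < v n - q * v n.-1.
      by move: A1'; rewrite -(pmulr_rgt0 _ vn) mulrBr mulr1 mulrCA (mulrCA (v n)) mulfV ?gt_eqF// mulr1.
    by rewrite !gt_eqF.
  rewrite subKr; apply: le_trans (ler_normD _ _) _.
  by apply: lerD; rewrite normrM ?(ger0_norm A0) ?(gtr0_norm A1').
- near=> n.
  have gn : 0 < g n by near: n.
  have kg : k <= n%:R * g n by near: n.
  have n0 : (0 : R) < n%:R by rewrite ltr0n; near: n; exact: near_gt0n.
  have A0 : 0 <= A n by near: n; apply: (cvgr_ge 1).
  have A1' : D / 2 <= (1 - A n) / g n by near: n; exact: AD2.
  rewrite gerBl A0 andbT; move: A1'; rewrite ler_pdivlMr// => A1'; apply: le_trans A1'.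
  by rewrite -mulrA ler_wpM2l// ?divr_ge0 ?(ltW D0)// ler_pdivrMr// mulrC.
- exact: s0.
Unshelve. all: by end_near. Qed.

End RegularVariation.

(** * The limit of 1 / (n g_n), for a finite or infinite limit of n g_n *)

Section Stepsize.
Context {R : realType}.

(** xi is 1 / L for finite L and 0 for infinite L. In both cases a threshold c < L becomes c xi < 1,
    which is what makes the denominators j - c xi positive. *)
Lemma stepsize_inv_cvg (g : nat -> R) (L : \bar R) (c0 : R) :
  0 <= c0 -> (c0%:E < L)%E -> (n%:R * g n)%:E @[n --> \oo] --> L ->
  exists xi, [/\ (n%:R * g n)^-1 @[n --> \oo] --> xi, 0 <= xi,
    (exists2 k, 0 < k & \forall n \near \oo, k <= n%:R * g n)
    & forall c, (c%:E < L)%E -> c * xi < 1].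
Proof.
move=> c00; case: L => [l| |] //.
- rewrite lte_fin => cl /fine_cvgP[_ ul].
  have l0 : 0 < l by apply: le_lt_trans cl.
  exists l^-1; split.
  + by apply: cvgV => //; rewrite gt_eqF.
  + by rewrite invr_ge0 ltW.
  + exists (l / 2); first by rewrite divr_gt0.
    by apply: (cvgr_ge l ul); lra.
  + by move=> c; rewrite lte_fin => cl'; rewrite ltr_pdivrMr// mul1r.
- move=> _ /cvgeryP ul.
  exists 0; split => //.
  + by apply/gtr0_cvgV0; [exact: (cvgryPgt _).1 ul 0 | exact: ul].
  + by exists 1 => //; exact: (cvgryPge _).1 ul 1.
  + by move=> c _; rewrite mulr0 ltr01.
Qed.

End Stepsize.

(** * Stirling formula and central binomial coefficients *)

Section PointwiseDerivatives.
Context {R : realType}.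
Implicit Types (f g : R -> R) (x a b c : R).

Lemma is_derive_addf f g x a b : is_derive x 1 f a -> is_derive x 1 g b ->
  is_derive x 1 (fun y => f y + g y) (a + b).
Proof. exact: is_deriveD. Qed.

Lemma is_derive_subf f g x a b : is_derive x 1 f a -> is_derive x 1 g b ->
  is_derive x 1 (fun y => f y - g y) (a - b).
Proof. exact: is_deriveB. Qed.

Lemma is_derive_mulf f g x a b : is_derive x 1 f a -> is_derive x 1 g b ->
  is_derive x 1 (fun y => f y * g y) (f x * b + g x * a).
Proof. exact: is_deriveM. Qed.

Lemma is_derive_expf f x a (n : nat) : is_derive x 1 f a ->
  is_derive x 1 (fun y => f y ^+ n) (n%:R * f x ^+ n.-1 * a).
Proof.
move=> fa; have /is_derive_eq := is_deriveX n fa.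
rewrite (_ : f ^+ n = fun y => f y ^+ n); last by apply/funext => y; rewrite fctE.
by apply.
Qed.

Lemma is_derive_cstf c x : is_derive x 1 (fun=> c) (0 : R).
Proof. exact: is_derive_cst. Qed.

Lemma is_derive_idf x : is_derive x 1 (fun y : R => y) (1 : R).
Proof. exact: is_derive_id. Qed.

Lemma is_derive_compf f g x a b : is_derive x 1 g b -> is_derive (g x) 1 f a ->
  is_derive x 1 (fun y => f (g y)) (b * a).
Proof. by move=> h1 h2; rewrite mulrC; exact: (@is_derive1_comp R f g x _ _ h2 h1). Qed.

End PointwiseDerivatives.

Ltac derive_step := first [ eapply is_derive_cstf | eapply is_derive_idf
  | eassumption | eapply is_derive_subf | eapply is_derive_addf
  | eapply is_derive_mulf | eapply is_derive_expf ].
Ltac derive_auto := eapply is_derive_eq; [repeat derive_step | ].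

Section Stirling.
Context {R : realType}.

Lemma nonneg_of_derive (h h' : R -> R) (t : R) : 0 <= t -> h 0 = 0 ->
  (forall x : R, 0 <= x -> is_derive x (1 : R) h (h' x)) ->
  (forall x : R, 0 <= x -> 0 <= h' x) -> 0 <= h t.
Proof.
move=> t0 h0 dh h'0.
have hc : {within `[0, t], continuous h}.
  apply: derivable_within_continuous => x /andP[x0 _].
  by have [] := dh x x0.
have dh' x : x \in `]0, t[ -> is_derive x 1 h (h' x).
  by rewrite in_itv/= => /andP[x0 _]; apply: dh; rewrite ltW.
have [c] := MVT_segment t0 dh' hc; rewrite in_itv/= => /andP[c0 _].
by rewrite h0 !subr0 => ->; rewrite mulr_ge0// h'0.
Qed.

Lemma is_derive_ln1D (x : R) : 0 < 1 + x ->
  is_derive x (1 : R) (fun y => ln (1 + y)) (1 + x)^-1.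
Proof.
move=> x0; have h := is_derive1_ln x0.
apply: (is_derive_eq (is_derive_compf (g := fun y => 1 + y) _ h)).
by rewrite add0r !mul1r.
Qed.

(** The derivative of the difference is ln (1 + x) - x / (1 + x), which is nonnegative by ln (1 + z)
    <= z at z = - x / (1 + x). *)
Lemma ln1D_lower (t : R) : 0 <= t -> 2 * t <= (2 + t) * ln (1 + t).
Proof.
move=> t0; rewrite -subr_ge0.
pose h' (x : R) : R := ln (1 + x) - x / (1 + x).
apply: (@nonneg_of_derive (fun x => (2 + x) * ln (1 + x) - 2 * x) h') => //.
- by rewrite !addr0 ln1 !mulr0 subrr.
- move=> x x0; have x1 : 0 < 1 + x by rewrite ltr_pwDl.
  have h := is_derive_ln1D x1.
  derive_auto; rewrite /h' /=; field.
  by rewrite !gt_eqF.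
- move=> x x0; have x1 : 0 < 1 + x by rewrite ltr_pwDl.
  have : ln (1 + - (x / (1 + x))) <= - (x / (1 + x)).
    by apply: le_ln1Dx; rewrite ltrN2 ltr_pdivrMr// mul1r ltrDr.
  have -> : 1 + - (x / (1 + x)) = (1 + x)^-1 by field; rewrite gt_eqF.
  by rewrite lnV ?posrE// /h'; lra.
Qed.

(** The derivative of the difference is x^3 / (1 + x). *)
Lemma ln1D_upper (t : R) : 0 <= t -> ln (1 + t) <= t - t ^+ 2 / 2 + t ^+ 3 / 3.
Proof.
move=> t0; rewrite -subr_ge0.
pose h' (x : R) : R := x ^+ 3 / (1 + x).
apply: (@nonneg_of_derive (fun x => x - x ^+ 2 / 2 + x ^+ 3 / 3 - ln (1 + x)) h' _ t0).
- by rewrite addr0 ln1 !expr0n/= !mul0r !subr0 add0r.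
- move=> x x0; have x1 : 0 < 1 + x by rewrite ltr_pwDl.
  have h := is_derive_ln1D x1.
  derive_auto; rewrite /h' /=; field.
  by rewrite !gt_eqF.
- by move=> x x0; rewrite /h' divr_ge0// ?exprn_ge0// addr_ge0.
Qed.

(** Logarithm of (n + 1)! divided by (n + 1)^(n + 3/2) e^(-(n + 1)). The index is shifted to stay
    away from ln 0. *)
Definition lnfact_err (n : nat) : R :=
  ln n.+1`!%:R - (n.+1%:R + 2^-1) * ln n.+1%:R + n.+1%:R.

Lemma lnfact_err_step n : lnfact_err n - lnfact_err n.+1 =
  (n.+1%:R + 2^-1) * ln (1 + n.+1%:R^-1) - 1.
Proof.
have n1 : (n.+1%:R : R) \is Num.pos by rewrite posrE.
have n2 : (n.+2%:R : R) \is Num.pos by rewrite posrE.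
have -> : 1 + n.+1%:R^-1 = n.+2%:R / n.+1%:R :> R.
  by rewrite -(natr1 n.+1) mulrDl mul1r divff// pnatr_eq0.
rewrite ln_div// /lnfact_err (factS n.+1) natrM lnM ?posrE ?ltr0n ?fact_gt0//.
by rewrite -(natr1 n.+1); ring.
Qed.

(** The sequence decreases by [ln1D_lower], and by [ln1D_upper] its steps are at most half of 1 / (n
    + 1) - 1 / (n + 2), which telescopes to a lower bound. *)
Lemma lnfact_err_cvg : exists l : R, lnfact_err @ \oo --> l.
Proof.
have st n : lnfact_err n.+1 <= lnfact_err n /\
    lnfact_err n - lnfact_err n.+1 <= 2^-1 * (n.+1%:R^-1 - n.+2%:R^-1).
  have n1 : 0 < (n.+1%:R : R) by rewrite ltr0n.
  have n1' : 1 <= (n.+1%:R : R) by rewrite ler1n.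
  have e2 : n.+2%:R = n.+1%:R + 1 :> R by rewrite natr1.
  rewrite -subr_ge0 lnfact_err_step e2; move: n1 n1' => {e2}; set x : R := n.+1%:R => n1 n1'.
  have x0 : 0 <= x^-1 by rewrite invr_ge0 ltW.
  have k : 0 < x + 2^-1 by rewrite addr_gt0.
  split.
    rewrite subr_ge0 -(ler_pM2l (_ : 0 < 2 * x^-1)); last by rewrite mulr_gt0// invr_gt0.
    rewrite mulr1 mulrA.
    have -> : 2 * x^-1 * (x + 2^-1) = 2 + x^-1 by field; rewrite gt_eqF.
    exact: ln1D_lower.
  have := ln1D_upper x0; rewrite -(ler_pM2l k) -(lerD2r (-1)) => /le_trans; apply.
  rewrite -subr_ge0.
  (* The numerator on the right factors as (5 x + 2) (x - 1), and x >= 1. *)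
  have -> : 2^-1 * (x^-1 - (x + 1)^-1) -
     ((x + 2^-1) * (x^-1 - x^-1 ^+ 2 / 2 + x^-1 ^+ 3 / 3) - 1) =
     (5 * x ^+ 2 - 3 * x - 2) / (12 * x ^+ 3 * (x + 1)).
    field; rewrite !gt_eqF//=; lra.
  apply: divr_ge0; last by rewrite !mulr_ge0 ?exprn_ge0//; lra.
  nra.
have lb n : lnfact_err 0 - 2^-1 + 2^-1 * n.+1%:R^-1 <= lnfact_err n.
  elim: n => [|n IH]; first by rewrite invr1; lra.
  by move: IH (st n).2; move: (n.+1%:R^-1) (n.+2%:R^-1) => a b; lra.
apply/cvg_ex; apply: nonincreasing_is_cvgn.
  by apply/nonincreasing_seqP => n; have [] := st n.
exists (lnfact_err 0 - 2^-1) => _ [n _ <-]; apply: le_trans (lb n).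
by rewrite lerDl mulr_ge0// invr_ge0.
Qed.

End Stirling.

(** * Wallis integrals and the growth of C(2n, n) and C(3n, n) *)

Section Wallis.
Context {R : realType}.
Local Notation mu := (@lebesgue_measure R).

Lemma continuous_integrable_itv (f : R -> R) (a b : R) :
  {within `[a, b], continuous f} -> mu.-integrable `[a, b] (EFin \o f).
Proof. by move=> cf; apply: continuous_compact_integrable => //; exact: segment_compact. Qed.

Lemma Rintegral_FTC2 (f F : R -> R) (a b : R) : a < b -> continuous f ->
  (forall x : R, is_derive x (1 : R) F (f x)) ->
  \int[mu]_(x in `[a, b]) f x = F b - F a.
Proof.
move=> ab cf dF.
have dF' x : derivable F x 1 by have [] := dF x.
rewrite /Rintegral (@continuous_FTC2 R f F)//.
- exact: continuous_subspaceT.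
- have cF : continuous F by move=> x; apply/differentiable_continuous/derivable1_diffP.
  split=> [x _||]; first exact: dF'.
  + exact/cvg_at_right_filter/cF.
  + exact/cvg_at_left_filter/cF.
- by move=> x _; rewrite derive1E derive_val.
Qed.

Definition wallis (n : nat) : R := \int[mu]_(x in `[0, pi / 2]) (sin x ^+ n).

Lemma continuous_sinX n : continuous (fun x : R => sin x ^+ n).
Proof.
move=> x; apply: (@continuous_comp _ _ _ sin (fun y : R => y ^+ n)); first exact: continuous_sin.
exact: exprn_continuous.
Qed.

Lemma integrable_sinX n : mu.-integrable `[0, pi / 2] (EFin \o (fun x : R => sin x ^+ n)).
Proof. by apply: continuous_integrable_itv; apply: continuous_subspaceT; exact: continuous_sinX. Qed.

Lemma pihalf_gt0 : (0 : R) < pi / 2.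
Proof. by rewrite divr_gt0// pi_gt0. Qed.

Lemma wallisSS n : n.+2%:R * wallis n.+2 = n.+1%:R * wallis n.
Proof.
apply/esym/eqP; rewrite -subr_eq0 /wallis -!RintegralZl//; try exact: integrable_sinX.
rewrite -RintegralB//; last 2 first.
- apply: continuous_integrable_itv; apply: continuous_subspaceT => x.
  by apply: cvgM; [exact: cvg_cst | exact: continuous_sinX].
- apply: continuous_integrable_itv; apply: continuous_subspaceT => x.
  by apply: cvgM; [exact: cvg_cst | exact: continuous_sinX].
have cf : continuous (fun x : R => n.+1%:R * sin x ^+ n - n.+2%:R * sin x ^+ n.+2).
  by move=> x; apply: cvgB; apply: cvgM; try exact: cvg_cst; exact: continuous_sinX.
(* Integration by parts in antiderivative form: this function vanishes at both 0 and pi / 2. *)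
have dF (x : R) : is_derive x 1 (fun x => cos x * sin x ^+ n.+1)
    (n.+1%:R * sin x ^+ n - n.+2%:R * sin x ^+ n.+2).
  have h1 := is_derive_sin x; have h2 := is_derive_cos x.
  derive_auto => /=.
  have := cos2sin2 x; rewrite expr2 => h.
  rewrite [cos x * (_ * _ * _)]mulrC -!mulrA h !exprS.
  by rewrite -[n.+2%:R]natr1; ring.
rewrite (Rintegral_FTC2 pihalf_gt0 cf dF).
by rewrite cos_pihalf sin0 expr0n /= mul0r mulr0 subrr.
Qed.

Lemma wallis0 : wallis 0 = pi / 2.
Proof.
have dF (x : R) : is_derive x 1 id (sin x ^+ 0) by exact: is_derive_id.
by rewrite /wallis (Rintegral_FTC2 pihalf_gt0 (@continuous_sinX 0) dF) subr0.
Qed.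

Lemma wallis1 : wallis 1 = 1.
Proof.
have dF (x : R) : is_derive x 1 (- cos) (sin x ^+ 1).
  by rewrite expr1 -[sin x]opprK; exact: is_deriveN.
rewrite /wallis (Rintegral_FTC2 pihalf_gt0 (@continuous_sinX 1) dF).
by rewrite !fctE cos_pihalf cos0 opprK oppr0 add0r.
Qed.

Lemma wallis_le n : wallis n.+1 <= wallis n.
Proof.
apply: le_Rintegral => //; try exact: integrable_sinX.
move=> x /=; rewrite in_itv/= => /andP[x0 xp].
rewrite exprS ler_piMl ?sin_le1//.
rewrite exprn_ge0//; move: x0; rewrite le_eqVlt => /predU1P[<-|x0]; first by rewrite sin0.
move: xp; rewrite le_eqVlt => /predU1P[->|xp]; first by rewrite sin_pihalf.
by rewrite ltW// sin_gt0_pihalf// x0.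
Qed.

(** The factor 4^(-n) removes the exponential growth; [cbin n] behaves like (pi n)^(-1/2). *)
Definition cbin (n : nat) : R := 'C(n.*2, n)%:R / 4 ^+ n.

Lemma binR (m k : nat) : 'C(m + k, k)%:R = (m + k)`!%:R / (k`!%:R * m`!%:R) :> R.
Proof.
have := bin_fact (leq_addl m k); rewrite addnK => <-.
rewrite natrM mulrAC natrM mulrC; field.
by rewrite !pnatr_eq0 -!lt0n !fact_gt0.
Qed.

Lemma factR_neq0 n : n`!%:R != 0 :> R.
Proof. by rewrite pnatr_eq0 -lt0n fact_gt0. Qed.

Lemma cbin_gt0 n : 0 < cbin n.
Proof. by rewrite divr_gt0 ?exprn_gt0// ltr0n bin_gt0; lia. Qed.

Lemma cbinS n : n.+1.*2%:R * cbin n.+1 = n.*2.+1%:R * cbin n.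
Proof.
rewrite /cbin -!addnn !binR addSn addnS !factS !natrM exprS.
have e1 : (n + n).+2%:R = 2 * n.+1%:R :> R by rewrite -natrM; congr (_%:R); lia.
rewrite e1; field.
by rewrite factR_neq0 nat1r expf_neq0 ?pnatr_eq0.
Qed.

Lemma wallis_even n : wallis n.*2 = pi / 2 * cbin n.
Proof.
elim: n => [|n IH]; first by rewrite wallis0 /cbin bin0 expr0 divr1 mulr1.
apply: (mulfI (_ : n.+1.*2%:R != 0)); first by rewrite pnatr_eq0.
by rewrite mulrCA cbinS doubleS wallisSS IH; ring.
Qed.

Lemma wallis_odd n : n.*2.+1%:R * cbin n * wallis n.*2.+1 = 1.
Proof.
elim: n => [|n IH]; first by rewrite wallis1 /cbin bin0 expr0 divr1 !mulr1.
by rewrite mulrAC doubleS wallisSS mulrAC -[n.*2.+2]doubleS cbinS.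
Qed.

(** Monotonicity of the Wallis integrals, used between the indices 2n and 2n + 1 for the lower bound
    and between 2n - 1 and 2n for the upper one. *)
Lemma cbin_bounds n : 2 / pi <= n.*2.+1%:R * cbin n ^+ 2 /\ n%:R * cbin n ^+ 2 <= pi^-1.
Proof.
have p0 := @pi_gt0 R.
have c0 := cbin_gt0 n.
split.
  have := wallis_le n.*2; rewrite wallis_even => h.
  rewrite ler_pdivrMr//.
  have : n.*2.+1%:R * cbin n * wallis n.*2.+1 <= n.*2.+1%:R * cbin n * (pi / 2 * cbin n).
    by rewrite ler_wpM2l// mulr_ge0// ltW.
  by rewrite wallis_odd expr2; lra.
case: n c0 => [|n] c0; first by rewrite mul0r invr_ge0 ltW.
have := wallis_le n.*2.+1; rewrite -doubleS wallis_even => h.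
have : n.*2.+1%:R * cbin n * (pi / 2 * cbin n.+1) <= n.*2.+1%:R * cbin n * wallis n.*2.+1.
  by rewrite ler_wpM2l// mulr_ge0// ltW// cbin_gt0.
rewrite wallis_odd -cbinS -muln2 natrM expr2.
move: (cbin n.+1) => c; set m : R := n.+1%:R => k.
by rewrite -(ler_pM2r p0) mulVf ?gt_eqF//; lra.
Qed.

Lemma cbin_sqr_cvg : n%:R * cbin n ^+ 2 @[n --> \oo] --> (pi^-1 : R).
Proof.
apply: (@squeeze_cvgr _ _ _ _ (fun n => (pi^-1) * (1 - (n.*2.+1%:R)^-1)) (fun=> pi^-1)); last 2 first.
- rewrite -[X in _ --> X]mulr1; apply: cvgM; first exact: cvg_cst.
  rewrite -[X in _ --> X]subr0; apply: cvgB; first exact: cvg_cst.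
  apply: (@squeeze_cvgr _ _ _ _ (fun=> 0) (fun n => n.+1%:R^-1)); first last.
  + exact: cvg_harmonic.
  + exact: cvg_cst.
  + by apply: nearW => n; rewrite invr_ge0 ler0n /= lef_pV2 ?posrE ?ltr0n// ler_nat; lia.
- exact: cvg_cst.
apply: nearW => n; have [h1 ->] := cbin_bounds n; rewrite andbT.
have p0 := @pi_gt0 R.
have n0 : (0 : R) < n.*2.+1%:R by rewrite ltr0n.
have e : n.*2.+1%:R = 2 * n%:R + 1 :> R by rewrite -natr1 -muln2 natrM mulrC.
have -> : pi^-1 * (1 - (n.*2.+1%:R)^-1) = n%:R * (2 / pi) / n.*2.+1%:R :> R.
  rewrite e in n0 *; field.
  by apply/andP; split; rewrite gt_eqF//; lra.
by rewrite ler_pdivrMr// -(mulrA n%:R) ler_wpM2l// [leRHS]mulrC.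
Qed.

(** C(3n, n) grows like (27/4)^n; after scaling, [tbin n] behaves like (3 / (4 pi n))^(1/2). *)
Definition tbin (n : nat) : R := 'C(3 * n, n)%:R * (4 / 27) ^+ n.

Lemma lnfactE n : ln n.+1`!%:R = lnfact_err n + (n.+1%:R + 2^-1) * ln n.+1%:R - n.+1%:R :> R.
Proof. by rewrite /lnfact_err; ring. Qed.

Lemma factR_gt0 n : (0 : R) < n`!%:R.
Proof. by rewrite ltr0n fact_gt0. Qed.

(** All terms in k and k ln k cancel, which leaves only Stirling errors and a constant. The same
    happens in [ln_tbin]. *)
Lemma ln_cbin k : ln (k.+1%:R * cbin k.+1 ^+ 2) =
  2 * (lnfact_err k.*2.+1 - 2 * lnfact_err k) + ln 2.
Proof.
have n0 : (0 : R) < k.+1%:R by rewrite ltr0n.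
have f2 := factR_gt0 k.*2.+2; have f1 := factR_gt0 k.+1.
have e4 : ln (4 : R) = 2 * ln 2.
  by rewrite (_ : 4 = 2 * 2) ?lnM ?posrE//; [ring|rewrite -natrM].
have e2 : k.*2.+2%:R = 2 * k.+1%:R :> R by rewrite -natrM mul2n.
rewrite /cbin -addnn binR addnn doubleS lnM ?posrE ?exprn_gt0 ?mulr_gt0 ?invr_gt0 ?exprn_gt0 ?mulr_gt0//.
rewrite lnXn ?mulr_gt0 ?invr_gt0 ?exprn_gt0 ?mulr_gt0//.
rewrite ln_div ?posrE ?mulr_gt0 ?invr_gt0 ?exprn_gt0 ?mulr_gt0//.
rewrite ln_div ?posrE ?mulr_gt0//.
rewrite lnM ?posrE// !lnfactE lnXn// e4 e2 lnM ?posrE//.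
rewrite -[_ *+ 2]mulr_natr -[_ * _ *+ k.+1]mulr_natr; move: (lnfact_err k.*2.+1) (lnfact_err k) (ln (2 : R)).
by move: (ln (k.+1%:R : R)) (k.+1%:R : R) => a b c d e; field.
Qed.

Lemma ln_tbin k : ln (k.+1%:R * tbin k.+1 ^+ 2) =
  2 * (lnfact_err (3 * k)%N.+2 - lnfact_err k - lnfact_err k.*2.+1) + ln (3 / 2).
Proof.
have n0 : (0 : R) < k.+1%:R by rewrite ltr0n.
have f2 := factR_gt0 k.*2.+2; have f1 := factR_gt0 k.+1; have f3 := factR_gt0 (3 * k)%N.+3.
have e4 : ln (4 : R) = 2 * ln 2.
  by rewrite (_ : 4 = 2 * 2) ?lnM ?posrE//; [ring|rewrite -natrM].
have e27 : ln (27 : R) = 3 * ln 3.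
  by rewrite (_ : 27 = 3 * 3 * 3) ?lnM ?posrE ?mulr_gt0//; [ring|rewrite -!natrM].
have e2 : k.*2.+2%:R = 2 * k.+1%:R :> R by rewrite -natrM mul2n.
have e3 : (3 * k)%N.+3%:R = 3 * k.+1%:R :> R by rewrite -natrM; congr (_%:R); lia.
have e1 : (3 * k.+1 = k.*2.+2 + k.+1)%N by lia.
have e1' : (k.*2.+2 + k.+1)%N = (3 * k)%N.+3 by lia.
rewrite /tbin e1 binR e1'.
rewrite lnM ?posrE ?exprn_gt0 ?mulr_gt0 ?invr_gt0 ?exprn_gt0 ?mulr_gt0//.
rewrite lnXn ?mulr_gt0 ?invr_gt0 ?exprn_gt0 ?mulr_gt0//.
rewrite lnM ?posrE ?mulr_gt0 ?invr_gt0 ?exprn_gt0 ?mulr_gt0//.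
rewrite ln_div ?posrE ?mulr_gt0// lnXn ?mulr_gt0//.
rewrite lnM ?posrE// !lnfactE !ln_div ?posrE// e4 e27 e2 e3 !lnM ?posrE//.
rewrite -[_ *+ 2]mulr_natr -[(_ - _) *+ k.+1]mulr_natr; move: (lnfact_err _) (lnfact_err k.*2.+1) (lnfact_err k) (ln (3 : R)) (ln (2 : R)).
by move: (ln (k.+1%:R : R)) (k.+1%:R : R) => a b c d e f g; field.
Qed.

Lemma cvg_sub (u : nat -> R) (l : R) (h : nat -> nat) : (forall n, n <= h n)%N ->
  u @ \oo --> l -> u (h n) @[n --> \oo] --> l.
Proof.
move=> hn ul; apply: (cvg_comp h u _ ul).
by move=> A [N _ NA]; exists N => // n /= Nn; apply: NA => /=; exact: leq_trans (hn n).
Qed.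

Lemma expR_cvg (u : nat -> R) (l : R) : u @ \oo --> l -> expR (u n) @[n --> \oo] --> expR l.
Proof. by move=> ul; exact: (cvg_comp u expR ul (@continuous_expR R l)). Qed.

Lemma tbin_gt0 n : 0 < tbin n.
Proof. by rewrite mulr_gt0 ?exprn_gt0// ltr0n bin_gt0; lia. Qed.

(** With l the unknown limit of [lnfact_err], the Stirling errors contribute - 2 l to the logarithm
    for both C(2n, n) and C(3n, n). The value 1 / pi from Wallis for the former thus fixes the
    constant of the latter. *)
Lemma tbin_sqr_cvg : n%:R * tbin n ^+ 2 @[n --> \oo] --> (3 / 4 / pi : R).
Proof.
have [l ll] := @lnfact_err_cvg R.
have l2 := @cvg_sub _ _ (fun k => k.*2.+1) (ltac:(move=> n; lia)) ll.
have l3 := @cvg_sub _ _ (fun k => (3 * k)%N.+2) (ltac:(move=> n; lia)) ll.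
have c1 : k.+1%:R * cbin k.+1 ^+ 2 @[k --> \oo] --> expR (2 * (l - 2 * l) + ln 2).
  apply: (near_cvg (expR_cvg (cvgD (cvgM (cvg_cst (2 : R)) (cvgB l2 (cvgM (cvg_cst (2 : R)) ll))) (cvg_cst (ln 2 : R))))).
  apply: nearW => k; rewrite !fctE /= -ln_cbin lnK// posrE mulr_gt0 ?exprn_gt0 ?cbin_gt0//.
have t1 : k.+1%:R * tbin k.+1 ^+ 2 @[k --> \oo] --> expR (2 * (l - l - l) + ln (3 / 2)).
  apply: (near_cvg (expR_cvg (cvgD (cvgM (cvg_cst (2 : R)) (cvgB (cvgB l3 ll) l2)) (cvg_cst (ln (3 / 2) : R))))).
  apply: nearW => k; rewrite !fctE /= -ln_tbin lnK// posrE mulr_gt0 ?exprn_gt0 ?tbin_gt0//.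
have e : expR (2 * (l - 2 * l) + ln 2) = pi^-1.
  have h : k.+1%:R * cbin k.+1 ^+ 2 @[k --> \oo] --> (pi^-1 : R).
    by rewrite (cvg_shiftS (fun k => k%:R * cbin k ^+ 2)); exact: cbin_sqr_cvg.
  by rewrite -(cvg_lim _ c1)// -(cvg_lim _ h).
have -> : 3 / 4 / pi = expR (2 * (l - l - l) + ln (3 / 2)) :> R.
  rewrite expRD lnK ?posrE ?divr_gt0//.
  move: e; rewrite expRD lnK ?posrE//.
  have -> : 2 * (l - 2 * l) = 2 * (l - l - l) by ring.
  by move=> <-; field.
by rewrite -(cvg_shiftS (fun k => k%:R * tbin k ^+ 2)).
Qed.

End Wallis.

(** * Taylor expansion on [0, 1] and binomial moments *)

Section Derivative01.
Context {R : realType}.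
Implicit Types (f g h : R -> R) (x y z : R).
Local Notation mu := (@lebesgue_measure R).

Definition derivable01_in f := forall x, x \in `[0, 1] -> derivable01 f x.

Lemma diffquot_cvg f x : derivable01 f x -> forall e, 0 < e ->
  exists2 d : R, 0 < d & forall y, y \in `[0, 1] -> y != x -> `|y - x| < d ->
    `|diffquot f x y - der01 f x| <= e.
Proof.
move=> fx e e0.
have /cvgrPdist_le /(_ _ e0) : diffquot f x @ within `[0, 1] x^' --> der01 f x := fx.
rewrite near_withinE => /nbhs_ballP[d /= d0 h].
exists d => // y y01 yx yd; rewrite distrC; apply: (h y) => //=.
by rewrite /ball /= distrC.
Qed.

Lemma derivable01_continuous f : derivable01_in f -> {within `[0, 1], continuous f}.
Proof.
move=> df; apply/subspace_continuousP => x x01.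
apply/cvgrPdist_le => e e0.
have [d d0 hd] := diffquot_cvg (df x x01) (@ltr01 R).
pose c : R := `|der01 f x| + 1.
have c0 : 0 < c by rewrite ltr_wpDl.
rewrite near_withinE; apply/nbhs_ballP; exists (Num.min d (e / c)).
  by rewrite /= lt_min d0 divr_gt0.
move=> y; rewrite /ball /= lt_min distrC => /andP[yd ye] y01.
have [->|yx] := eqVneq y x; first by rewrite subrr normr0 ltW.
have -> : f x - f y = - (diffquot f x y * (y - x)).
  by rewrite /diffquot divfK ?subr_eq0// opprB.
rewrite normrN normrM.
have : `|diffquot f x y| <= c.
  rewrite -[diffquot _ _ _](subrK (der01 f x)) (le_trans (ler_normD _ _))// addrC lerD2l.
  exact: hd.
move=> hq; apply: le_trans (ler_pM (normr_ge0 _) (normr_ge0 _) hq (ltW ye)) _.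
by rewrite mulrC divfK// gt_eqF.
Qed.

Lemma derivable01_is_derive f x : derivable01_in f -> x \in `]0, 1[ ->
  is_derive x 1 f (der01 f x).
Proof.
move=> df x01.
have x01c : x \in `[0, 1] by move: x01; rewrite !in_itv/= => /andP[x0 x1]; rewrite !ltW.
suff h : h^-1 *: ((f \o shift x) (h *: 1) - f x) @[h --> 0^'] --> der01 f x.
  by apply: DeriveDef; [apply/cvg_ex; exists (der01 f x) | apply/cvg_lim].
apply/cvgrPdist_le => e e0.
have [d d0 hd] := diffquot_cvg (df x x01c) e0.
apply/nbhs_ballP.
move: x01; rewrite in_itv/= => /andP[x0 x1].
exists (Num.min d (Num.min x (1 - x))); first by rewrite /= !lt_min d0 x0 subr_gt0.
move=> h; rewrite /ball /= sub0r normrN !lt_min => /and3P[hd0 hx hx1] h0.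
rewrite [h%:A]mulr1 distrC.
have := hd (h + x); rewrite addrK /diffquot addrK mulrC; apply => //.
- rewrite in_itv/=; move: hx hx1; rewrite !ltr_norml => /andP[? ?] /andP[? ?].
  by apply/andP; split; lra.
- by rewrite -subr_eq0 addrK.
Qed.

(* [h] stands for a function on [0, 1] with one-sided derivatives at the ends. *)
Definition has_deriv01 (h h' : R -> R) :=
  {within `[0, 1], continuous h} /\
  forall x, x \in `]0, 1[ -> is_derive x (1 : R) h (h' x).

Lemma has_deriv01_der f : derivable01_in f -> has_deriv01 f (der01 f).
Proof.
by move=> df; split=> [|x x01]; [exact: derivable01_continuous | exact: derivable01_is_derive].
Qed.

Lemma MVT01_le h h' (a b : R) : has_deriv01 h h' -> 0 <= a -> a <= b -> b <= 1 ->
  exists2 c : R, a <= c <= b & h b - h a = h' c * (b - a).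
Proof.
move=> [ch dh] a0 ab b1.
have dh' x : x \in `]a, b[ -> is_derive x (1 : R) h (h' x).
  rewrite in_itv/= => /andP[ax xb]; apply: dh; rewrite in_itv/=.
  by rewrite (le_lt_trans a0 ax) (lt_le_trans xb b1).
have ch' : {within `[a, b], continuous h}.
  apply: continuous_subspaceW ch => x /=; rewrite !in_itv/= => /andP[ax xb].
  by rewrite (le_trans a0 ax) (le_trans xb b1).
by have [c] := MVT_segment ab dh' ch'; rewrite in_itv/=; exists c.
Qed.

(** One integration of a remainder bound by the mean value theorem. The factor 1 / (k + 1) of a true
    integration is given up, which is harmless because M can be made small near x. *)
Lemma taylor_step h h' x z (M : R) (k : nat) : has_deriv01 h h' ->
  x \in `[0, 1] -> z \in `[0, 1] -> h x = 0 ->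
  (forall w, w \in `[0, 1] -> `|w - x| <= `|z - x| -> `|h' w| <= M * `|w - x| ^+ k) ->
  0 <= M -> `|h z| <= M * `|z - x| ^+ k.+1.
Proof.
move=> dh; rewrite !in_itv/= => /andP[x0 x1] /andP[z0 z1] hx0 hM M0.
have key c : 0 <= c <= 1 -> `|c - x| <= `|z - x| -> `|h z| = `|h' c * (z - x)| ->
    `|h z| <= M * `|z - x| ^+ k.+1.
  move=> c01 cz ->; rewrite normrM exprSr mulrA ler_wpM2r//.
  apply: le_trans (hM c _ cz) _; first by rewrite in_itv.
  by rewrite ler_wpM2l// lerXn2r// nnegrE.
have [xz|/ltW zx] := leP x z.
  have [c /andP[c1 c2]] := MVT01_le dh x0 xz z1; rewrite hx0 subr0 => hz.
  apply: (key c); first by rewrite (le_trans x0 c1) (le_trans c2 z1).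
    by rewrite !ger0_norm ?subr_ge0// lerD2r.
  by rewrite hz.
have [c /andP[c1 c2]] := MVT01_le dh z0 zx x1; rewrite hx0 sub0r => hz.
apply: (key c); first by rewrite (le_trans z0 c1) (le_trans c2 x1).
  by rewrite !ler0_norm ?subr_le0// lerN2 lerD2r.
by rewrite -normrN hz -[z - x]opprB mulrN normrN.
Qed.

Lemma continuous01_bounded f : {within `[0, 1], continuous f} ->
  exists2 M : R, 0 <= M & forall x : R, x \in `[0, 1] -> `|f x| <= M.
Proof.
move=> cf.
have cf' : {within `[0, 1], continuous (fun x => `|f x|)}.
  move=> x; apply: (@continuous_comp _ _ _ (f : subspace `[0, 1] -> R) Num.norm); first exact: cf.
  exact: norm_continuous.
have [c c01 hc] := EVT_max (@ler01 R) cf'.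
by exists `|f c|.
Qed.

(** Uniform continuity in polynomial form: for distant points the bound 2 M on the oscillation is
    absorbed by the quadratic term. In this form it can be averaged against binomial moments. *)
Lemma uniform_continuity01 f (e : R) : {within `[0, 1], continuous f} -> 0 < e ->
  exists2 K : R, 0 <= K & forall x z : R, x \in `[0, 1] -> z \in `[0, 1] ->
    `|f z - f x| <= e + K * `|z - x| ^+ 2.
Proof.
move=> cf e0; have e2 : 0 < e / 2 by rewrite divr_gt0.
have [M M0 hM] := continuous01_bounded cf.
(* Compactness, as near covering, replaces the radii at individual points by one radius valid on the
   whole segment. *)
pose P (d : R) (x : R) := x \in `[0, 1] -> forall z, z \in `[0, 1] -> `|z - x| < d -> `|f z - f x| <= e.
have /compact_near_coveringP/(_ R 0^'+ P) := @segment_compact R 0 1.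
case.
  move=> x x01.
  have /subspace_continuousP /(_ x x01) /cvgrPdist_le /(_ _ e2) := cf.
  rewrite near_withinE => /nbhs_ballP[r /= r0 hr].
  exists (ball x (r / 2), [set i | i < r / 2]).
    split; first by apply: nbhsx_ballx; rewrite divr_gt0.
    by apply: nbhs_right_lt; rewrite divr_gt0.
  move=> [y d] /= [xy dr] y01 z z01 zy.
  have h1 : `|f x - f y| <= e / 2.
    by apply: hr => //; rewrite /ball /= (lt_le_trans xy)// ler_pdivrMr//; lra.
  have h2 : `|f x - f z| <= e / 2.
    apply: hr => //; rewrite /ball /= -(subrK y x) -addrA (le_lt_trans (ler_normD _ _))//.
    rewrite [ltRHS](splitr r) ltrD// distrC.
    exact: lt_trans dr.
  rewrite -(subrK (f x) (f z)) -addrA (le_trans (ler_normD _ _))//.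
  by rewrite (splitr e) lerD// distrC.
move=> d /= d0 hd.
have d2 : 0 < d / 2 by rewrite divr_gt0.
have hP : forall x, x \in `[0, 1] -> P (d / 2) x.
  move=> x x01; apply: hd => //=.
  by rewrite sub0r normrN gtr0_norm//; lra.
have K0 : 0 <= 2 * M / (d / 2) ^+ 2 by rewrite divr_ge0 ?sqr_ge0// mulr_ge0.
exists (2 * M / (d / 2) ^+ 2) => // x z x01 z01.
have [zx|zx] := ltP `|z - x| (d / 2).
  by rewrite (le_trans (hP x x01 x01 z z01 zx))// lerDl mulr_ge0// sqr_ge0.
apply: (@le_trans _ _ (2 * M)).
  rewrite (le_trans (ler_normB _ _))//.
  by have := hM x x01; have := hM z z01; lra.
rewrite ler_wpDl ?(ltW e0)// -mulrA -[leLHS]mulr1 ler_wpM2l ?mulr_ge0//.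
rewrite ler_pdivlMl ?exprn_gt0// mulr1 lerXn2r// nnegrE //; exact: ltW.
Qed.

Lemma has_deriv01_sub h h' (p p' : R -> R) : has_deriv01 h h' ->
  (forall x : R, is_derive x (1 : R) p (p' x)) ->
  has_deriv01 (fun y => h y - p y) (fun y => h' y - p' y).
Proof.
move=> [ch dh] dp; split=> [|x x01].
  have cp : {within `[0, 1], continuous p}.
    by apply: derivable_within_continuous => x _; have [] := dp x.
  by move=> x; apply: cvgB; [exact: ch | exact: cp].
have h1 := dh x x01; have h2 := dp x.
exact: is_derive_subf.
Qed.

(** Up to distance |y - x| from x, the variation of [f4] is at most M = e + K |y - x|^2. This M is
    constant in the running point, so [taylor_step] carries it up through the four derivatives. *)
Lemma taylor4 (f0 f1 f2 f3 f4 : R -> R) (e : R) :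
  has_deriv01 f0 f1 -> has_deriv01 f1 f2 -> has_deriv01 f2 f3 -> has_deriv01 f3 f4 ->
  {within `[0, 1], continuous f4} -> 0 < e ->
  exists2 K : R, 0 <= K & forall x y : R, x \in `[0, 1] -> y \in `[0, 1] ->
    `|f0 y - (f0 x + f1 x * (y - x) + f2 x / 2 * (y - x) ^+ 2
      + f3 x / 6 * (y - x) ^+ 3 + f4 x / 24 * (y - x) ^+ 4)|
    <= e * `|y - x| ^+ 4 + K * `|y - x| ^+ 6.
Proof.
move=> d0 d1 d2 d3 c4 e0; have [K K0 hK] := uniform_continuity01 c4 e0.
exists K => // x y x01 y01.
have M0 : 0 <= e + K * `|y - x| ^+ 2.
  by rewrite addr_ge0 ?(ltW e0)// mulr_ge0// sqr_ge0.
have -> : e * `|y - x| ^+ 4 + K * `|y - x| ^+ 6 = (e + K * `|y - x| ^+ 2) * `|y - x| ^+ 4.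
  by ring.
set M := e + K * _ in M0 *.
have b4 z : z \in `[0, 1] -> `|z - x| <= `|y - x| -> `|f4 z - f4 x| <= M * `|z - x| ^+ 0.
  move=> z01 zy; rewrite expr0 mulr1 (le_trans (hK x z x01 z01))// lerD2l ler_wpM2l//.
  by rewrite lerXn2r// nnegrE.
have step h h' (p p' : R -> R) k : has_deriv01 h h' ->
    (forall u : R, is_derive u (1 : R) p (p' u)) -> p x = h x ->
    (forall z, z \in `[0, 1] -> `|z - x| <= `|y - x| -> `|h' z - p' z| <= M * `|z - x| ^+ k) ->
    (forall z, z \in `[0, 1] -> `|z - x| <= `|y - x| -> `|h z - p z| <= M * `|z - x| ^+ k.+1).
  move=> dh dp ph hp z z01 zy.
  apply: (@taylor_step _ _ x z M k (has_deriv01_sub dh dp) x01 z01 _ _ M0).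
    by rewrite ph subrr.
  by move=> w w01 wz; apply: hp => //; exact: le_trans zy.
pose p3 (z : R) := f3 x + f4 x * (z - x).
pose p2 (z : R) := f2 x + f3 x * (z - x) + f4 x / 2 * (z - x) ^+ 2.
pose p1 (z : R) := f1 x + f2 x * (z - x) + f3 x / 2 * (z - x) ^+ 2 + f4 x / 6 * (z - x) ^+ 3.
pose p0 (z : R) := f0 x + f1 x * (z - x) + f2 x / 2 * (z - x) ^+ 2
  + f3 x / 6 * (z - x) ^+ 3 + f4 x / 24 * (z - x) ^+ 4.
have dp3 (u : R) : is_derive u (1 : R) p3 ((fun=> f4 x) u) by rewrite /p3; derive_auto; rewrite /= ?/p3; field.
have ep3 : p3 x = f3 x by rewrite /p3 subrr; ring.
have b3 := step _ _ _ _ _ d3 dp3 ep3 b4.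
have dp2 (u : R) : is_derive u (1 : R) p2 ((p3) u) by rewrite /p2; derive_auto; rewrite /= ?/p3; field.
have ep2 : p2 x = f2 x by rewrite /p2 subrr; ring.
have b2 := step _ _ _ _ _ d2 dp2 ep2 b3.
have dp1 (u : R) : is_derive u (1 : R) p1 ((p2) u) by rewrite /p1; derive_auto; rewrite /= ?/p2; field.
have ep1 : p1 x = f1 x by rewrite /p1 subrr; ring.
have b1 := step _ _ _ _ _ d1 dp1 ep1 b2.
have dp0 (u : R) : is_derive u (1 : R) p0 ((p1) u) by rewrite /p0; derive_auto; rewrite /= ?/p1; field.
have ep0 : p0 x = f0 x by rewrite /p0 subrr; ring.
have b0 := step _ _ _ _ _ d0 dp0 ep0 b1.
exact: b0 y y01 (lexx _).
Qed.

End Derivative01.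

(** * Central moments of the binomial distribution up to order six *)

Section BinomialMoments.
Context {R : realType}.
Implicit Types (x : R) (phi : nat -> R).

Definition Ebin (n : nat) x phi : R := \sum_(k < n.+1) bernstein k n x * phi k.

Lemma bernstein_small k n x : (n < k)%N -> bernstein k n x = 0.
Proof. by move=> nk; rewrite /bernstein bin_small// !mul0r. Qed.

Lemma bernsteinS k n x :
  bernstein k.+1 n.+1 x = x * bernstein k n x + (1 - x) * bernstein k.+1 n x.
Proof.
rewrite /bernstein binS natrD subSS.
have [nk|nk] := leqP n k.
  by rewrite (@bin_small n k.+1)// exprS; ring.
by rewrite -(subnSK nk) !exprS; ring.
Qed.

(** Conditioning on the outcome of one trial. *)
Lemma EbinS n x phi :
  Ebin n.+1 x phi = (1 - x) * Ebin n x phi + x * Ebin n x (fun k => phi k.+1).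
Proof.
rewrite /Ebin big_ord_recl /=.
under eq_bigr do rewrite bernsteinS mulrDl -(mulrA x) -(mulrA (1 - x)).
rewrite big_split /= -!mulr_sumr addrCA addrC; congr (_ + _).
have -> : bernstein 0 n.+1 x = (1 - x) * bernstein 0 n x.
  by rewrite /bernstein !bin0 !subn0 exprS; ring.
rewrite -mulrA -mulrDr; congr (_ * _).
by rewrite [in LHS]big_ord_recr /= (@bernstein_small n.+1)// mul0r addr0 [RHS]big_ord_recl.
Qed.

Lemma EbinD n x phi1 phi2 :
  Ebin n x (fun k => phi1 k + phi2 k) = Ebin n x phi1 + Ebin n x phi2.
Proof. by rewrite /Ebin -big_split; apply: eq_bigr => k _; rewrite mulrDr. Qed.

Lemma EbinZ n x (c : R) phi : Ebin n x (fun k => c * phi k) = c * Ebin n x phi.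
Proof. by rewrite /Ebin mulr_sumr; apply: eq_bigr => k _; rewrite mulrCA. Qed.

Lemma Ebin_sum n x (I : Type) (r : seq I) (P : pred I) (F : I -> nat -> R) :
  Ebin n x (fun k => \sum_(i <- r | P i) F i k) = \sum_(i <- r | P i) Ebin n x (F i).
Proof.
rewrite /Ebin exchange_big /=; apply: eq_bigr => k _; by rewrite mulr_sumr.
Qed.

Lemma eq_Ebin n x phi1 phi2 : phi1 =1 phi2 -> Ebin n x phi1 = Ebin n x phi2.
Proof. by move=> e; apply: eq_bigr => k _; rewrite e. Qed.

Lemma bernstein_ge0 k n x : 0 <= x <= 1 -> 0 <= bernstein k n x.
Proof.
by move=> /andP[x0 x1]; rewrite !mulr_ge0// exprn_ge0// subr_ge0.
Qed.

Lemma ler_Ebin n x phi1 phi2 : 0 <= x <= 1 -> (forall k, (k <= n)%N -> phi1 k <= phi2 k) ->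
  Ebin n x phi1 <= Ebin n x phi2.
Proof.
move=> x01 h; apply: ler_sum => k _; rewrite ler_wpM2l ?bernstein_ge0//.
by apply: h; rewrite -ltnS.
Qed.

Definition cmoment (j n : nat) x : R := Ebin n x (fun k => (k%:R - n%:R * x) ^+ j).

(** One trial shifts the centred variable by - x or by 1 - x. Expanding the powers expresses a
    moment through lower ones with one trial less, and the closed forms follow by induction on n. *)
Lemma cmomentS j n x : cmoment j n.+1 x =
  \sum_(i < j.+1) 'C(j, i)%:R * ((1 - x) * (- x) ^+ i + x * (1 - x) ^+ i)
    * cmoment (j - i) n x.
Proof.
rewrite /cmoment EbinS -!EbinZ -EbinD.
under [RHS]eq_bigr do rewrite -EbinZ.
rewrite -Ebin_sum; apply: eq_Ebin => k /=.
have -> : k%:R - n.+1%:R * x = (k%:R - n%:R * x) + - x by rewrite -natr1; ring.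
have -> : k.+1%:R - n.+1%:R * x = (k%:R - n%:R * x) + (1 - x) by rewrite -!natr1; ring.
rewrite !exprDn !mulr_sumr -big_split; apply: eq_bigr => i _ /=.
by rewrite -[_ *+ 'C(j, i)]mulr_natr -[X in x * X]mulr_natr; ring.
Qed.

Lemma cmoment0 j x : cmoment j 0 x = (j == 0)%:R.
Proof.
rewrite /cmoment /Ebin big_ord1 /bernstein bin0 subn0 !expr0 !mul1r mul0r subr0.
by rewrite expr0n.
Qed.

Lemma cmoment_0 n x : cmoment 0 n x = 1.
Proof.
elim: n => [|n IH]; first by rewrite cmoment0.
by rewrite cmomentS big_ord1 subn0 bin0 IH !expr0; ring.
Qed.

Lemma cmoment_1 n x : cmoment 1 n x = 0.
Proof.
elim: n => [|n IH]; first by rewrite cmoment0.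
by rewrite cmomentS !big_ord_recr big_ord0 /= cmoment_0 IH; ring.
Qed.

Lemma cmoment_2 n x : cmoment 2 n x = n%:R * (x * (1 - x)).
Proof.
elim: n => [|n IH]; first by rewrite cmoment0 mul0r.
rewrite cmomentS !big_ord_recr big_ord0 /= !binE/= cmoment_0 cmoment_1 IH.
by rewrite -natr1; ring.
Qed.

Lemma cmoment_3 n x : cmoment 3 n x = n%:R * (x * (1 - x)) * (1 - 2 * x).
Proof.
elim: n => [|n IH]; first by rewrite cmoment0 !mul0r.
rewrite cmomentS !big_ord_recr big_ord0 /= !binE/= cmoment_0 cmoment_1 cmoment_2 IH.
by rewrite -natr1; ring.
Qed.

Lemma cmoment_4 n x : cmoment 4 n x =
  3 * n%:R ^+ 2 * (x * (1 - x)) ^+ 2 + n%:R * (x * (1 - x)) * (1 - 6 * (x * (1 - x))).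
Proof.
elim: n => [|n IH]; first by rewrite cmoment0 /=; ring.
rewrite cmomentS !big_ord_recr big_ord0 /= !binE/=.
rewrite cmoment_0 cmoment_1 cmoment_2 cmoment_3 IH.
by rewrite -natr1; ring.
Qed.

Lemma cmoment_5 n x : cmoment 5 n x = (1 - 2 * x) *
  (10 * n%:R ^+ 2 * (x * (1 - x)) ^+ 2 + n%:R * (x * (1 - x)) * (1 - 12 * (x * (1 - x)))).
Proof.
elim: n => [|n IH]; first by rewrite cmoment0 /=; ring.
rewrite cmomentS !big_ord_recr big_ord0 /= !binE/=.
rewrite cmoment_0 cmoment_1 cmoment_2 cmoment_3 cmoment_4 IH.
by rewrite -natr1; ring.
Qed.

Lemma cmoment_6 n x (p := x * (1 - x)) : cmoment 6 n x =
  15 * n%:R ^+ 3 * p ^+ 3 + 5 * n%:R ^+ 2 * p ^+ 2 * (5 - 26 * p)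
  + n%:R * p * (1 - 30 * p + 120 * p ^+ 2).
Proof.
elim: n => [|n IH]; first by rewrite cmoment0 /=; ring.
rewrite cmomentS !big_ord_recr big_ord0 /= !binE/=.
rewrite cmoment_0 cmoment_1 cmoment_2 cmoment_3 cmoment_4 cmoment_5 IH /p.
by rewrite -natr1; ring.
Qed.

End BinomialMoments.

(** * Bias of the Bernstein kernel *)

Section BiasExpansion.
Context {R : realType}.
Implicit Types (x y : R) (phi : nat -> R).

Lemma EbinB n x phi1 phi2 :
  Ebin n x (fun k => phi1 k - phi2 k) = Ebin n x phi1 - Ebin n x phi2.
Proof. by rewrite /Ebin -sumrB; apply: eq_bigr => k _; rewrite mulrBr. Qed.

Lemma norm_Ebin n x phi : 0 <= x <= 1 -> `|Ebin n x phi| <= Ebin n x (fun k => `|phi k|).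
Proof.
move=> x01; apply: le_trans (ler_norm_sum _ _ _) _; apply: ler_sum => k _.
by rewrite normrM (ger0_norm (bernstein_ge0 _ _ x01)).
Qed.

(** Power mean inequality; equality at u = 1 explains the double root of the difference. *)
Lemma norm1D_exp4_le (s : R) : (`|s| + 1) ^+ 4 <= 8 * (s ^+ 4 + 1).
Proof.
have -> : s ^+ 4 = `|s| ^+ 4 by rewrite -normrX ger0_norm// (exprM s 2 2) sqr_ge0.
move: `|s| (normr_ge0 s) => u u0; rewrite -subr_ge0.
have -> : 8 * (u ^+ 4 + 1) - (u + 1) ^+ 4 = (u - 1) ^+ 2 * (7 * u ^+ 2 + 10 * u + 7) by ring.
by rewrite mulr_ge0 ?sqr_ge0// !addr_ge0 ?mulr_ge0 ?sqr_ge0.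
Qed.

Lemma norm1D_exp6_le (s : R) : (`|s| + 1) ^+ 6 <= 32 * (s ^+ 6 + 1).
Proof.
have -> : s ^+ 6 = `|s| ^+ 6 by rewrite -normrX ger0_norm// (exprM s 3 2) sqr_ge0.
move: `|s| (normr_ge0 s) => u u0; rewrite -subr_ge0.
have -> : 32 * (u ^+ 6 + 1) - (u + 1) ^+ 6 = (u - 1) ^+ 2 *
  (31 * u ^+ 4 + 56 * u ^+ 3 + 66 * u ^+ 2 + 56 * u + 31) by ring.
by rewrite mulr_ge0 ?sqr_ge0// !addr_ge0 ?mulr_ge0 ?exprn_ge0.
Qed.

Lemma var_bound x : 0 <= x <= 1 -> 0 <= x * (1 - x) <= 4^-1.
Proof.
move=> /andP[x0 x1]; rewrite mulr_ge0 ?subr_ge0//= -subr_ge0.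
have -> : 4^-1 - x * (1 - x) = (x - 2^-1) ^+ 2 by field.
exact: sqr_ge0.
Qed.

(** The added 1 matches the right-hand side of [norm1D_exp4_le], of which this bounds the
    expectation. *)
Lemma cmoment4_le n x : 0 <= x <= 1 -> cmoment 4 n x + 1 <= 2 * n.+1%:R ^+ 2.
Proof.
move=> /var_bound; rewrite cmoment_4 -[n.+1%:R]natr1; move: (x * (1 - x)) => p /andP[p0 p1].
move: (n%:R) (ler0n R n) => t t0.
have h1 : p ^+ 2 <= 16^-1.
  have : p ^+ 2 <= 4^-1 ^+ 2 by rewrite lerXn2r// nnegrE.
  by lra.
have h2 : t ^+ 2 * p ^+ 2 <= t ^+ 2 * 16^-1 by rewrite ler_wpM2l ?sqr_ge0.
have h3 : t * p * (1 - 6 * p) <= t * p * 1 by rewrite ler_wpM2l ?mulr_ge0//; lra.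
have h4 : t * p <= t * 4^-1 by rewrite ler_wpM2l.
have := sqr_ge0 t; lra.
Qed.

Lemma cmoment6_le n x : 0 <= x <= 1 -> cmoment 6 n x + 1 <= 6 * n.+1%:R ^+ 3.
Proof.
move=> /var_bound; rewrite cmoment_6 -[n.+1%:R]natr1; move: (x * (1 - x)) => p /andP[p0 p1].
move: (n%:R) (ler0n R n) => t t0.
have h1 : p ^+ 2 <= 16^-1.
  have : p ^+ 2 <= 4^-1 ^+ 2 by rewrite lerXn2r// nnegrE.
  by lra.
have h1' : p ^+ 3 <= 64^-1.
  rewrite exprS; have : p * p ^+ 2 <= p * 16^-1 by rewrite ler_wpM2l.
  by lra.
have h2 : t ^+ 3 * p ^+ 3 <= t ^+ 3 * 64^-1 by rewrite ler_wpM2l ?exprn_ge0.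
have h3 : t ^+ 2 * p ^+ 2 * (5 - 26 * p) <= t ^+ 2 * p ^+ 2 * 5.
  by rewrite ler_wpM2l ?mulr_ge0 ?sqr_ge0//; lra.
have h4 : t ^+ 2 * p ^+ 2 <= t ^+ 2 * 16^-1 by rewrite ler_wpM2l ?sqr_ge0.
have h5 : t * p * (1 - 30 * p + 120 * p ^+ 2) <= t * p * 9.
  by rewrite ler_wpM2l ?mulr_ge0//; lra.
have h6 : t * p <= t * 4^-1 by rewrite ler_wpM2l.
have := sqr_ge0 t; have : 0 <= t ^+ 3 by rewrite exprn_ge0.
lra.
Qed.

(** These fractions are the coefficients of a^3 and a^4 in [Ebin_taylor], with p = x (1 - x). *)
Lemma taylor_coeff_bounds (p : R) : 0 <= p <= 4^-1 ->
  [/\ `|(1 - 12 * p) / 24| <= 1, `|(25 * p - 130 * p ^+ 2) / 120| <= 1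
    & `|(120 * p ^+ 2 - 30 * p + 1) / 120| <= 1].
Proof.
move=> /andP[p0 p1].
have pp : p ^+ 2 <= 16^-1.
  have : p ^+ 2 <= 4^-1 ^+ 2 by rewrite lerXn2r// nnegrE.
  by lra.
have pp0 := sqr_ge0 p.
by split; rewrite ler_norml; apply/andP; split; lra.
Qed.

Context (F f0 f1 f2 f3 f4 : R -> R).
Context (dF : has_deriv01 F f0) (d0 : has_deriv01 f0 f1) (d1 : has_deriv01 f1 f2)
  (d2 : has_deriv01 f2 f3) (d3 : has_deriv01 f3 f4)
  (c4 : {within `[0, 1], continuous f4}).

(** Expectation of T_m when F is the distribution function of the observations. *)
Definition bern_mean (m : nat) x : R :=
  m%:R * Ebin m.-1 x (fun k => F (k.+1%:R / m%:R) - F (k%:R / m%:R)).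

(** The 1 / m term of the bias of T_m. It cancels in 2 T_m - T_(m/2), where the 1 / m^2 term [bias2]
    receives the factor 2 - 4 = - 2. *)
Definition bias1 x : R := (1 - 2 * x) / 2 * f1 x + x * (1 - x) / 2 * f2 x.

Definition bias2 x : R := 6^-1 * (1 - 6 * x * (1 - x)) * f2 x
  + 5 / 12 * x * (1 - x) * (1 - 2 * x) * f3 x
  + 8^-1 * x ^+ 2 * (1 - x) ^+ 2 * f4 x.

(* The coefficients are the differences ((s + 1 - x)^j - (s - x)^j) / j!, since
   m ((k + 1) / m - x) = s + 1 - x and m (k / m - x) = s - x. *)
Lemma Ebin_taylor (m : nat) x (n := m.-1) (a := m%:R^-1) : (0 < m)%N ->
  Ebin n x (fun k => let s := k%:R - n%:R * x in
    f0 x + f1 x / 2 * a * (2 * s + (1 - 2 * x))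
    + f2 x / 6 * a ^+ 2 * (3 * s ^+ 2 + 3 * (1 - 2 * x) * s + ((1 - x) ^+ 3 + x ^+ 3))
    + f3 x / 24 * a ^+ 3 * (4 * s ^+ 3 + 6 * (1 - 2 * x) * s ^+ 2
        + 4 * ((1 - x) ^+ 3 + x ^+ 3) * s + ((1 - x) ^+ 4 - x ^+ 4))
    + f4 x / 120 * a ^+ 4 * (5 * s ^+ 4 + 10 * (1 - 2 * x) * s ^+ 3
        + 10 * ((1 - x) ^+ 3 + x ^+ 3) * s ^+ 2 + 5 * ((1 - x) ^+ 4 - x ^+ 4) * s
        + ((1 - x) ^+ 5 + x ^+ 5)))
  = f0 x + bias1 x * a + bias2 x * a ^+ 2
    + (f3 x * (1 - 2 * x) * (1 - 12 * (x * (1 - x))) / 24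
       + f4 x * (25 * (x * (1 - x)) - 130 * (x * (1 - x)) ^+ 2) / 120) * a ^+ 3
    + f4 x * (120 * (x * (1 - x)) ^+ 2 - 30 * (x * (1 - x)) + 1) / 120 * a ^+ 4.
Proof.
move=> m0.
pose s k : R := k%:R - n%:R * x.
pose c0 := f0 x + f1 x / 2 * a * (1 - 2 * x) + f2 x / 6 * a ^+ 2 * ((1 - x) ^+ 3 + x ^+ 3)
  + f3 x / 24 * a ^+ 3 * ((1 - x) ^+ 4 - x ^+ 4) + f4 x / 120 * a ^+ 4 * ((1 - x) ^+ 5 + x ^+ 5).
pose c1' := f1 x / 2 * a * 2 + f2 x / 6 * a ^+ 2 * (3 * (1 - 2 * x))
  + f3 x / 24 * a ^+ 3 * (4 * ((1 - x) ^+ 3 + x ^+ 3))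
  + f4 x / 120 * a ^+ 4 * (5 * ((1 - x) ^+ 4 - x ^+ 4)).
pose c2' := f2 x / 6 * a ^+ 2 * 3 + f3 x / 24 * a ^+ 3 * (6 * (1 - 2 * x))
  + f4 x / 120 * a ^+ 4 * (10 * ((1 - x) ^+ 3 + x ^+ 3)).
pose c3' := f3 x / 24 * a ^+ 3 * 4 + f4 x / 120 * a ^+ 4 * (10 * (1 - 2 * x)).
pose c4' := f4 x / 120 * a ^+ 4 * 5.
transitivity (Ebin n x (fun k => c0 * s k ^+ 0 + c1' * s k ^+ 1 + c2' * s k ^+ 2
    + c3' * s k ^+ 3 + c4' * s k ^+ 4)).
  apply: eq_Ebin => k; rewrite /= -/(s k) /c0 /c1' /c2' /c3' /c4'.
  move: (s k) => z; ring.
rewrite !EbinD !EbinZ -!/(cmoment _ _ _) cmoment_0 cmoment_1 cmoment_2 cmoment_3 cmoment_4.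
(* The moments are polynomials in n; this substitution leaves a rational identity in a and x
   alone. *)
have -> : n%:R = a^-1 - 1 by rewrite /a invrK /n -[in RHS](prednK m0) -natr1 addrK.
have a0 : a != 0 by rewrite invr_eq0 pnatr_eq0 -lt0n.
rewrite /c0 /c1' /c2' /c3' /c4' /bias1 /bias2.
move: (f0 x) (f1 x) (f2 x) (f3 x) (f4 x) => g0 g1 g2 g3 g4.
by field.
Qed.

(** m times the increment over cell k of the primitive of the Taylor polynomial of [f0] at x,
    written in the centred variable s. *)
Definition cell_taylor (m : nat) x (k : nat) : R :=
  let a := m%:R^-1 in let s := k%:R - m.-1%:R * x in
    f0 x + f1 x / 2 * a * (2 * s + (1 - 2 * x))
    + f2 x / 6 * a ^+ 2 * (3 * s ^+ 2 + 3 * (1 - 2 * x) * s + ((1 - x) ^+ 3 + x ^+ 3))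
    + f3 x / 24 * a ^+ 3 * (4 * s ^+ 3 + 6 * (1 - 2 * x) * s ^+ 2
        + 4 * ((1 - x) ^+ 3 + x ^+ 3) * s + ((1 - x) ^+ 4 - x ^+ 4))
    + f4 x / 120 * a ^+ 4 * (5 * s ^+ 4 + 10 * (1 - 2 * x) * s ^+ 3
        + 10 * ((1 - x) ^+ 3 + x ^+ 3) * s ^+ 2 + 5 * ((1 - x) ^+ 4 - x ^+ 4) * s
        + ((1 - x) ^+ 5 + x ^+ 5)).

(** The mean value theorem, applied to F minus the primitive p of the Taylor polynomial, turns the
    error on the cell into the remainder of [f0] at a single point c of the cell; this c lies within
    (|s| + 1) / m of x. *)
Lemma cell_taylor_bound (e : R) : 0 < e -> exists2 K : R, 0 <= K &
  forall m k x, (k < m)%N -> 0 <= x <= 1 ->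
  `|m%:R * (F (k.+1%:R / m%:R) - F (k%:R / m%:R)) - cell_taylor m x k| <=
  e * ((`|k%:R - m.-1%:R * x| + 1) / m%:R) ^+ 4
  + K * ((`|k%:R - m.-1%:R * x| + 1) / m%:R) ^+ 6.
Proof.
move=> e0; have [K K0 hK] := taylor4 d0 d1 d2 d3 c4 e0.
exists K => // m k x km x01.
pose p y : R := f0 x * (y - x) + f1 x / 2 * (y - x) ^+ 2 + f2 x / 6 * (y - x) ^+ 3
  + f3 x / 24 * (y - x) ^+ 4 + f4 x / 120 * (y - x) ^+ 5.
pose p' y : R := f0 x + f1 x * (y - x) + f2 x / 2 * (y - x) ^+ 2
      + f3 x / 6 * (y - x) ^+ 3 + f4 x / 24 * (y - x) ^+ 4.
have dp (u : R) : is_derive u (1 : R) p (p' u) by rewrite /p; derive_auto; rewrite /= /p'; field.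
have m0 : (0 : R) < m%:R by rewrite ltr0n; apply: leq_ltn_trans km.
have a0 : (0 : R) <= k%:R / m%:R by rewrite divr_ge0.
have ab : k%:R / m%:R <= k.+1%:R / m%:R :> R by rewrite ler_pM2r ?invr_gt0// ler_nat.
have b1 : k.+1%:R / m%:R <= 1 :> R by rewrite ler_pdivrMr// mul1r ler_nat.
have [c /andP[c0 c1] hc] := MVT01_le (has_deriv01_sub dF dp) a0 ab b1.
have c01 : c \in `[0, 1] by rewrite in_itv/= (le_trans a0 c0) (le_trans c1 b1).
have x01' : x \in `[0, 1] by rewrite in_itv.
set s := k%:R - m.-1%:R * x.
have mE : m%:R = m.-1%:R + 1 :> R by rewrite natr1 prednK//; apply: leq_ltn_trans km.
have ek : k%:R / m%:R - x = (s - x) * m%:R^-1.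
  by rewrite /s mE; field; rewrite -mE gt_eqF.
have ek1 : k.+1%:R / m%:R - x = (s + 1 - x) * m%:R^-1.
  by rewrite /s -natr1 mE; field; rewrite -mE gt_eqF.
have -> : m%:R * (F (k.+1%:R / m%:R) - F (k%:R / m%:R)) - cell_taylor m x k = f0 c - p' c.
  have -> : F (k.+1%:R / m%:R) - F (k%:R / m%:R) =
      p (k.+1%:R / m%:R) - p (k%:R / m%:R) + (f0 c - p' c) / m%:R.
    have h : m%:R^-1 = k.+1%:R / m%:R - k%:R / m%:R :> R.
      by rewrite -natr1; field; rewrite gt_eqF.
    by rewrite [X in _ + _ * X]h -hc; ring.
  rewrite {1 2}/p ek ek1 /cell_taylor -/s.
  move: (f0 c - p' c) (f0 x) (f1 x) (f2 x) (f3 x) (f4 x) => z g0 g1 g2 g3 g4.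
  by field; rewrite gt_eqF.
have cx : `|c - x| <= (`|s| + 1) / m%:R.
  move: x01 => /andP[x0 x1].
  have h1 : (s - x) * m%:R^-1 <= c - x by rewrite -ek lerD2r.
  have h2 : c - x <= (s + 1 - x) * m%:R^-1 by rewrite -ek1 lerD2r.
  have h3 : s <= `|s| by exact: ler_norm.
  have h4 : - s <= `|s| by rewrite -normrN; exact: ler_norm.
  rewrite ler_norml; apply/andP; split.
    by apply: le_trans h1; rewrite -mulNr ler_pM2r ?invr_gt0//; lra.
  by apply: le_trans h2 _; rewrite ler_pM2r ?invr_gt0//; lra.
apply: le_trans (hK x c x01' c01) _.
have s0 : 0 <= (`|s| + 1) / m%:R by rewrite divr_ge0 ?addr_ge0.
by apply: lerD; rewrite ler_wpM2l ?(ltW e0)// lerXn2r.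
Qed.

Lemma bern_mean_expansion (e : R) : 0 < e -> exists m0 : nat, forall (m : nat) x,
  (m0 <= m)%N -> 0 <= x <= 1 ->
  `|bern_mean m x - (f0 x + bias1 x / m%:R + bias2 x / m%:R ^+ 2)| <= e / m%:R ^+ 2.
Proof.
(* The factors 8 of [norm1D_exp4_le] and 2 of [cmoment4_le] turn e / 32 into e / 2; likewise 192 =
   32 * 6 below. The other e / 2 absorbs C / m. *)
move=> e0; have e1 : 0 < e / 32 by rewrite divr_gt0.
have [K K0 hK] := cell_taylor_bound e1.
have [M3 M30 hM3] := continuous01_bounded d3.1.
have [M4 M40 hM4] := continuous01_bounded c4.
pose C := 192 * K + (M3 + 2 * M4).
have C0 : 0 <= C by rewrite !addr_ge0 ?mulr_ge0.
have ce0 : 0 <= 2 * C / e by rewrite divr_ge0 ?mulr_ge0// ltW.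
exists (Num.bound (2 * C / e)).+1 => m x mm x01.
have m0 : (0 < m)%N by apply: leq_trans mm.
have mR : (0 : R) < m%:R by rewrite ltr0n.
have mC : C * m%:R^-1 <= e / 2.
  rewrite ler_pdivrMr// mulrC -ler_pdivrMr ?divr_gt0// invf_div mulrA [C * 2]mulrC.
  by rewrite (le_trans (ltW (archi_boundP ce0)))// ler_nat ltnW.
have a1 : m%:R^-1 <= 1 :> R by rewrite invf_le1// ler1n.
have mE : m = m.-1.+1 by rewrite prednK.
have T1 : `|bern_mean m x - Ebin m.-1 x (cell_taylor m x)| <= (e / 2 + 192 * K * m%:R^-1) * m%:R^-1 ^+ 2.
  have -> : bern_mean m x - Ebin m.-1 x (cell_taylor m x) = Ebin m.-1 x (fun k =>
      m%:R * (F (k.+1%:R / m%:R) - F (k%:R / m%:R)) - cell_taylor m x k).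
    by rewrite EbinB EbinZ.
  apply: le_trans (norm_Ebin _ _ x01) _.
  pose s k : R := k%:R - m.-1%:R * x.
  apply: (@le_trans _ _ (Ebin m.-1 x (fun k =>
     e / 32 * m%:R^-1 ^+ 4 * 8 * (s k ^+ 4 + 1 * s k ^+ 0)
     + K * m%:R^-1 ^+ 6 * 32 * (s k ^+ 6 + 1 * s k ^+ 0)))).
    apply: ler_Ebin => // k km.
    have km' : (k < m)%N by rewrite mE ltnS.
    apply: le_trans (hK m k x km' x01) _.
    have n4 := norm1D_exp4_le (s k); have n6 := norm1D_exp6_le (s k).
    rewrite -/(s k) !exprMn expr0 mul1r; apply: lerD.
      rewrite (mulrC (_ ^+ 4)) mulrA -[leRHS]mulrA ler_wpM2l//.
      by rewrite mulr_ge0 ?exprn_ge0 ?invr_ge0// ltW.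
    rewrite (mulrC (_ ^+ 6)) mulrA -[leRHS]mulrA ler_wpM2l//.
    by rewrite mulr_ge0 ?exprn_ge0 ?invr_ge0.
  rewrite EbinD !EbinZ !EbinD EbinZ -!/(cmoment _ _ _) cmoment_0 mulr1.
  have h4 := cmoment4_le m.-1 x01; have h6 := cmoment6_le m.-1 x01.
  rewrite -mE in h4 h6.
  have h4' : e / 32 * m%:R^-1 ^+ 4 * 8 * (cmoment 4 m.-1 x + 1) <=
      e / 32 * m%:R^-1 ^+ 4 * 8 * (2 * m%:R ^+ 2).
    by rewrite ler_wpM2l// !mulr_ge0 ?exprn_ge0 ?invr_ge0// ltW.
  have h6' : K * m%:R^-1 ^+ 6 * 32 * (cmoment 6 m.-1 x + 1) <=
      K * m%:R^-1 ^+ 6 * 32 * (6 * m%:R ^+ 3).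
    by rewrite ler_wpM2l// !mulr_ge0 ?exprn_ge0 ?invr_ge0.
  apply: le_trans (lerD h4' h6') _.
  rewrite le_eqVlt; apply/orP; left; apply/eqP; field.
  by rewrite gt_eqF.
have T2 : `|Ebin m.-1 x (cell_taylor m x) - (f0 x + bias1 x / m%:R + bias2 x / m%:R ^+ 2)| <=
    (M3 + 2 * M4) * m%:R^-1 * m%:R^-1 ^+ 2.
  rewrite /cell_taylor Ebin_taylor// exprVn.
  set A := (_ / 24 + _); set B := (X in X * m%:R^-1 ^+ 4).
  have -> : f0 x + bias1 x / m%:R + bias2 x / m%:R ^+ 2 + A * m%:R^-1 ^+ 3 + B * m%:R^-1 ^+ 4
    - (f0 x + bias1 x / m%:R + bias2 x / m%:R ^+ 2) = (A + B * m%:R^-1) * (m%:R^-1 * m%:R^-1 ^+ 2).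
    by ring.
  rewrite -exprVn -mulrA normrM [X in _ * X]ger0_norm ?mulr_ge0 ?exprn_ge0 ?invr_ge0//.
  rewrite ler_wpM2r ?mulr_ge0 ?exprn_ge0 ?invr_ge0//.
  have x01' : x \in `[0, 1] by rewrite in_itv.
  have := hM3 x x01'; have := hM4 x x01'; rewrite /A /B.
  have [b1 b2 b3] := taylor_coeff_bounds (var_bound x01).
  have q1 : `|1 - 2 * x| <= 1 by rewrite ler_norml; move: x01 => /andP[x0 x1]; apply/andP; split; lra.
  move: (x * (1 - x)) b1 b2 b3 (1 - 2 * x) q1 (f3 x) (f4 x) => p b1 b2 b3 q q1 g3 g4 h4 h3.
  have k1 : `|g3 * q * (1 - 12 * p) / 24| <= M3.
    rewrite -mulrA 2!normrM -mulrA -[leRHS]mulr1 ler_pM ?mulr_ge0//.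
    by rewrite -[leRHS]mulr1 ler_pM.
  have k2 : `|g4 * (25 * p - 130 * p ^+ 2) / 120| <= M4.
    by rewrite -mulrA normrM -[leRHS]mulr1 ler_pM.
  have k3 : `|g4 * (120 * p ^+ 2 - 30 * p + 1) / 120| <= M4.
    by rewrite -mulrA normrM -[leRHS]mulr1 ler_pM.
  apply: le_trans (ler_normD _ _) _.
  have -> : M3 + 2 * M4 = M3 + M4 + M4 by ring.
  rewrite lerD//.
    by apply: le_trans (ler_normD _ _) _; rewrite lerD.
  rewrite normrM -[leRHS]mulr1 ler_pM// ger0_norm// invr_ge0 //.
rewrite -(subrK (Ebin m.-1 x (cell_taylor m x)) (bern_mean m x)) -addrA.
apply: le_trans (ler_normD _ _) _; apply: le_trans (lerD T1 T2) _.
rewrite -mulrDl exprVn ler_wpM2r ?invr_ge0 ?exprn_ge0//.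
by move: mC; rewrite /C mulrDl; lra.
Qed.

End BiasExpansion.

(** * Second moment of the kernel *)

Section BernsteinProducts.
Context {R : realType}.
Local Notation mu := (@lebesgue_measure R).
Implicit Types (x y : R).

Lemma continuous_bernstein k n : continuous (bernstein k n : R -> R).
Proof.
have -> : bernstein k n = fun x : R => 'C(n, k)%:R * XMonemX k (n - k) x.
  by apply/funext => x; rewrite /bernstein -mulrA.
by move=> x; apply: cvgM; [exact: cvg_cst | exact: continuous_XMonemX].
Qed.

Lemma Rintegral_XMonemX a b :
  \int[mu]_(x in `[0, 1]) (XMonemX a b x) = (a`! * b`!)%:R / (a + b).+1`!%:R.
Proof. by rewrite -beta_fun_fact /beta_fun -Rintegral_mkcond. Qed.

Lemma Rintegral_bernsteinM k n j n' : (k <= n)%N -> (j <= n')%N ->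
  \int[mu]_(x in `[0, 1]) (bernstein k n x * bernstein j n' x) =
  n`!%:R * n'`!%:R * (k + j)`!%:R * ((n - k) + (n' - j))`!%:R
   / (k`!%:R * (n - k)`!%:R * j`!%:R * (n' - j)`!%:R * (n + n').+1`!%:R).
Proof.
move=> kn jn.
under eq_Rintegral => x _.
  rewrite (_ : _ * _ = 'C(n, k)%:R * 'C(n', j)%:R * XMonemX (k + j) ((n - k) + (n' - j)) x);
    last by rewrite /bernstein /XMonemX !exprD /unstable.onem; ring.
  over.
rewrite RintegralZl//; last exact: integrable_XMonemX.
rewrite Rintegral_XMonemX.
have -> : (k + j + (n - k + (n' - j)) = n + n')%N by lia.
rewrite -{1}(subnK kn) binR subnK// -{1}(subnK jn) binR subnK// natrM.
field.
by rewrite !factR_neq0.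
Qed.

Lemma Rintegral_bernstein_sqr k i :
  \int[mu]_(x in `[0, 1]) (bernstein k (k + i) x ^+ 2) =
  cbin k * cbin i / ((k + i).*2.+1%:R * cbin (k + i)).
Proof.
under eq_Rintegral do rewrite expr2.
rewrite Rintegral_bernsteinM ?leq_addr// addKn /cbin -!addnn !binR factS natrM exprD.
have z0 : (k + i + (k + i)).+1%:R != 0 :> R by rewrite pnatr_eq0.
by move: (_.+1%:R) z0 => z z0; field; rewrite z0 !factR_neq0 !expf_neq0 ?pnatr_eq0.
Qed.

(** What remains when the factorials of 3 l + 1, 2 l + 1, 2 g + 1 and 3 g + 2 are reduced to those
    of 3 l, 2 l, 2 g and 3 g. For large l and g it behaves like 1 / (3 g). *)
Definition ratio31 (l g : nat) : R :=
  (3 * l + 1)%:R * (2 * g + 1)%:R / ((2 * l + 1)%:R * ((3 * g + 2)%:R * (3 * g + 1)%:R)).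

Lemma tbinE n : tbin n = (3 * n)`!%:R / (n`!%:R * (2 * n)`!%:R) * (4 / 27) ^+ n :> R.
Proof.
have e : (3 * n = 2 * n + n)%N by lia.
by rewrite /tbin {1}e binR -e.
Qed.

Lemma Rintegral_bernstein_even j i (g := (j + i)%N) :
  \int[mu]_(x in `[0, 1]) (bernstein (2 * j) (2 * g + 1) x * bernstein j g x) =
  tbin j * tbin i / tbin g * ratio31 i g.
Proof.
rewrite Rintegral_bernsteinM ?leq_addr//; last by rewrite /g; lia.
have -> : (2 * g + 1 - 2 * j = (2 * i).+1)%N by rewrite /g; lia.
have -> : (g - j = i)%N by rewrite /g; lia.
have -> : (2 * j + j = 3 * j)%N by lia.
have -> : ((2 * i).+1 + i = (3 * i).+1)%N by lia.
have -> : ((2 * g + 1 + g).+1 = (3 * g).+2)%N by lia.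
rewrite !addn1 !tbinE /ratio31 !factS !natrM exprD.
have -> : (3 * i + 1 = (3 * i).+1)%N by lia.
have -> : (2 * i + 1 = (2 * i).+1)%N by lia.
have -> : (2 * g + 1 = (2 * g).+1)%N by lia.
have -> : (3 * g + 2 = (3 * g).+2)%N by lia.
have -> : (3 * g + 1 = (3 * g).+1)%N by lia.
have f3 : (3 * g).+2%:R != 0 :> R by rewrite pnatr_eq0.
have f1 : (3 * g).+1%:R != 0 :> R by rewrite pnatr_eq0.
have f2 : (2 * g).+1%:R != 0 :> R by rewrite pnatr_eq0.
have f4 : (2 * i).+1%:R != 0 :> R by rewrite pnatr_eq0.
have f5 := @factR_neq0 R (3 * g)%N; have f6 := @factR_neq0 R (2 * g)%N.
have f7 := @factR_neq0 R g; have f8 := @factR_neq0 R i; have f9 := @factR_neq0 R (2 * i)%N.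
have f10 := @factR_neq0 R j; have f11 := @factR_neq0 R (2 * j)%N.
have f12 : (4 / 27) ^+ j != 0 :> R by rewrite expf_neq0// mulf_neq0// invr_eq0.
have f13 : (4 / 27) ^+ i != 0 :> R by rewrite expf_neq0// mulf_neq0// invr_eq0.
move: (_ ^+ j) (_ ^+ i) f12 f13 => ej ei f12 f13.
move: (_.+2%:R) f3 => t3 f3; move: ((3 * g).+1%:R) f1 => t1 f1; move: ((2 * g).+1%:R) f2 => t2 f2.
move: ((2 * i).+1%:R) f4 => t4 f4; move: ((3 * i).+1%:R) => t5.
field.
by rewrite f1 f3 f4 f5 f6 f7 f8 f9 f10 f11 f12 f13.
Qed.

Lemma Rintegral_bernsteinM_sym k n j n' : (k <= n)%N -> (j <= n')%N ->
  \int[mu]_(x in `[0, 1]) (bernstein k n x * bernstein j n' x) =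
  \int[mu]_(x in `[0, 1]) (bernstein (n - k) n x * bernstein (n' - j) n' x).
Proof.
move=> kn jn; rewrite !Rintegral_bernsteinM ?leq_subr// !subKn//.
by congr (_ / _); ring.
Qed.

(** The reflection of x to 1 - x exchanges j and i and turns the odd index into the even index 2
    i. *)
Lemma Rintegral_bernstein_odd j i (g := (j + i)%N) :
  \int[mu]_(x in `[0, 1]) (bernstein (2 * j).+1 (2 * g + 1) x * bernstein j g x) =
  tbin j * tbin i / tbin g * ratio31 j g.
Proof.
rewrite Rintegral_bernsteinM_sym ?leq_addr//; last by rewrite /g; lia.
have -> : (2 * g + 1 - (2 * j).+1 = 2 * i)%N by rewrite /g; lia.
have -> : (g - j = i)%N by rewrite /g; lia.
by have := Rintegral_bernstein_even i j; rewrite [(i + j)%N]addnC -/g [tbin i * _]mulrC.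
Qed.

Lemma Rintegral_bernstein_half k g : (k <= 2 * g + 1)%N ->
  \int[mu]_(x in `[0, 1]) (bernstein k (2 * g + 1) x * bernstein k./2 g x) =
  tbin k./2 * tbin (g - k./2) / tbin g * ratio31 (if odd k then k./2 else (g - k./2)%N) g.
Proof.
move=> kg; have jg : (k./2 <= g)%N by lia.
case: (boolP (odd k)) => ok.
  have [j [i [kE gE]]] : exists j i, k = (2 * j).+1 /\ g = (j + i)%N.
    by exists k./2, (g - k./2)%N; split; lia.
  have e : k./2 = j by lia.
  by rewrite e {1}kE gE Rintegral_bernstein_odd addKn.
have [j [i [kE gE]]] : exists j i, k = (2 * j)%N /\ g = (j + i)%N.
  by exists k./2, (g - k./2)%N; split; lia.
have e : k./2 = j by lia.
by rewrite e {1}kE gE Rintegral_bernstein_even addKn.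
Qed.

End BernsteinProducts.

(** * Limits of quotients of scaled binomial coefficients *)

Section Limits.
Context {R : realType}.
Implicit Types (u : nat -> R) (k : nat -> nat).

Lemma ratio_cvg_infty k (a : R) : 0 < a -> (k h)%:R / h%:R @[h --> \oo] --> a ->
  k @ \oo --> \oo.
Proof.
move=> a0 ka A [N _ NA].
have ka2 : \forall h \near \oo, a / 2 <= (k h)%:R / h%:R by apply: (cvgr_ge a ka); lra.
have [n0 hn0] : exists n0 : nat, N%:R / (a / 2) <= n0%:R :> R.
  by exists (Num.bound (N%:R / (a / 2))); rewrite ltW// archi_boundP// divr_ge0// divr_ge0// ltW.
suff : \forall h \near \oo, (N <= k h)%N by apply: filterS => h; exact: NA.
near=> h.
have h1 : a / 2 <= (k h)%:R / h%:R by near: h.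
have h0 : (0 < h)%N by near: h; exact: near_gt0n.
have h2 : (n0 <= h)%N by near: h; exists n0.
move: h1; rewrite ler_pdivlMr ?ltr0n// => h1.
rewrite -(ler_nat R); apply: le_trans h1.
rewrite mulrC -ler_pdivrMr ?divr_gt0//; apply: le_trans hn0 _.
by rewrite ler_nat.
Unshelve. all: by end_near. Qed.

(** Used with u = [cbin] and u = [tbin]. Squaring postpones the square roots to a single continuity
    argument. *)
Lemma bin_ratio_cvg u (tau a b c : R) (k i g : nat -> nat) :
  0 < tau -> 0 < a -> 0 < b -> 0 < c ->
  n%:R * u n ^+ 2 @[n --> \oo] --> tau ->
  (k h)%:R / h%:R @[h --> \oo] --> a ->
  (i h)%:R / h%:R @[h --> \oo] --> b ->
  (g h)%:R / h%:R @[h --> \oo] --> c ->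
  h%:R * (u (k h) * u (i h) / u (g h)) ^+ 2 @[h --> \oo] --> tau * c / (a * b).
Proof.
move=> tau0 a0 b0 c0 hu ka ib gc.
have ky := ratio_cvg_infty a0 ka; have iy := ratio_cvg_infty b0 ib.
have gy := ratio_cvg_infty c0 gc.
have uk := cvg_comp k (fun n => n%:R * u n ^+ 2) ky hu.
have ui := cvg_comp i (fun n => n%:R * u n ^+ 2) iy hu.
have ug := cvg_comp g (fun n => n%:R * u n ^+ 2) gy hu.
have -> : tau * c / (a * b) = tau * tau / tau * (a^-1 * b^-1 * c).
  by field; rewrite !gt_eqF.
have pos (q : nat -> nat) : q @ \oo --> \oo -> \forall h \near \oo, (0 < q h)%N.
  by move=> qy; apply: (qy [set n | (0 < n)%N]); exists 1%N.
have k1 := pos _ ky; have i1 := pos _ iy; have g1 := pos _ gy.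
have t0 : tau != 0 by rewrite gt_eqF.
have a0' : a != 0 by rewrite gt_eqF.
have b0' : b != 0 by rewrite gt_eqF.
apply: (near_cvg (cvgM (cvgM (cvgM uk ui) (cvgV t0 ug)) (cvgM (cvgM (cvgV a0' ka) (cvgV b0' ib)) gc))).
near=> h; rewrite /=.
have h0 : (h%:R : R) != 0 by rewrite pnatr_eq0 -lt0n; near: h; exact: near_gt0n.
have k0 : ((k h)%:R : R) != 0 by rewrite pnatr_eq0 -lt0n; near: h.
have i0 : ((i h)%:R : R) != 0 by rewrite pnatr_eq0 -lt0n; near: h.
have g0 : ((g h)%:R : R) != 0 by rewrite pnatr_eq0 -lt0n; near: h.
have u0 : u (g h) != 0.
  have : 0 < (g h)%:R * u (g h) ^+ 2 by near: h; exact: (cvgr_gt tau ug).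
  by apply: contraTneq => ->; rewrite expr0n/= mulr0 ltxx.
field.
by rewrite h0 k0 i0 g0 u0.
Unshelve. all: by end_near. Qed.

End Limits.

Section SecondMoment.
Context {R : realType}.
Local Notation mu := (@lebesgue_measure R).
Implicit Types (x y : R).

(* The value of [Zker (2 * h) y] on the cell [`]k / (2h), (k + 1) / (2h)]]. *)
Definition zpoly (h k : nat) x : R :=
  4 * h%:R * bernstein k (2 * h).-1 x - h%:R * bernstein k./2 h.-1 x.

Definition zsq (h k : nat) : R := \int[mu]_(x in `[0, 1]) (zpoly h k x ^+ 2).

Definition bsq (k n : nat) : R := \int[mu]_(x in `[0, 1]) (bernstein k n x ^+ 2).

(** Cell k of mesh 1 / (2 g + 2) lies in cell [k./2] of mesh 1 / (g + 1), so this is the cross term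
    in the square of [zpoly g.+1 k]. *)
Definition bcross (k g : nat) : R :=
  \int[mu]_(x in `[0, 1]) (bernstein k (2 * g + 1) x * bernstein k./2 g x).

Lemma integrable_continuous (f : R -> R) (a b : R) : continuous f ->
  mu.-integrable `[a, b] (EFin \o f).
Proof. by move=> cf; apply: continuous_integrable_itv; exact: continuous_subspaceT. Qed.

Lemma continuous_mulf (f g : R -> R) : continuous f -> continuous g ->
  continuous (fun x => f x * g x).
Proof. by move=> cf cg x; apply: cvgM; [exact: cf | exact: cg]. Qed.

Lemma continuous_addf (f g : R -> R) : continuous f -> continuous g ->
  continuous (fun x => f x + g x).
Proof. by move=> cf cg x; apply: cvgD; [exact: cf | exact: cg]. Qed.

Lemma continuous_subf (f g : R -> R) : continuous f -> continuous g ->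
  continuous (fun x => f x - g x).
Proof. by move=> cf cg x; apply: cvgB; [exact: cf | exact: cg]. Qed.

Lemma continuous_scalef (c : R) (f : R -> R) : continuous f -> continuous (fun x => c * f x).
Proof. by move=> cf x; apply: cvgM; [exact: cvg_cst | exact: cf]. Qed.

Lemma continuous_sqrf (f : R -> R) : continuous f -> continuous (fun x => f x ^+ 2).
Proof. by move=> cf; under eq_fun do rewrite expr2; exact: continuous_mulf. Qed.

Lemma continuous_zpoly h k : continuous (zpoly h k).
Proof.
by apply: continuous_subf; apply: continuous_scalef; exact: continuous_bernstein.
Qed.

Lemma zsqE g k : zsq g.+1 k =
  g.+1%:R ^+ 2 * (16 * bsq k (2 * g + 1) - 8 * bcross k g + bsq k./2 g).
Proof.
have c1 := @continuous_bernstein R k (2 * g + 1).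
have c2 := @continuous_bernstein R k./2 g.
rewrite /zsq /zpoly /bsq /bcross.
have -> : (2 * g.+1).-1 = (2 * g + 1)%N by lia.
under eq_Rintegral => x _.
  rewrite (_ : _ ^+ 2 = (16 * g.+1%:R ^+ 2) * bernstein k (2 * g + 1) x ^+ 2
    - (8 * g.+1%:R ^+ 2) * (bernstein k (2 * g + 1) x * bernstein k./2 g x)
    + g.+1%:R ^+ 2 * bernstein k./2 g x ^+ 2); last by rewrite /=; ring.
  over.
have i1 := continuous_sqrf c1; have i2 := continuous_mulf c1 c2; have i3 := continuous_sqrf c2.
rewrite RintegralD// ?RintegralB// ?RintegralZl//; try by apply: integrable_continuous => //;
  try (by apply: continuous_scalef); try by apply: continuous_subf; apply: continuous_scalef.
by ring.
Qed.

Lemma zsq_ge0 h k : 0 <= zsq h k.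
Proof. by apply: Rintegral_ge0 => x _; exact: sqr_ge0. Qed.

(** The cross term is removed by (4 b - c)^2 + (4 b + c)^2 = 32 b^2 + 2 c^2. *)
Lemma zsq_le g k : zsq g.+1 k <= g.+1%:R ^+ 2 * (32 * bsq k (2 * g + 1) + 2 * bsq k./2 g).
Proof.
have c1 := @continuous_bernstein R k (2 * g + 1).
have c2 := @continuous_bernstein R k./2 g.
have i1 := continuous_sqrf c1; have i3 := continuous_sqrf c2.
have -> : g.+1%:R ^+ 2 * (32 * bsq k (2 * g + 1) + 2 * bsq k./2 g) =
  \int[mu]_(x in `[0, 1]) ((32 * g.+1%:R ^+ 2) * bernstein k (2 * g + 1) x ^+ 2
    + (2 * g.+1%:R ^+ 2) * bernstein k./2 g x ^+ 2).
  rewrite RintegralD// ?RintegralZl//; try by apply: integrable_continuous => //;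
    try by apply: continuous_scalef.
  by rewrite /bsq; ring.
apply: le_Rintegral => //.
- by apply: integrable_continuous; exact/continuous_sqrf/continuous_zpoly.
- by apply: integrable_continuous; apply: continuous_addf; apply: continuous_scalef.
move=> x _; rewrite /zpoly (_ : (2 * g.+1).-1 = (2 * g + 1)%N); last by lia.
rewrite /= -subr_ge0; set b := bernstein k _ x; set c := bernstein k./2 g x.
rewrite (_ : _ - _ = g.+1%:R ^+ 2 * (4 * b + c) ^+ 2); last by ring.
by rewrite mulr_ge0 ?sqr_ge0.
Qed.

(** The factor k + 1 in place of k makes the bound meaningful for k = 0, that is, for cells touching
    an end point. *)
Lemma cbin_le k : k.+1%:R * cbin k ^+ 2 <= 1 :> R.
Proof.
case: k => [|k]; first by rewrite /cbin bin0 expr0 divr1 expr1n mulr1.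
have [_ h] := @cbin_bounds R k.+1.
have p2 := @pi_ge2 R.
have h2 : (pi : R)^-1 <= 2^-1 by rewrite lef_pV2 ?posrE// (lt_le_trans _ p2).
apply: (@le_trans _ _ (2 * (k.+1%:R * cbin k.+1 ^+ 2))); last by lra.
by rewrite mulrA ler_wpM2r ?sqr_ge0// -natrM ler_nat; lia.
Qed.

Lemma bsq_sqr_le k i : bsq k (k + i) ^+ 2 <= 2 / (k.+1%:R * i.+1%:R * (k + i).+1%:R).
Proof.
rewrite /bsq Rintegral_bernstein_sqr.
have [h _] := @cbin_bounds R (k + i); have hk := cbin_le k; have hi := cbin_le i.
have p4 : (pi : R) <= 4 by have := @pihalf_lt2 R; lra.
have p0 := @pi_gt0 R.
have c0 := @cbin_gt0 R (k + i).
have n0 : (0 : R) < (k + i).*2.+1%:R by rewrite ltr0n.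
have k0 : (0 : R) < k.+1%:R by rewrite ltr0n.
have i0 : (0 : R) < i.+1%:R by rewrite ltr0n.
have m0 : (0 : R) < (k + i).+1%:R by rewrite ltr0n.
(* The bound pi <= 4 weakens 2 / pi to 1 / 2. *)
have h' : 2^-1 <= (k + i).*2.+1%:R * cbin (k + i) ^+ 2 :> R.
  apply: le_trans h; rewrite ler_pdivlMr//; lra.
have nm : (k + i).+1%:R <= (k + i).*2.+1%:R :> R by rewrite ler_nat ltnS -addnn leq_addr.
move: (cbin k) (cbin i) (cbin (k + i)) hk hi c0 h' {h} => ck ci c hk hi c0 h'.
move: (k + i).*2.+1%:R (k + i).+1%:R n0 m0 nm h' => n m n0 m0 nm h'.
rewrite exprMn exprVn exprMn ler_pdivrMr ?mulr_gt0 ?exprn_gt0//.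
rewrite [leRHS]mulrAC ler_pdivlMr ?mulr_gt0// exprMn.
have -> : ck ^+ 2 * ci ^+ 2 * (k.+1%:R * i.+1%:R * m) =
  (k.+1%:R * ck ^+ 2) * (i.+1%:R * ci ^+ 2) * m by ring.
have e1 : k.+1%:R * ck ^+ 2 * (i.+1%:R * ci ^+ 2) <= 1.
  by rewrite mulr_ile1// mulr_ge0// sqr_ge0.
apply: (@le_trans _ _ (1 * m)); first by rewrite ler_wpM2r// ltW.
rewrite mul1r; apply: (le_trans nm).
have -> : 2 * (n ^+ 2 * c ^+ 2) = n * (2 * (n * c ^+ 2)) by ring.
by rewrite -{1}[n]mulr1 ler_wpM2l ?(ltW n0)//; lra.
Qed.

(* The integrable majorant for dominated convergence in [cell_variance_cvg]. *)
Lemma zsq_bound g k y : 0 < y < 1 -> k%:R < (2 * g.+1)%:R * y -> (2 * g.+1)%:R * y <= k.+1%:R ->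
  zsq g.+1 k <= 20 * Num.sqrt g.+1%:R / Num.sqrt (y * (1 - y)).
Proof.
have kgE : (k < 2 * g.+1)%N -> (k <= 2 * g + 1)%N by lia.
have jg0 : (k <= 2 * g + 1)%N -> (k./2 <= g)%N by lia.
have half1 : (k./2 * 2 <= k)%N by lia.
have half2 : (k.+1 <= (k./2).+1 * 2)%N by lia.
have half3 : ((2 * g.+1) <= (2 * g + 1).+1)%N by lia.
have sub1 : (2 * g.+1 - k = (2 * g + 1).+1 - k)%N by congr (_ - _)%N; lia.
move=> /andP[y0 y1] k1 k2.
have y1' : 0 < 1 - y by rewrite subr_gt0.
set w := y * (1 - y); have w0 : 0 < w by rewrite mulr_gt0.
set H : R := g.+1%:R; have H0 : 0 < H by rewrite ltr0n.
have e2 : (2 * g.+1)%:R = 2 * H :> R by rewrite natrM.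
rewrite e2 in k1 k2.
have kg : (k <= 2 * g + 1)%N.
  have : k%:R < (2 * g.+1)%:R :> R by rewrite e2 (lt_trans k1)// gtr_pMr// mulr_gt0.
  by rewrite ltr_nat => /kgE.
(* Common to both orders: c is the number of cells, and the hypotheses say that y lies left of the
   right end of its cell, and 1 - y likewise after reflection. *)
have bnd (j i : nat) (c : R) : 0 < c -> c * y <= j.+1%:R -> c * (1 - y) <= i.+1%:R ->
    c <= (j + i).+1%:R -> bsq j (j + i) <= Num.sqrt (2 / (c ^+ 3 * w)).
  move=> c0 h1 h2 h3.
  have b0 : 0 <= bsq j (j + i) by apply: Rintegral_ge0 => x _; exact: sqr_ge0.
  rewrite -(ger0_norm b0) -sqrtr_sqr ler_sqrt; last first.
    by rewrite divr_ge0// mulr_ge0// ?exprn_ge0// ltW.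
  apply: le_trans (bsq_sqr_le _ _) _.
  rewrite ler_wpM2l// lef_pV2 ?posrE ?mulr_gt0 ?exprn_gt0//.
  have -> : c ^+ 3 * w = (c * y) * (c * (1 - y)) * c by rewrite /w; ring.
  by rewrite !ler_pM// ?mulr_ge0// ltW.
have k2' : 2 * H - k%:R = (2 * g + 1 - k).+1%:R :> R.
  rewrite -subSn// -sub1 natrB ?e2//.
  by rewrite -(ler_nat R) (le_trans (ltW k1))// e2 ler_piMr ?mulr_ge0// ltW.
have B1 : bsq k (2 * g + 1) <= Num.sqrt (2 / ((2 * H) ^+ 3 * w)).
  have {1}-> : (2 * g + 1 = k + (2 * g + 1 - k))%N by rewrite subnKC.
  apply: bnd; rewrite ?mulr_gt0//.
    by rewrite -k2' mulrBr mulr1 lerD2l lerN2 ltW.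
  by rewrite -e2 ler_nat subnKC.
have B2 : bsq k./2 g <= Num.sqrt (2 / (H ^+ 3 * w)).
  have jg := jg0 kg.
  have {1}-> : (g = k./2 + (g - k./2))%N by rewrite subnKC.
  have j1 : (k./2)%:R <= k%:R / 2 :> R by rewrite ler_pdivlMr// -natrM ler_nat.
  have j2 : k.+1%:R / 2 <= (k./2).+1%:R :> R by rewrite ler_pdivrMr// -natrM ler_nat.
  apply: bnd => //.
  - by apply: le_trans j2; lra.
  - rewrite -subSn// natrB ?(leq_trans jg)// -/H; lra.
  - by rewrite subnKC.
apply: le_trans (zsq_le g k) _; rewrite -/H.
have s2 : 0 < Num.sqrt H by rewrite sqrtr_gt0.
have sw : 0 < Num.sqrt w by rewrite sqrtr_gt0.
have HH : H = Num.sqrt H ^+ 2 by rewrite sqr_sqrtr// ltW.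
have q1 : Num.sqrt (2 / ((2 * H) ^+ 3 * w)) = 2^-1 * (Num.sqrt H ^+ 3 * Num.sqrt w)^-1.
  rewrite (_ : 2 / _ = (2^-1 * (Num.sqrt H ^+ 3 * Num.sqrt w)^-1) ^+ 2).
    by rewrite sqrtr_sqr gtr0_norm// mulr_gt0// invr_gt0 mulr_gt0// exprn_gt0.
  have -> : (2^-1 * (Num.sqrt H ^+ 3 * Num.sqrt w)^-1) ^+ 2 = 4^-1 / ((Num.sqrt H ^+ 2) ^+ 3 * Num.sqrt w ^+ 2).
    by field; rewrite !gt_eqF.
  by rewrite -HH sqr_sqrtr ?(ltW w0)//; field; rewrite !gt_eqF.
have q2 : Num.sqrt (2 / (H ^+ 3 * w)) <= 2 * (Num.sqrt H ^+ 3 * Num.sqrt w)^-1.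
  apply: (@le_trans _ _ (Num.sqrt ((2 * (Num.sqrt H ^+ 3 * Num.sqrt w)^-1) ^+ 2))).
    have -> : (2 * (Num.sqrt H ^+ 3 * Num.sqrt w)^-1) ^+ 2 = 4 / ((Num.sqrt H ^+ 2) ^+ 3 * Num.sqrt w ^+ 2).
      by field; rewrite !gt_eqF.
    have Hw : 0 <= (H ^+ 3 * w)^-1.
      by rewrite invr_ge0; apply: mulr_ge0; [rewrite exprn_ge0// ltW | exact: ltW].
    rewrite -HH sqr_sqrtr ?(ltW w0)// ler_sqrt; last by apply: mulr_ge0.
    by rewrite ler_wpM2r// ler_nat.
  by rewrite sqrtr_sqr gtr0_norm// mulr_gt0// invr_gt0 mulr_gt0// exprn_gt0.
rewrite q1 in B1; have {}B2 := le_trans B2 q2.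
(* 20 = 32 / 2 + 2 * 2, from the bounds [B1] and [B2]. *)
apply: (@le_trans _ _ (H ^+ 2 * (20 * (Num.sqrt H ^+ 3 * Num.sqrt w)^-1))).
  rewrite ler_wpM2l ?sqr_ge0//; lra.
rewrite {1}HH le_eqVlt; apply/orP; left; apply/eqP.
by field; rewrite !gt_eqF.
Qed.

Lemma sqrt_cvg (u : nat -> R) (l : R) : u @ \oo --> l ->
  Num.sqrt (u n) @[n --> \oo] --> Num.sqrt l.
Proof. by move=> ul; exact: (cvg_comp u Num.sqrt ul (@sqrt_continuous R l)). Qed.

Lemma near_squeeze_div (u : nat -> R) (a b : R) :
  (\forall h \near \oo, a * h%:R - b <= u h <= a * h%:R + b) ->
  u h / h%:R @[h --> \oo] --> a.
Proof.
move=> hu.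
apply: (@squeeze_cvgr _ _ _ _ (fun h => a - b * h%:R^-1) (fun h => a + b * h%:R^-1)); last 2 first.
- rewrite -[X in _ --> X]subr0 -(mulr0 b); apply: cvgB; first exact: cvg_cst.
  by apply: cvgM; [exact: cvg_cst | exact: invn_cvg0].
- rewrite -[X in _ --> X]addr0 -(mulr0 b); apply: cvgD; first exact: cvg_cst.
  by apply: cvgM; [exact: cvg_cst | exact: invn_cvg0].
near=> h.
have h0 : (0 : R) < h%:R by rewrite ltr0n; near: h; exact: near_gt0n.
have /andP[h1 h2] : a * h%:R - b <= u h <= a * h%:R + b by near: h.
apply/andP; split.
  by rewrite ler_pdivlMr// mulrBl -mulrA mulVf ?gt_eqF// mulr1.
by rewrite ler_pdivrMr// mulrDl -mulrA mulVf ?gt_eqF// mulr1.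
Unshelve. all: by end_near. Qed.

Lemma inv_succ_cvg0 (k : nat -> nat) : k @ \oo --> \oo ->
  (k h).+1%:R^-1 @[h --> \oo] --> (0 : R).
Proof. by move=> ky; exact: (cvg_comp k (@harmonic R) ky (@cvg_harmonic R)). Qed.

Lemma half_bounds (m : nat) : ((m./2)%:R : R) <= m%:R / 2 /\ m%:R / 2 - 1 <= (m./2)%:R :> R.
Proof.
have h1 : (m./2 * 2 <= m)%N by lia.
have h2 : (m <= (m./2).+1 * 2)%N by lia.
split; first by rewrite ler_pdivlMr// -natrM ler_nat.
by rewrite lerBlDr ler_pdivrMr// natr1 -natrM ler_nat.
Qed.

Lemma half_le_pred m h : (m <= 2 * h.-1 + 1)%N -> (m./2 <= h.-1)%N.
Proof. lia. Qed.

Lemma ltn_double_pred m h : (m < 2 * h)%N -> (m <= 2 * h.-1 + 1)%N.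
Proof. lia. Qed.

Lemma double_pred1 h : (0 < h)%N -> (h.-1.*2.+1 = (2 * h).-1)%N.
Proof. lia. Qed.

Lemma double_pred2 h : (0 < h)%N -> ((2 * h.-1 + 1).*2.+1 = (4 * h).-1)%N.
Proof. lia. Qed.

Lemma natr_pred h : (0 < h)%N -> h.-1%:R = h%:R - 1 :> R.
Proof. by case: h => // h _; rewrite /= -natr1 addrK. Qed.

(** The parity of the cell index selects the argument of [ratio31]. The lower bound subtracts the
    errors of both alternatives, so the selection does not affect the limit. *)
Lemma ratio31_cvg (k i : nat -> nat) (b : nat -> bool) :
  k @ \oo --> \oo -> i @ \oo --> \oo ->
  h%:R * ratio31 (if b h then k h else i h) h.-1 @[h --> \oo] --> (3^-1 : R).
Proof.
move=> ky iy.
pose l h := if b h then k h else i h.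
have L : (3 * l h + 1)%:R / (2 * l h + 1)%:R @[h --> \oo] --> (3 / 2 : R).
  apply: (@squeeze_cvgr _ _ _ _
    (fun h => 3 / 2 - ((k h).+1%:R^-1 + (i h).+1%:R^-1)) (fun=> 3 / 2)); last 2 first.
  - rewrite -[X in _ --> X]subr0 -[0 in X in _ --> X](addr0 0).
    by apply: cvgB; [exact: cvg_cst | apply: cvgD; exact: inv_succ_cvg0].
  - exact: cvg_cst.
  apply: nearW => h.
  have -> : (3 * l h + 1)%:R / (2 * l h + 1)%:R = 3 / 2 - (2 * (2 * l h + 1)%:R)^-1 :> R.
    rewrite !addn1 -!natr1 !natrM; field.
    by rewrite gt_eqF// ltr_wpDl// mulr_ge0.
  apply/andP; split; last by rewrite gerBl invr_ge0.
  rewrite lerD2l lerN2.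
  apply: (@le_trans _ _ ((l h).+1%:R^-1)).
    rewrite lef_pV2 ?posrE ?mulr_gt0 ?ltr0n ?addn1// -natrM ler_nat.
    by lia.
  by rewrite /l; case: (b h); rewrite ?lerDl ?lerDr invr_ge0.
have Q : h%:R * (2 * h.-1 + 1)%:R / ((3 * h.-1 + 2)%:R * (3 * h.-1 + 1)%:R) @[h --> \oo]
    --> (2 / 9 : R).
  have c1 : (2 - h%:R^-1) / ((3 - h%:R^-1) * (3 - 2 * h%:R^-1)) @[h --> \oo] -->
      ((2 - 0) / ((3 - 0) * (3 - 2 * 0)) : R).
    have iv := invn_cvg0 (R := R).
    apply: cvgM; first by apply: cvgB => //; exact: cvg_cst.
    apply: cvgV; first by rewrite mulr0 !subr0 mulf_neq0.
    apply: cvgM; apply: cvgB; [exact: cvg_cst | exact: iv | exact: cvg_cst |].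
    by apply: cvgM => //; exact: cvg_cst.
  have -> : 2 / 9 = (2 - 0) / ((3 - 0) * (3 - 2 * 0)) :> R by field.
  apply: (near_cvg c1); near=> h.
  have h0 : (0 < h)%N by near: h; exact: near_gt0n.
  have hR : (0 : R) < h%:R by rewrite ltr0n.
  have h1 : (1 : R) <= h%:R by rewrite ler1n.
  rewrite !addn2 !addn1 -!natr1 !natrM natr_pred//; field.
  by rewrite !gt_eqF//; lra.
have -> : 3^-1 = 3 / 2 * (2 / 9) :> R by field.
apply: (near_cvg (cvgM L Q)); apply: nearW => h; rewrite /= /ratio31 -/(l h).
by rewrite !invfM; ring.
Unshelve. all: by end_near. Qed.

Lemma zsqE_pred h k : (0 < h)%N ->
  zsq h k = h%:R ^+ 2 * (16 * bsq k (2 * h.-1 + 1) - 8 * bcross k h.-1 + bsq k./2 h.-1).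
Proof. by case: h => // g _; exact: zsqE. Qed.

Lemma bsq_ge0 k n : 0 <= bsq k n.
Proof. by apply: Rintegral_ge0 => x _; exact: sqr_ge0. Qed.

Lemma bcross_ge0 k g : 0 <= bcross k g.
Proof.
by apply: Rintegral_ge0 => x /=; rewrite in_itv/= => x01; rewrite mulr_ge0// bernstein_ge0.
Qed.

Lemma sqrtr_uniq (a b : R) : 0 <= b -> b ^+ 2 = a -> Num.sqrt a = b.
Proof. by move=> b0 <-; rewrite sqrtr_sqr ger0_norm. Qed.

Lemma psiE (y : R) : 0 < y -> 0 < 1 - y ->
  psi y = Num.sqrt (4 * pi * (y * (1 - y)))^-1.
Proof.
move=> y0 y1; have p0 := @pi_gt0 R.
have q0 : 0 <= 4 * pi * (y * (1 - y)) by rewrite !mulr_ge0// ltW.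
by rewrite /psi -mulrA powRN powR12_sqrt// sqrtrV.
Qed.

(** The origin of [C3]: relative to [psi y] the three terms are 16 / sqrt 8, 8 / sqrt 3 and 1. The
    factor sqrt 2 appears because [zsq_cvg] divides by sqrt h while the order is 2 h. *)
Lemma psi_limit_identity (y : R) (w := y * (1 - y)) : 0 < y -> 0 < 1 - y ->
  Num.sqrt 2 * (C3 * psi y) = 16 * Num.sqrt (32 * pi * w)^-1
    - 8 * Num.sqrt (12 * pi * w)^-1 + Num.sqrt (4 * pi * w)^-1.
Proof.
move=> y0 y1; rewrite psiE// -/w.
have w0 : 0 < w by rewrite mulr_gt0.
have p0 := @pi_gt0 R.
set s := Num.sqrt (4 * pi * w)^-1.
have s0 : 0 <= s by exact: sqrtr_ge0.
have s2 : s ^+ 2 = (4 * pi * w)^-1.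
  by rewrite /s sqr_sqrtr// invr_ge0 !mulr_ge0// ltW.
have r2 : (0 : R) < Num.sqrt 2 by rewrite sqrtr_gt0.
have r3 : (0 : R) < Num.sqrt 3 by rewrite sqrtr_gt0.
have e2 : Num.sqrt 2 ^+ 2 = 2 :> R by rewrite sqr_sqrtr.
have e3 : Num.sqrt 3 ^+ 2 = 3 :> R by rewrite sqr_sqrtr.
have -> : Num.sqrt (32 * pi * w)^-1 = s / (2 * Num.sqrt 2).
  apply: sqrtr_uniq; first by rewrite divr_ge0// mulr_ge0// ltW.
  rewrite expr_div_n s2 exprMn e2; move: (pi : R) p0 => q q0.
  by field; rewrite !gt_eqF.
have -> : Num.sqrt (12 * pi * w)^-1 = s / Num.sqrt 3.
  apply: sqrtr_uniq; first by rewrite divr_ge0// ltW.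
  rewrite expr_div_n s2 e3; move: (pi : R) p0 => q q0.
  by field; rewrite !gt_eqF.
have e23 : Num.sqrt (2 / 3) = Num.sqrt 2 / Num.sqrt 3 :> R.
  apply: sqrtr_uniq; first by rewrite divr_ge0// ltW.
  by rewrite expr_div_n e2 e3.
rewrite /C3 e23; move: s s0 s2 => s s0 s2.
have -> : 16 * (s / (2 * Num.sqrt 2)) = 4 * Num.sqrt 2 * s.
  by rewrite -[4](_ : 8 / Num.sqrt 2 ^+ 2 = _ :> R); [field; rewrite gt_eqF | rewrite e2; field].
transitivity (s + 4 * Num.sqrt 2 * s - 4 * Num.sqrt 2 ^+ 2 / Num.sqrt 3 * s).
  by field; rewrite !gt_eqF.
by rewrite e2; field; rewrite gt_eqF.
Qed.

(** Here y is a fixed interior point and k h the index of its cell. All indices are then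
    proportional to h in the limit, and [bin_ratio_cvg] applies to each of the three inner products
    in [zsqE]. *)
Lemma zsq_cvg (y : R) (k : nat -> nat) : 0 < y < 1 ->
  (forall h, (0 < h)%N -> (k h)%:R < (2 * h)%:R * y <= (k h).+1%:R) ->
  zsq h (k h) / Num.sqrt h%:R @[h --> \oo] --> Num.sqrt 2 * (C3 * psi y).
Proof.
move=> /andP[y0 y1'] hk.
have y1 : 0 < 1 - y by rewrite subr_gt0.
have kle h : (0 < h)%N -> (k h <= 2 * h.-1 + 1)%N.
  move=> h0; apply: ltn_double_pred.
  rewrite -(ltr_nat R); have /andP[k1 _] := hk h h0; apply: lt_trans k1 _.
  by rewrite gtr_pMr ?ltr0n ?muln_gt0.
have kbnd h : (0 < h)%N -> 2 * h%:R * y - 1 <= (k h)%:R <= 2 * h%:R * y.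
  move=> h0; have /andP[] := hk h h0; rewrite natrM -[(k h).+1%:R]natr1 => k1 k2.
  by rewrite lerBlDr k2 ltW.
have kh : (k h)%:R / h%:R @[h --> \oo] --> 2 * y.
  apply: (@near_squeeze_div _ _ 1); near=> h.
  have h0 : (0 < h)%N by near: h; exact: near_gt0n.
  by have /andP[k1 k2] := kbnd h h0; apply/andP; split; lra.
have jh : (k h)./2%:R / h%:R @[h --> \oo] --> y.
  apply: (@near_squeeze_div _ _ 2); near=> h.
  have h0 : (0 < h)%N by near: h; exact: near_gt0n.
  have /andP[k1 k2] := kbnd h h0.
  by have [h1 h2] := half_bounds (k h); apply/andP; split; lra.
have gh : h.-1%:R / h%:R @[h --> \oo] --> (1 : R).
  apply: (@near_squeeze_div _ _ 1); near=> h.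
  have h0 : (0 < h)%N by near: h; exact: near_gt0n.
  by rewrite natr_pred//; apply/andP; split; lra.
have nh : (2 * h.-1 + 1)%:R / h%:R @[h --> \oo] --> (2 : R).
  apply: (@near_squeeze_div _ _ 2); near=> h.
  have h0 : (0 < h)%N by near: h; exact: near_gt0n.
  by rewrite natrD natrM natr_pred//; apply/andP; split; lra.
have ih : (2 * h.-1 + 1 - k h)%:R / h%:R @[h --> \oo] --> 2 * (1 - y).
  apply: (@near_squeeze_div _ _ 3); near=> h.
  have h0 : (0 < h)%N by near: h; exact: near_gt0n.
  have /andP[k1 k2] := kbnd h h0.
  by rewrite natrB ?kle// natrD natrM natr_pred//; apply/andP; split; lra.
have ijh : (h.-1 - (k h)./2)%:R / h%:R @[h --> \oo] --> 1 - y.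
  apply: (@near_squeeze_div _ _ 3); near=> h.
  have h0 : (0 < h)%N by near: h; exact: near_gt0n.
  have /andP[k1 k2] := kbnd h h0.
  have [h1 h2] := half_bounds (k h).
  have jg := half_le_pred (kle h h0).
  by rewrite natrB// natr_pred//; apply/andP; split; lra.
have p0 := @pi_gt0 R; have pV : (0 : R) < pi^-1 by rewrite invr_gt0.
have a0 : 0 < 2 * y by rewrite mulr_gt0.
have b0 : 0 < 2 * (1 - y) by rewrite mulr_gt0.
pose w := y * (1 - y); have w0 : 0 < w by rewrite mulr_gt0.
have A1 : h%:R ^+ 3 * bsq (k h) (2 * h.-1 + 1) ^+ 2 @[h --> \oo] --> (32 * pi * w)^-1.
  have t := bin_ratio_cvg pV a0 b0 (ltr0n R 2) (@cbin_sqr_cvg R) kh ih nh.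
  have c1 : h%:R / ((2 * h.-1 + 1).*2.+1)%:R @[h --> \oo] --> (4^-1 : R).
    under eq_fun do rewrite -invf_div.
    apply: cvgV => //; apply: (@near_squeeze_div _ _ 1); near=> h.
    have h0 : (0 < h)%N by near: h; exact: near_gt0n.
    rewrite double_pred2// natr_pred ?muln_gt0// natrM; apply/andP; split; lra.
  have -> : (32 * pi * w)^-1 = pi^-1 * 2 / (2 * y * (2 * (1 - y))) * (4^-1 * 4^-1).
    by move: (pi : R) p0 => q q0; rewrite /w; field; rewrite !gt_eqF.
  apply: (near_cvg (cvgM t (cvgM c1 c1))); near=> h => /=.
  have h0 : (0 < h)%N by near: h; exact: near_gt0n.
  have eb : bsq (k h) (2 * h.-1 + 1) = cbin (k h) * cbin (2 * h.-1 + 1 - k h) /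
      ((2 * h.-1 + 1).*2.+1%:R * cbin (2 * h.-1 + 1)).
    by rewrite /bsq; have := Rintegral_bernstein_sqr (R := R) (k h) (2 * h.-1 + 1 - k h);
       rewrite subnKC ?kle.
  by rewrite eb; rewrite !invfM; ring.
have A2 : h%:R ^+ 3 * bsq (k h)./2 h.-1 ^+ 2 @[h --> \oo] --> (4 * pi * w)^-1.
  have t := bin_ratio_cvg pV y0 y1 (ltr0n R 1) (@cbin_sqr_cvg R) jh ijh gh.
  have c1 : h%:R / (h.-1.*2.+1)%:R @[h --> \oo] --> (2^-1 : R).
    under eq_fun do rewrite -invf_div.
    apply: cvgV => //; apply: (@near_squeeze_div _ _ 1); near=> h.
    have h0 : (0 < h)%N by near: h; exact: near_gt0n.
    rewrite double_pred1// natr_pred ?muln_gt0// natrM; apply/andP; split; lra.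
  have -> : (4 * pi * w)^-1 = pi^-1 * 1 / (y * (1 - y)) * (2^-1 * 2^-1).
    by move: (pi : R) p0 => q q0; rewrite /w; field; rewrite !gt_eqF.
  apply: (near_cvg (cvgM t (cvgM c1 c1))); near=> h => /=.
  have h0 : (0 < h)%N by near: h; exact: near_gt0n.
  have eb : bsq (k h)./2 h.-1 = cbin (k h)./2 * cbin (h.-1 - (k h)./2) /
      (h.-1.*2.+1%:R * cbin h.-1).
    by rewrite /bsq; have := Rintegral_bernstein_sqr (R := R) (k h)./2 (h.-1 - (k h)./2);
       rewrite subnKC ?(half_le_pred (kle h h0)).
  by rewrite eb; rewrite !invfM; ring.
have A3 : h%:R ^+ 3 * bcross (k h) h.-1 ^+ 2 @[h --> \oo] --> (12 * pi * w)^-1.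
  have tau0 : (0 : R) < 3 / 4 / pi by rewrite !divr_gt0.
  have t := bin_ratio_cvg tau0 y0 y1 (ltr0n R 1) (@tbin_sqr_cvg R) jh ijh gh.
  have r := ratio31_cvg (fun h => odd (k h)) (ratio_cvg_infty y0 jh) (ratio_cvg_infty y1 ijh).
  have -> : (12 * pi * w)^-1 = 3 / 4 / pi * 1 / (y * (1 - y)) * (3^-1 * 3^-1).
    by move: (pi : R) p0 => q q0; rewrite /w; field; rewrite !gt_eqF.
  apply: (near_cvg (cvgM t (cvgM r r))); near=> h => /=.
  have h0 : (0 < h)%N by near: h; exact: near_gt0n.
  rewrite /bcross Rintegral_bernstein_half ?kle//; ring.
(* The three limits above concern squared inner products times h^3; the square root restores h^2 /
   sqrt h, the scaling of [zsq]. *)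
have cube (h : nat) (b : R) : (0 < h)%N -> 0 <= b ->
    Num.sqrt (h%:R ^+ 3 * b ^+ 2) = h%:R ^+ 2 * b / Num.sqrt h%:R.
  move=> h0 b0'; have hR : (0 : R) < h%:R by rewrite ltr0n.
  have sh : 0 < Num.sqrt (h%:R : R) by rewrite sqrtr_gt0.
  rewrite -[RHS]ger0_norm; last by rewrite divr_ge0 ?mulr_ge0 ?sqr_ge0// ltW.
  rewrite -sqrtr_sqr; congr Num.sqrt.
  rewrite !exprMn exprVn sqr_sqrtr ?(ltW hR)//; field.
  by rewrite gt_eqF.
rewrite psi_limit_identity//.
apply: (near_cvg (cvgD (cvgB (cvgM (cvg_cst (16 : R)) (sqrt_cvg A1))
  (cvgM (cvg_cst (8 : R)) (sqrt_cvg A3))) (sqrt_cvg A2))); near=> h.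
have h0 : (0 < h)%N by near: h; exact: near_gt0n.
rewrite !fctE /= !cube ?bsq_ge0 ?bcross_ge0//.
by rewrite (zsqE_pred _ h0); ring.
Unshelve. all: by end_near. Qed.

End SecondMoment.

(** * Integrability of (y (1 - y))^(-1/2) on the unit interval *)

Section InverseSqrt.
Context {R : realType}.
Local Notation mu := (@lebesgue_measure R).
Implicit Types (x y : R).

Definition rsqrt01 y : R := (Num.sqrt (y * (1 - y)))^-1.

Lemma rsqrt01_ge0 y : 0 <= rsqrt01 y.
Proof. by rewrite invr_ge0 sqrtr_ge0. Qed.

Lemma continuous_rsqrt01 y : 0 < y < 1 -> {for y, continuous rsqrt01}.
Proof.
move=> /andP[y0 y1]; apply: cvgV.
  by rewrite gt_eqF// sqrtr_gt0 mulr_gt0// subr_gt0.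
apply: (@continuous_comp _ _ _ (fun y : R => y * (1 - y)) Num.sqrt); last exact: sqrt_continuous.
apply: continuous_mulf => z; first exact: cvg_id.
by apply: cvgB; [exact: cvg_cst | exact: cvg_id].
Qed.

Lemma is_derive_asin_affine y : 0 < y < 1 ->
  is_derive y (1 : R) (fun z => asin (2 * z - 1)) (rsqrt01 y).
Proof.
move=> /andP[y0 y1].
have w0 : 0 < y * (1 - y) by rewrite mulr_gt0// subr_gt0.
have a1 : -1 < 2 * y - 1 < 1 by apply/andP; split; lra.
have h1 := is_derive1_asin a1.
have h2 : is_derive y (1 : R) (fun z : R => 2 * z - 1) 2 by derive_auto; rewrite /=; ring.
have := is_derive_compf h2 h1 => /is_derive_eq; apply.
rewrite (_ : 1 - _ = (2 * Num.sqrt (y * (1 - y))) ^+ 2); last first.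
  by rewrite exprMn sqr_sqrtr ?ltW//; ring.
rewrite sqrtr_sqr ger0_norm ?mulr_ge0 ?sqrtr_ge0// /rsqrt01; field.
by rewrite gt_eqF// sqrtr_gt0.
Qed.

(** asin (2 y - 1) is an antiderivative, so the integrals over an exhaustion by closed intervals
    stay below pi; monotone convergence does the rest. *)
Lemma integrable_rsqrt01 : mu.-integrable `]0, 1[ (EFin \o rsqrt01).
Proof.
have mf : measurable_fun (`]0, 1[%classic : set R) rsqrt01.
  apply: open_continuous_measurable_fun => // y; rewrite inE/= in_itv/=.
  exact: continuous_rsqrt01.
apply/integrableP; split; first exact/measurable_EFinP.
under eq_integral => y _ do rewrite /= ger0_norm ?rsqrt01_ge0//.
(* The shift by 3 gives a n < 1/2, so that every interval [a n, 1 - a n] is proper. *)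
pose a n : R := n.+3%:R^-1.
have a0 n : 0 < a n by rewrite invr_gt0.
have a2 n : a n < 2^-1 by rewrite ltf_pV2 ?posrE// ltr_nat.
pose F n : set R := `[a n, 1 - a n]%classic : set R.
have FD n : F n `<=` `]0, 1[%classic.
  move=> y; rewrite /F /= !in_itv/= => /andP[h1 h2].
  by rewrite (lt_le_trans (a0 n) h1) (le_lt_trans h2)// gtrBl.
have UF : \bigcup_n F n = `]0, 1[%classic.
  apply/seteqP; split=> [y [n _]|y]; first exact: FD.
  rewrite /= in_itv/= => /andP[y0 y1].
  have [n hn] : exists n : nat, a n <= Num.min y (1 - y).
    have m0 : 0 < Num.min y (1 - y) by rewrite lt_min y0 subr_gt0.
    exists (Num.bound (Num.min y (1 - y))^-1).
    rewrite invf_ple ?posrE//; apply: le_trans (ltW (archi_boundP _)) _.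
      by rewrite invr_ge0 ltW.
    by rewrite ler_nat; do 3 apply: leqW.
  exists n => //; move: hn; rewrite /F /= in_itv/= le_min => /andP[-> h]; lra.
have ndF : nondecreasing_seq F.
  move=> m n mn; apply/subsetPset => y; rewrite /F /= !in_itv/= => /andP[h1 h2].
  have : a n <= a m by rewrite lef_pV2 ?posrE// ler_nat.
  by move=> anm; apply/andP; split; lra.
have C : ((\int[mu]_(y in F i) (rsqrt01 y)%:E)%E @[i --> \oo] -->
    (\int[mu]_(y in \bigcup_i F i) (rsqrt01 y)%:E)%E).
  apply: ge0_nondecreasing_set_cvg_integral => //.
  - by move=> i; exact: measurable_itv.
  - by move=> i; apply/measurable_EFinP; exact: measurable_funS mf.
  - by move=> i y _; rewrite lee_fin rsqrt01_ge0.
rewrite UF in C; apply: (@le_lt_trans _ _ (pi%:E)); last exact: ltry.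
rewrite -(cvg_lim _ C)//; apply: lime_le; first by apply/cvg_ex; eexists; exact: C.
apply: nearW => n.
have anb : a n < 1 - a n by have := a2 n; lra.
have der y : y \in `[a n, 1 - a n] -> is_derive y (1 : R) (fun z => asin (2 * z - 1)) (rsqrt01 y).
  by move=> yF; apply: is_derive_asin_affine; have := FD n y yF; rewrite /= in_itv.
have cF y : y \in `[a n, 1 - a n] -> {for y, continuous (fun z : R => asin (2 * z - 1))}.
  move=> yF; have [+ _] := der y yF; move=> d1.
  exact/differentiable_continuous/derivable1_diffP.
have ain : a n \in `[a n, 1 - a n] by rewrite in_itv/= lexx ltW.
have bin : 1 - a n \in `[a n, 1 - a n] by rewrite in_itv/= lexx ltW.
rewrite (@continuous_FTC2 R rsqrt01 (fun z => asin (2 * z - 1)))//.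
- rewrite -EFinB lee_fin.
  have := a0 n; have := a2 n; move: (a n) => t t2 t0.
  have h1 : -1 <= 2 * (1 - t) - 1 <= 1 by apply/andP; split; lra.
  have h2 : -1 <= 2 * t - 1 <= 1 by apply/andP; split; lra.
  have := asin_lepi2 h1; have := asin_geNpi2 h2; lra.
- apply: continuous_in_subspaceT => y; rewrite inE => yF.
  by apply: continuous_rsqrt01; have := FD n y yF; rewrite /= in_itv.
- split.
  + move=> y yF; have [] := der y _ => //.
    by move: yF; rewrite !in_itv/= => /andP[? ?]; rewrite !ltW.
  + exact/cvg_at_right_filter/cF.
  + exact/cvg_at_left_filter/cF.
- move=> y yF; rewrite derive1E; apply: derive_val; apply: der.
  by move: yF; rewrite !in_itv/= => /andP[? ?]; rewrite !ltW.
Qed.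

End InverseSqrt.

Section RintegralSum.
Context d (T : measurableType d) (R : realType) (nu : {measure set T -> \bar R}).

Lemma integrable_Rsum (I : Type) (s : seq I) (D : set T) (g : I -> T -> R) : measurable D ->
  (forall i, nu.-integrable D (EFin \o g i)) ->
  nu.-integrable D (EFin \o (fun x => \sum_(i <- s) g i x)).
Proof.
move=> mD ig.
apply: (eq_integrable mD (fun x => \sum_(i <- s) (g i x)%:E)%E).
  by move=> x _; rewrite /= -sumEFin.
by apply: integrable_sum => // i _; exact: ig.
Qed.

Lemma Rintegral_sum (I : Type) (s : seq I) (D : set T) (g : I -> T -> R) : measurable D ->
  (forall i, nu.-integrable D (EFin \o g i)) ->
  \int[nu]_(x in D) (\sum_(i <- s) g i x) = \sum_(i <- s) \int[nu]_(x in D) g i x.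
Proof.
move=> mD ig; elim: s => [|i s IH].
  by under eq_Rintegral do rewrite big_nil; rewrite Rintegral_cst// mul0r big_nil.
under eq_Rintegral do rewrite big_cons.
by rewrite RintegralD// ?IH ?big_cons//; exact: integrable_Rsum.
Qed.

End RintegralSum.

(** * From sums over cells to integrals against the density *)

Section CellSums.
Context {R : realType}.
Local Notation mu := (@lebesgue_measure R).
Implicit Types (y : R) (m k h : nat).

Definition cell m k : set R := `]k%:R / m%:R, k.+1%:R / m%:R]%classic.

Lemma measurable_cell m k : measurable (cell m k).
Proof. exact: measurable_itv. Qed.

Lemma mem_cell m k y : (0 < m)%N ->
  (y \in cell m k) = (k%:R < m%:R * y <= k.+1%:R).
Proof.
move=> m0; have -> : (y \in cell m k) = (y \in `]k%:R / m%:R, k.+1%:R / m%:R]).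
  by apply/idP/idP; rewrite inE.
by rewrite in_itv/= ltr_pdivrMr ?ltr0n// ler_pdivlMr ?ltr0n// [y * _]mulrC.
Qed.

Lemma cell_exists m y : (0 < m)%N -> 0 < y <= 1 -> exists2 k, (k < m)%N & y \in cell m k.
Proof.
move=> m0 /andP[y0 y1].
have ex : exists n : nat, m%:R * y <= n%:R by exists m; rewrite ger_pMr ?ltr0n.
case: (ex_minnP ex) => -[|k] hk kmin.
  by move: hk; rewrite leNgt mulr_gt0 ?ltr0n.
exists k.
  by apply: kmin; rewrite ger_pMr ?ltr0n.
rewrite mem_cell// hk andbT ltNge; apply/negP => /kmin; by rewrite ltnn.
Qed.

Lemma cell_uniq m k j y : (0 < m)%N -> y \in cell m k -> y \in cell m j -> k = j.
Proof.
move=> m0; rewrite !mem_cell// => /andP[k1 k2] /andP[j1 j2]; apply/eqP; rewrite eqn_leq.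
by apply/andP; split; rewrite -ltnS -(ltr_nat R); [exact: lt_le_trans k1 j2 | exact: lt_le_trans j1 k2].
Qed.

Lemma sum_cell m k y (c : nat -> R) : (0 < m)%N -> (k < m)%N -> y \in cell m k ->
  \sum_(j < m) \1_(cell m j) y * c j = c k.
Proof.
move=> m0 km yk; rewrite (bigD1 (Ordinal km))//= indicE yk mul1r big1 ?addr0// => j.
move=> /eqP jk; rewrite indicE; have [yj|_] := boolP (y \in _); last by rewrite mul0r.
by case: jk; apply: val_inj; exact: cell_uniq yj yk.
Qed.

Lemma cell_sub01 m k : (k < m)%N -> cell m k `<=` `]0, 1].
Proof.
move=> km; have m0 : (0 < m)%N by exact: leq_ltn_trans km.
move=> y; rewrite /cell /= !in_itv/= => /andP[h1 h2]; apply/andP; split.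
  by apply: le_lt_trans h1; rewrite divr_ge0.
by apply: le_trans h2 _; rewrite ler_pdivrMr ?ltr0n// mul1r ler_nat.
Qed.

Context (f : R -> R) (M : R).
Context (mf : measurable_fun setT f) (f0 : forall y, 0 <= f y)
  (intf : mu.-integrable setT (EFin \o f))
  (fM : forall y, y \in `[0, 1] -> f y <= M).

Definition mass (A : set R) : R := \int[mu]_(y in A) f y.

(** Squared L2 norm in x of [Zker (2 * h) y], as a step function of y. *)
Definition cell_sum h y : R := \sum_(k < (2 * h)%N) \1_(cell (2 * h) k) y * zsq h k.

Lemma measurable_cell_sum h : measurable_fun setT (cell_sum h).
Proof.
apply: measurable_sum => k; apply: measurable_funM; last exact: measurable_cst.
apply: measurable_indic; exact: measurable_cell.
Qed.

Lemma integrable_mass (A : set R) : measurable A -> mu.-integrable A (EFin \o f).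
Proof. by move=> mA; apply: integrableS intf. Qed.

Lemma cell_sum_bound g y : 0 < y < 1 ->
  0 <= cell_sum g.+1 y <= 20 * Num.sqrt g.+1%:R * rsqrt01 y.
Proof.
move=> /andP[y0 y1].
have m0 : (0 < 2 * g.+1)%N by [].
have [|k km yk] := @cell_exists (2 * g.+1) y m0; first by rewrite y0 ltW.
rewrite /cell_sum (@sum_cell _ k)// zsq_ge0/=.
move: yk; rewrite mem_cell// => /andP[k1 k2].
by apply: zsq_bound => //; apply/andP.
Qed.

(** Reading the discrete second moment as the integral of a step function makes dominated
    convergence applicable. *)
Lemma Rintegral_cell_sum h :
  \int[mu]_(y in `]0, 1[) (f y * cell_sum h y) = \sum_(k < (2 * h)%N) mass (cell (2 * h) k) * zsq h k.
Proof.
have ik (k : nat) : mu.-integrable `]0, 1] (EFin \o (fun y => f y * (\1_(cell (2 * h) k) y * zsq h k))).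
  have ii : mu.-integrable `]0, 1] (EFin \o (fun y => zsq h k * f y)).
    by apply: (@integrableZl _ _ R mu _ (measurable_itv _) (zsq h k) (EFin \o f)); exact: integrable_mass.
  apply: le_integrable ii => //.
    apply/measurable_EFinP; apply: measurable_funTS; apply: measurable_funM => //.
    apply: measurable_funM; last exact: measurable_cst.
    by apply: measurable_indic; exact: measurable_cell.
  move=> y _ /=; rewrite lee_fin !normrM (ger0_norm (f0 y)) (ger0_norm (zsq_ge0 h k)) mulrA mulrC.
  rewrite ler_wpM2l ?zsq_ge0// ler_piMr// indicE; case: (_ \in _); by rewrite ?normr1 ?normr0.
under eq_Rintegral do rewrite /cell_sum mulr_sumr.
(* The last cell contains 1, so the cells fit into the half-open interval rather than the open
   one. *)
rewrite Rintegral_itv_bndo_bndc; last first.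
  have S : mu.-integrable `]0, 1] (EFin \o (fun y => \sum_(k < (2 * h)%N)
      f y * (\1_(cell (2 * h) k) y * zsq h k))).
    by apply: integrable_Rsum => // k; exact: ik.
  by move: S; apply: integrableS => //; apply: subset_itvl; rewrite bnd_simp.
rewrite Rintegral_sum//; apply: eq_bigr => k _.
under eq_Rintegral do rewrite mulrA.
rewrite RintegralZr//; last first.
  apply: le_integrable (integrable_mass (measurable_itv `]0, 1])) => //.
    apply/measurable_EFinP; apply: measurable_funTS; apply: measurable_funM => //.
    by apply: measurable_indic; exact: measurable_cell.
  move=> y _ /=; rewrite lee_fin normrM (ger0_norm (f0 y)) ler_piMr//.
  by rewrite indicE; case: (_ \in _); rewrite ?normr1 ?normr0.
congr (_ * _); rewrite /mass -[in RHS](setIidr (cell_sub01 (ltn_ord k))) Rintegral_mkcondr.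
by apply: eq_Rintegral => y _; rewrite patchE indicE; case: (_ \in _); rewrite ?mulr1 ?mulr0.
Qed.

Lemma psi_rsqrt01 y : 0 < y < 1 -> psi y = Num.sqrt (4 * pi)^-1 * rsqrt01 y.
Proof.
move=> /andP[y0 y1]; have p0 := @pi_gt0 R.
rewrite psiE ?subr_gt0// invfM sqrtrM ?invr_ge0 ?mulr_ge0 ?ltW//.
by rewrite /rsqrt01 -sqrtrV// mulr_ge0 ?subr_ge0// ltW.
Qed.

Lemma measurable_rsqrt01 : measurable_fun (`]0, 1[%classic : set R) (@rsqrt01 R).
Proof. by have /measurable_int/measurable_EFinP := @integrable_rsqrt01 R. Qed.

Lemma measurable_psi : measurable_fun (`]0, 1[%classic : set R) (@psi R).
Proof.
apply: (@eq_measurable_fun _ _ _ _ _ (fun y => Num.sqrt (4 * pi)^-1 * rsqrt01 y)).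
  by move=> y; rewrite inE/= in_itv/= => /psi_rsqrt01.
by apply: measurable_funM => //; exact: measurable_rsqrt01.
Qed.

Lemma C1_open : C1 f = \int[mu]_(y in `]0, 1[) (f y * psi y).
Proof.
rewrite /C1 /Rintegral integral_itv_bndoo//.
apply/measurable_EFinP; apply: measurable_funM; last exact: measurable_psi.
exact: measurable_funTS.
Qed.

Lemma integrable_mass_psi : mu.-integrable `]0, 1[ (EFin \o (fun y => f y * psi y)).
Proof.
have mff : measurable_fun (`]0, 1[%classic : set R) f by exact: measurable_funTS.
have M0 : 0 <= M by apply: le_trans (fM (_ : 0 \in _)); rewrite ?f0// in_itv/= lexx ler01.
have idom' : mu.-integrable `]0, 1[ (EFin \o (fun y => M * Num.sqrt (4 * pi)^-1 * rsqrt01 y)).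
  by apply: (@integrableZl _ _ R mu _ (measurable_itv _) (M * Num.sqrt (4 * pi)^-1) (EFin \o @rsqrt01 R));
    exact: integrable_rsqrt01.
apply: le_integrable idom' => //.
  by apply/measurable_EFinP; apply: measurable_funM => //; exact: measurable_psi.
move=> y /=; rewrite in_itv/= => y01; rewrite lee_fin psi_rsqrt01// -mulrA.
have h0 : 0 <= Num.sqrt (4 * pi)^-1 * rsqrt01 y by rewrite mulr_ge0 ?sqrtr_ge0 ?rsqrt01_ge0.
rewrite !normrM -normrM (ger0_norm h0) ler_wpM2r// !ger0_norm//.
by apply: fM; have /andP[? ?] := y01; rewrite in_itv/= !ltW.
Qed.

Lemma psi_ge y : 0 < y < 1 -> Num.sqrt pi^-1 <= psi y.
Proof.
move=> /andP[y0 y1]; have p0 := @pi_gt0 R; rewrite psiE ?subr_gt0//.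
have w0 : 0 < y * (1 - y) by rewrite mulr_gt0 ?subr_gt0.
have w4 : y * (1 - y) <= 4^-1 by have := sqr_ge0 (y - 2^-1); rewrite sqrrB; lra.
apply: ler_wsqrtr; rewrite lef_pV2 ?posrE ?mulr_gt0 ?subr_gt0//.
move: (pi : R) p0 => q q0; nra.
Qed.

(** Since y (1 - y) <= 1/4, [psi] is at least pi^(-1/2). This yields the positivity of [C1]. *)
Lemma C1_ge : Num.sqrt pi^-1 * mass `]0, 1[ <= C1 f.
Proof.
rewrite C1_open /mass -RintegralZl//; last exact: integrable_mass.
apply: le_Rintegral => //; last 2 first.
- exact: integrable_mass_psi.
- by move=> y /=; rewrite in_itv/= => y01; rewrite mulrC ler_wpM2l// psi_ge.
by apply: (@integrableZl _ _ R mu _ (measurable_itv _) (Num.sqrt pi^-1) (EFin \o f));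
  exact: integrable_mass.
Qed.

Lemma C3_gt0 : 0 < (C3 : R).
Proof.
have h : Num.sqrt (2 / 3) <= (1 : R) by rewrite -[leRHS]sqrtr1; apply: ler_wsqrtr; lra.
have h2 : 0 < (Num.sqrt 2)^-1 :> R by rewrite invr_gt0 sqrtr_gt0.
by rewrite /C3; lra.
Qed.

(** Dominated convergence with the pointwise limit [zsq_cvg] and the majorant [zsq_bound];
    boundedness of f makes the majorant integrable against it. *)
Lemma cell_variance_cvg :
  (\sum_(k < (2 * h)%N) mass (cell (2 * h) k) * zsq h k) / Num.sqrt h%:R @[h --> \oo]
  --> Num.sqrt 2 * (C3 * C1 f).
Proof.
have mff : measurable_fun (`]0, 1[%classic : set R) f by exact: measurable_funTS.
have M0 : 0 <= M by apply: le_trans (fM (_ : 0 \in _)); rewrite ?f0// in_itv/= lexx ler01.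
have idom : mu.-integrable `]0, 1[ (EFin \o (fun y => M * 20 * rsqrt01 y)).
  by apply: (@integrableZl _ _ R mu _ (measurable_itv _) (M * 20) (EFin \o @rsqrt01 R));
    exact: integrable_rsqrt01.
have sq0 h : 0 < Num.sqrt h.+1%:R :> R by rewrite sqrtr_gt0.
pose F h y := f y * (cell_sum h.+1 y / Num.sqrt h.+1%:R).
pose G y := f y * (Num.sqrt 2 * (C3 * psi y)).
have FG : ((\int[mu]_(y in `]0%R, 1%R[) (F h y)%:E)%E @[h --> \oo]
    --> (\int[mu]_(y in `]0%R, 1%R[) (G y)%:E)%E).
  apply: (@dominated_cvg _ _ R mu _ (measurable_itv _) (fun h y => (F h y)%:E)
    (EFin \o G) (fun y => (M * 20 * rsqrt01 y)%:E)) => //.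
  - move=> h; apply/measurable_EFinP; apply: measurable_funM => //.
    by apply: measurable_funM => //; apply: measurable_funTS; exact: measurable_cell_sum.
  - move=> y /=; rewrite in_itv/= => y01; have /andP[y0 y1] := y01.
    apply: cvg_EFin; first exact: nearW.
    apply: cvgM; first exact: cvg_cst.
    (* For a fixed y, [k] follows the cell containing y as h grows; h = 0 has no cells and receives
       an arbitrary value. *)
    have /choice[k hk] : forall h, exists k : nat, (0 < h)%N -> (k < 2 * h)%N /\ y \in cell (2 * h) k.
      move=> [|h]; first by exists 0%N.
      have [||k k1 k2] := @cell_exists (2 * h.+1) y; [by [] | by rewrite y0 ltW |].
      by exists k.
    have := @zsq_cvg R y k y01 _; rewrite -(cvg_shiftS (fun h => zsq h (k h) / _)) => H.
    apply: cvg_trans (H _); last first.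
      by move=> h h0; have [_] := hk h h0; rewrite mem_cell// muln_gt0.
    apply: near_eq_cvg; apply: nearW => h /=.
    have [k1 k2] := hk h.+1 erefl.
    by rewrite /cell_sum (@sum_cell _ (k h.+1)).
  - move=> h y /=; rewrite in_itv/= => y01; rewrite lee_fin /F normrM (ger0_norm (f0 y)).
    have /andP[c0 c1] := cell_sum_bound h y01; have /andP[y0 y1] := y01.
    rewrite -mulrA ler_pM ?f0//; first by apply: fM; rewrite in_itv/= !ltW.
    rewrite ger0_norm ?divr_ge0 ?sqrtr_ge0// ler_pdivrMr//.
    by rewrite mulrAC.
have ifpsi := integrable_mass_psi.
have GE y : G y = Num.sqrt 2 * C3 * (f y * psi y) by rewrite /G; ring.
have iG : mu.-integrable `]0, 1[ (EFin \o G).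
  have -> : EFin \o G = (fun y => (Num.sqrt 2 * C3)%:E * (f y * psi y)%:E)%E.
    by apply: funext => y; rewrite /= GE EFinM.
  exact: (@integrableZl _ _ R mu _ (measurable_itv _) _ (EFin \o (fun y => f y * psi y))).
have G1 : \int[mu]_(y in `]0, 1[) G y = Num.sqrt 2 * (C3 * C1 f).
  under eq_Rintegral do rewrite GE.
  by rewrite RintegralZl// -C1_open mulrA.
rewrite -(cvg_shiftS (fun h => _ / Num.sqrt h%:R)) -G1.
have fG : (\int[mu]_(y in `]0%R, 1%R[) (G y)%:E)%E \is a fin_num.
  by apply: integrable_fin_num; [exact: measurable_itv | exact: iG].
rewrite -(fineK fG) in FG.
have H : (\int[mu]_(y in `]0, 1[) F h y) @[h --> \oo] --> \int[mu]_(y in `]0, 1[) G y.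
  by apply: fine_cvg; exact: FG.
apply: (near_cvg H); apply: nearW => h /=.
rewrite -Rintegral_cell_sum -RintegralZr//.
  by apply: eq_Rintegral => y _; rewrite /F mulrA.
have idom' : mu.-integrable `]0, 1[ (EFin \o (fun y => M * (20 * Num.sqrt h.+1%:R) * rsqrt01 y)).
  by apply: (@integrableZl _ _ R mu _ (measurable_itv _) (M * (20 * Num.sqrt h.+1%:R)) (EFin \o @rsqrt01 R));
    exact: integrable_rsqrt01.
apply: le_integrable idom' => //.
  by apply/measurable_EFinP; apply: measurable_funM => //; apply: measurable_funTS;
    exact: measurable_cell_sum.
move=> y /=; rewrite in_itv/= => y01; rewrite lee_fin normrM (ger0_norm (f0 y)).
have /andP[c0 c1] := cell_sum_bound h y01; have /andP[y0 y1] := y01.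
have D0 : 0 <= M * (20 * Num.sqrt h.+1%:R) * rsqrt01 y by rewrite !mulr_ge0 ?sqrtr_ge0 ?rsqrt01_ge0.
rewrite (ger0_norm D0) -mulrA ler_pM//; first by apply: fM; rewrite in_itv/= !ltW.
by rewrite ger0_norm.
Qed.

End CellSums.

(** * The expectation of Z_m for the given density *)

Section Mean.
Context {R : realType}.
Local Notation mu := (@lebesgue_measure R).
Context (f : R -> R) (f_density : density01 f) (f_C4 : C4_01 f).
Implicit Types (x y : R) (h k : nat).

Lemma density_measurable : measurable_fun setT f.
Proof. by case: f_density. Qed.

Lemma density_ge0 y : 0 <= f y.
Proof. by case: f_density. Qed.

Lemma density_integrable : mu.-integrable setT (EFin \o f).
Proof.
apply/integrableP; split; first by apply/measurable_EFinP; exact: density_measurable.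
under eq_integral do rewrite /= ger0_norm ?density_ge0//.
by case: f_density => _ _ _ ->; exact: ltry.
Qed.

Lemma derivable01_dern k : (k < 4)%N -> derivable01_in (dern01 k f).
Proof. by move=> k4 x x01; case: f_C4 => + _; apply. Qed.

Lemma has_deriv01_dern k : (k < 4)%N -> has_deriv01 (dern01 k f) (dern01 k.+1 f).
Proof. by move=> k4; apply: has_deriv01_der; exact: derivable01_dern. Qed.

Lemma continuous_dern k : (k <= 4)%N -> {within `[0, 1], continuous (dern01 k f)}.
Proof.
rewrite leq_eqVlt => /predU1P[->|k4]; first by case: f_C4.
exact/derivable01_continuous/derivable01_dern.
Qed.

Lemma continuous_density : {within `[0, 1], continuous f}.
Proof. exact: (@continuous_dern 0). Qed.

Lemma density_bounded : exists2 M, 0 <= M & forall y, y \in `[0, 1] -> f y <= M.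
Proof.
have [M M0 hM] := continuous01_bounded continuous_density.
by exists M => // y y01; apply: le_trans (ler_norm _) (hM _ y01).
Qed.

Definition primitive01 x : R := \int[mu]_(t in `[0, x]) f t.

Lemma has_deriv01_primitive : has_deriv01 primitive01 f.
Proof.
have int01 : mu.-integrable `[0, 1] (EFin \o f) by apply: integrable_mass density_integrable _ _.
split; first by apply: parameterized_integral_continuous.
move=> x; rewrite in_itv/= => /andP[x0 x1].
have cx : {for x, continuous f}.
  have := continuous_density; move/(continuous_within_itvP _ ltr01) => [+ _ _]; apply.
  by rewrite in_itv/= x0.
have [d1 d2] := continuous_FTC1_closed x1 int01 x0 cx.
apply: DeriveDef; first exact: d1.
by rewrite -derive1E; exact: d2.
Qed.

Lemma mass_cell m k : (k < m)%N -> mass f (cell m k) = primitive01 (k.+1%:R / m%:R) - primitive01 (k%:R / m%:R).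
Proof.
move=> km; have m0 : (0 < m)%N by exact: leq_ltn_trans km.
rewrite /primitive01 /mass /cell; apply/esym/Rintegral_itvB.
- by apply: integrable_mass density_integrable _ _.
- by rewrite bnd_simp divr_ge0.
- by rewrite bnd_simp ler_pM2r ?invr_gt0 ?ltr0n// ler_nat.
Qed.

Lemma mass_open : mass f `]0, 1[ = 1.
Proof.
case: f_density => mf f0 fout f1.
rewrite /mass /Rintegral -(integral_itv_bndoo true false); last first.
  by apply/measurable_EFinP; exact: measurable_funTS.
rewrite integral_mkcond (_ : (_ \_ _) = EFin \o f) ?f1//.
apply: funext => y; rewrite patchE; case: ifPn => // y01.
rewrite /= fout//; apply: contra y01 => y01; exact: mem_set.
Qed.

Definition zmean h x : R := \sum_(k < (2 * h)%N) mass f (cell (2 * h) k) * zpoly h k x.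

Lemma big_ord_pair (G : nat -> R) h :
  \sum_(k < (2 * h)%N) G k = \sum_(j < h) (G j.*2 + G j.*2.+1).
Proof.
elim: h => [|h IH]; first by rewrite !big_ord0.
by rewrite mulnS addnC addn2 !big_ord_recr/= IH mul2n addrA.
Qed.

(** A cell of mesh 1 / h is the union of two consecutive cells of mesh 1 / (2 h), so the sum for the
    coarse kernel is regrouped from pairs of fine cells. *)
Lemma zmean_bern h x : (0 < h)%N -> zmean h x = 2 * bern_mean primitive01 (2 * h) x - bern_mean primitive01 h x.
Proof.
move=> h0; have h0' : h%:R != 0 :> R by rewrite pnatr_eq0 -lt0n.
have S1 : bern_mean primitive01 (2 * h) x
    = (2 * h)%:R * \sum_(k < (2 * h)%N) bernstein k (2 * h).-1 x * mass f (cell (2 * h) k).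
  rewrite /bern_mean /Ebin prednK ?muln_gt0//; congr (_ * _).
  by apply: eq_bigr => k _; rewrite mass_cell.
have S2 : bern_mean primitive01 h x
    = \sum_(k < (2 * h)%N) h%:R * bernstein k./2 h.-1 x * mass f (cell (2 * h) k).
  rewrite (big_ord_pair (fun k => h%:R * bernstein k./2 h.-1 x * mass f (cell (2 * h) k))).
  rewrite /bern_mean /Ebin prednK// mulr_sumr; apply: eq_bigr => j _.
  rewrite /= uphalf_double doubleK -mulrDr !mass_cell; last 2 first.
  - by rewrite mul2n ltn_Sdouble.
  - by rewrite mul2n ltn_double.
  rewrite mulrA; congr (_ * _).
  have e1 : (j.*2.+1).+1%:R / (2 * h)%:R = j.+1%:R / h%:R :> R.
    by rewrite -doubleS -mul2n !natrM; field.
  have e2 : j.*2%:R / (2 * h)%:R = j%:R / h%:R :> R by rewrite -mul2n !natrM; field.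
  by rewrite e1 e2; ring.
rewrite S1 S2 /zmean mulrA mulr_sumr -sumrB; apply: eq_bigr => k _.
by rewrite /zpoly natrM; ring.
Qed.

Lemma zmean_expansion (e : R) : 0 < e -> exists h0, forall h x, (h0 <= h)%N -> 0 <= x <= 1 ->
  `|zmean h x - f x + 2 * Delta2 f x / (2 * h)%:R ^+ 2| <= e / (2 * h)%:R ^+ 2.
Proof.
(* The two remainders add up to (2 / 4 + 1) (e / 6) / h^2 = e / (2 h)^2. *)
move=> e0; have e60 : 0 < e / 6 by rewrite divr_gt0.
have [m0 hm] := bern_mean_expansion has_deriv01_primitive (@has_deriv01_dern 0 erefl)
  (@has_deriv01_dern 1 erefl) (@has_deriv01_dern 2 erefl) (@has_deriv01_dern 3 erefl)
  (@continuous_dern 4 erefl) e60.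
exists m0.+1 => h x mh x01; have h0 : (0 < h)%N by exact: leq_trans mh.
have mh' : (m0 <= h)%N by exact: ltnW.
have m2h : (m0 <= 2 * h)%N by apply: leq_trans mh' _; rewrite mul2n -addnn leq_addr.
have := hm h x mh' x01; have := hm _ x m2h x01.
rewrite zmean_bern// (_ : Delta2 f x = bias2 (dern01 2 f) (dern01 3 f) (dern01 4 f) x)//.
have h0' : h%:R != 0 :> R by rewrite pnatr_eq0 -lt0n.
rewrite natrM exprMn; move: (bias1 _ _ _) (bias2 _ _ _ _) => b1 b2.
set A := bern_mean _ _ _; set B := bern_mean _ _ _; set t : R := h%:R => A1 B1.
have -> : 2 * A - B - f x + 2 * b2 / (2 ^+ 2 * t ^+ 2)
  = 2 * (A - (f x + b1 / (2 * t) + b2 / (2 ^+ 2 * t ^+ 2))) - (B - (f x + b1 / t + b2 / t ^+ 2)).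
  by field.
apply: le_trans (ler_normB _ _) _; rewrite normrM ger0_norm//.
apply: le_trans (lerD (ler_wpM2l _ A1) B1) _ => //.
by rewrite le_eqVlt; apply/orP; left; apply/eqP; field.
Qed.

End Mean.

(** * Bias-variance decomposition of the MISE *)

Section Quadratic.
Context {R : realType}.
Local Notation mu := (@lebesgue_measure R).
Implicit Types (u v : R -> R) (x : R).

Definition ip u v : R := \int[mu]_(x in `[0, 1]) (u x * v x).

Lemma within_continuousM u v (A : set R) : {within A, continuous u} -> {within A, continuous v} ->
  {within A, continuous (fun x => u x * v x)}.
Proof. by move=> cu cv x; apply: cvgM; [exact: cu | exact: cv]. Qed.

Lemma integrable_ip u v : {within `[0, 1], continuous u} -> {within `[0, 1], continuous v} ->
  mu.-integrable `[0, 1] (EFin \o (fun x => u x * v x)).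
Proof. by move=> cu cv; apply: continuous_integrable_itv; exact: within_continuousM. Qed.

Lemma integrable_scale d (T : measurableType d) (nu : {measure set T -> \bar R}) (D : set T)
  (g : T -> R) (c : R) : measurable D ->
  nu.-integrable D (EFin \o g) -> nu.-integrable D (EFin \o (fun w => c * g w)).
Proof. by move=> mD ig; exact: (@integrableZl _ _ R nu D mD c (EFin \o g)). Qed.

Lemma integrable_Radd d (T : measurableType d) (nu : {measure set T -> \bar R}) (D : set T)
  (g1 g2 : T -> R) : measurable D -> nu.-integrable D (EFin \o g1) ->
  nu.-integrable D (EFin \o g2) -> nu.-integrable D (EFin \o (fun w => g1 w + g2 w)).
Proof. by move=> mD i1 i2; have := integrableD mD i1 i2. Qed.

Lemma ip_quadratic (I : Type) (S : seq I) (a : I -> R) (u : I -> R -> R) (f : R -> R) :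
  (forall s, {within `[0, 1], continuous (u s)}) -> {within `[0, 1], continuous f} ->
  \int[mu]_(x in `[0, 1]) (\sum_(s <- S) a s * u s x - f x) ^+ 2
  = \sum_(s <- S) \sum_(t <- S) ip (u s) (u t) * (a s * a t)
    + \sum_(s <- S) (- 2 * ip (u s) f) * a s + ip f f.
Proof.
move=> cu cf.
have E x : (\sum_(s <- S) a s * u s x - f x) ^+ 2
  = \sum_(s <- S) \sum_(t <- S) (a s * a t) * (u s x * u t x)
    + \sum_(s <- S) (- 2 * a s) * (u s x * f x) + f x * f x.
  rewrite sqrrB expr2 big_distrlr /= -expr2 -mulr_natl; congr (_ + _ + _).
    by apply: eq_bigr => s _; apply: eq_bigr => t _; ring.
  by rewrite mulr_suml mulr_sumr -sumrN; apply: eq_bigr => s _; ring.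
under eq_Rintegral do rewrite E.
have i2 s : mu.-integrable `[0, 1] (EFin \o (fun x => \sum_(t <- S) (a s * a t) * (u s x * u t x))).
  by apply: integrable_Rsum => // t; apply: integrable_scale => //; exact: integrable_ip.
have i1 s : mu.-integrable `[0, 1] (EFin \o (fun x => (- 2 * a s) * (u s x * f x))).
  by apply: integrable_scale => //; exact: integrable_ip.
rewrite RintegralD//; last 2 first.
- by apply: integrable_Radd => //; exact: integrable_Rsum.
- exact: integrable_ip.
congr (_ + _); rewrite RintegralD//; try exact: integrable_Rsum.
congr (_ + _).
  rewrite Rintegral_sum//; apply: eq_bigr => s _; rewrite Rintegral_sum//.
    by apply: eq_bigr => t _; rewrite RintegralZl 1?mulrC//; exact: integrable_ip.
  by move=> t; apply: integrable_scale => //; exact: integrable_ip.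
rewrite Rintegral_sum//; apply: eq_bigr => s _; rewrite RintegralZl//; last exact: integrable_ip.
by rewrite /ip; ring.
Qed.

Context d (T : measurableType d) (P : probability T R).

Lemma integrable_indicZ (A : set T) (c : R) : measurable A ->
  P.-integrable setT (EFin \o (fun w => c * \1_A w)).
Proof. by move=> mA; apply: integrable_scale => //; exact: integrable_indic. Qed.

Lemma Rintegral_indicZ (A : set T) (c : R) : measurable A ->
  \int[P]_w (c * \1_A w) = c * fine (P A).
Proof.
move=> mA; rewrite RintegralZl//; last exact: integrable_indic.
by rewrite /Rintegral integral_indic// setIT.
Qed.

(** For random coefficients that are indicators, the integrated square is a quadratic polynomial in
    them by [ip_quadratic]. Its expectation involves only probabilities of events and of their
    pairwise intersections, and the covariances account for the difference from the square at the
    mean. *)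
Lemma expectation_quadratic (I : Type) (S : seq I) (A : I -> set T) (u : I -> R -> R) (f : R -> R)
    (p : I -> R := fun s => fine (P (A s))) :
  (forall s, measurable (A s)) ->
  (forall s, {within `[0, 1], continuous (u s)}) -> {within `[0, 1], continuous f} ->
  ('E_P[(fun w => \int[mu]_(x in `[0, 1]) (\sum_(s <- S) \1_(A s) w * u s x - f x) ^+ 2)%R])%E =
   (\int[mu]_(x in `[0, 1]) (\sum_(s <- S) p s * u s x - f x) ^+ 2
   + \sum_(s <- S) \sum_(t <- S) ip (u s) (u t) * (fine (P (A s `&` A t)) - p s * p t))%:E.
Proof.
move=> mA cu cf.
pose Y2 w : R := \sum_(s <- S) \sum_(t <- S) ip (u s) (u t) * \1_(A s `&` A t) w.
pose Y1 w : R := \sum_(s <- S) (- 2 * ip (u s) f) * \1_(A s) w.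
have EY : (fun w => \int[mu]_(x in `[0, 1]) (\sum_(s <- S) \1_(A s) w * u s x - f x) ^+ 2)
    = (fun w => Y2 w + Y1 w + ip f f).
  apply: funext => w; rewrite (ip_quadratic S (fun s => \1_(A s) w) cu cf); congr (_ + _ + _).
  by apply: eq_bigr => s _; apply: eq_bigr => t _; rewrite indicI.
have i2 s : P.-integrable setT (EFin \o (fun w => \sum_(t <- S) ip (u s) (u t) * \1_(A s `&` A t) w)).
  by apply: integrable_Rsum => // t; apply: integrable_indicZ; exact: measurableI.
have i1 s : P.-integrable setT (EFin \o (fun w => (- 2 * ip (u s) f) * \1_(A s) w)).
  exact: integrable_indicZ.
have j2 : P.-integrable setT (EFin \o Y2) by exact: integrable_Rsum.
have j1 : P.-integrable setT (EFin \o Y1) by exact: integrable_Rsum.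
have j0 : P.-integrable setT (EFin \o (fun _ : T => ip f f)).
  by apply: finite_measure_integrable_cst.
have j21 : P.-integrable setT (EFin \o (fun w => Y2 w + Y1 w)).
  by have := integrableD measurableT j2 j1.
have j : P.-integrable setT (EFin \o (fun w => Y2 w + Y1 w + ip f f)).
  by have := integrableD measurableT j21 j0.
rewrite EY unlock -[LHS]fineK; last exact: (integrable_fin_num measurableT j).
congr (_%:E); rewrite -[LHS]/(\int[P]_w (Y2 w + Y1 w + ip f f)).
have K : \int[P]_w (ip f f) = ip f f.
  by rewrite Rintegral_cst//; rewrite (_ : fine _ = 1) ?mulr1//; rewrite -[in RHS](_ : fine 1%E = 1)// -(probability_setT P).
rewrite RintegralD// RintegralD// K.
rewrite (ip_quadratic S p cu cf) /Y2 /Y1 Rintegral_sum// Rintegral_sum//.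
under eq_bigr => s _.
  rewrite Rintegral_sum//; last first.
    by move=> t; apply: integrable_indicZ; exact: measurableI.
  over.
rewrite [RHS]addrAC; congr (_ + _); rewrite [RHS]addrAC; congr (_ + _).
  rewrite -big_split/=; apply: eq_bigr => s _; rewrite -big_split/=; apply: eq_bigr => t _.
  by rewrite Rintegral_indicZ; [ring | exact: measurableI].
by apply: eq_bigr => s _; rewrite Rintegral_indicZ.
Qed.

End Quadratic.

(** * Unfolding the recursive estimator *)

Section Weights.
Context {R : realType}.
Implicit Types (g Z : nat -> R).

(** Coefficient of Z_(i+1) in f_n, namely g_(i+1) times the product of 1 - g_j over i + 1 < j <=
    n. *)
Fixpoint weight g (n i : nat) : R :=
  if n is n'.+1 then if i == n' then g n else (1 - g n) * weight g n' i else 0.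

(** J = 1 gives the recursion of the bias, J = 2 that of the variance. *)
Lemma weightS_sum g Z (J n : nat) :
  \sum_(i < n.+1) weight g n.+1 i ^+ J * Z i
  = (1 - g n.+1) ^+ J * (\sum_(i < n) weight g n i ^+ J * Z i) + g n.+1 ^+ J * Z n.
Proof.
rewrite big_ord_recr /= eqxx; congr (_ + _); rewrite mulr_sumr; apply: eq_bigr => i _.
by rewrite ltn_eqF// exprMn mulrA.
Qed.

End Weights.

Section MeanSquare.
Context {R : realType}.
Local Notation mu := (@lebesgue_measure R).
Implicit Types (x y : R) (h k : nat).

Lemma indic_cell_half h j y : (0 < h)%N ->
  \1_(cell h j) y = \1_(cell (2 * h) j.*2) y + \1_(cell (2 * h) j.*2.+1) y :> R.
Proof.
move=> h0; have h2 : (0 < 2 * h)%N by rewrite muln_gt0.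
have hR : (0 : R) < h%:R by rewrite ltr0n.
rewrite !indicE !mem_cell//.
have e0 : j.*2%:R = 2 * j%:R :> R by rewrite -mul2n natrM.
have e1 : j.*2.+1%:R = 2 * j%:R + 1 :> R by rewrite -natr1 e0.
have e2 : j.*2.+2%:R = 2 * (j%:R + 1) :> R by rewrite -doubleS -mul2n natrM -[j.+1%:R]natr1.
rewrite e2 e1 e0 natrM -[j.+1%:R]natr1 -!mulrA ltr_pM2l// ler_pM2l//.
move: (j%:R : R) (h%:R * y) => a b.
have [ab|ab] := ltP a b; have [ab1|ab1] := leP b (a + 1);
  have [c1|c1] := leP (2 * b) (2 * a + 1); rewrite ?addr0 ?add0r//; exfalso; lra.
Qed.

Lemma Zker_cells h y x : (0 < h)%N ->
  Zker (2 * h) y x = \sum_(k < (2 * h)%N) \1_(cell (2 * h) k) y * zpoly h k x.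
Proof.
move=> h0; rewrite /Zker mul2n doubleK -mul2n /Tker.
have -> : h%:R * (\sum_(j < h) \1_(cell h j) y * bernstein j h.-1 x)
   = \sum_(k < (2 * h)%N) \1_(cell (2 * h) k) y * (h%:R * bernstein k./2 h.-1 x).
  rewrite (big_ord_pair (fun k => \1_(cell (2 * h) k) y * (h%:R * bernstein k./2 h.-1 x))).
  rewrite mulr_sumr; apply: eq_bigr => j _.
  by rewrite /= uphalf_double doubleK indic_cell_half//; ring.
rewrite mulrA mulr_sumr -sumrB; apply: eq_bigr => k _.
rewrite /zpoly -/(cell (2 * h) k) (_ : 2 * (2 * h)%:R = 4 * h%:R :> R); first ring.
by rewrite natrM; ring.
Qed.

Context (d : measure_display) (T : measurableType d) (P : probability T R)
  (X : nat -> {RV P >-> R}) (f : R -> R) (f_density : density01 f)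
  (X_iid : iid_with_density (fun n => X n.+1) f) (f_C4 : C4_01 f).

Lemma prob_mass i (A : set R) : measurable A -> P (X i.+1 @^-1` A) = (mass f A)%:E.
Proof.
move=> mA; have [_ /(_ i A mA) E] := X_iid.
rewrite (_ : P _ = distribution P (X i.+1) A)// E /mass /Rintegral fineK//.
by apply: integrable_fin_num => //; apply: integrable_mass => //; exact: density_integrable.
Qed.

Lemma prob_pair i j (A B : set R) : i != j -> measurable A -> measurable B ->
  P (X i.+1 @^-1` A `&` X j.+1 @^-1` B) = (mass f A * mass f B)%:E.
Proof.
move=> ij mA mB; have [H _] := X_iid.
have := H [:: i; j] (fun m => if m == i then A else B) _ _.
rewrite /= mem_seq1 ij /= => /(_ erefl) H'.
have {}H' := H' (fun m => ltac:(by case: ifP)).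
rewrite 2!big_cons big_nil mule1 eqxx eq_sym (negPf ij) !prob_mass// -EFinM in H'.
rewrite -H'; congr (P _); apply/seteqP; split=> [w [wA wB] m|w H2].
  rewrite /= !inE => /orP[|] /eqP ->; first by rewrite eqxx.
  by rewrite eq_sym (negPf ij).
split; first by have := H2 i; rewrite /= !inE eqxx; apply.
by have := H2 j; rewrite /= !inE eqxx orbT eq_sym (negPf ij); apply.
Qed.

(** Variance of Z of order 2 h integrated over x, as second moment minus squared mean. *)
Definition zvar h : R :=
  \sum_(k < (2 * h)%N) mass f (cell (2 * h) k) * zsq h k - \int[mu]_(x in `[0, 1]) zmean f h x ^+ 2.

Lemma within_zpoly h k : {within `[0, 1], continuous (zpoly h k : R -> R)}.
Proof. by apply: continuous_subspaceT; exact: continuous_zpoly. Qed.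

(** This is [ip_quadratic] with target function 0. *)
Lemma zmean_sqr h : \int[mu]_(x in `[0, 1]) zmean f h x ^+ 2 =
  \sum_(k < (2 * h)%N) \sum_(l < (2 * h)%N)
     ip (zpoly h k) (zpoly h l) * (mass f (cell (2 * h) k) * mass f (cell (2 * h) l)).
Proof.
have := ip_quadratic (index_enum 'I_(2 * h)) (fun k : 'I_(2 * h) => mass f (cell (2 * h) k))
  (fun k : 'I_(2 * h) => @within_zpoly h k) (f := fun=> 0).
move=> /(_ (continuous_subspaceT (fun y => cvg_cst (0 : R)))) E.
have ip0 u : ip u (fun=> 0) = 0 :> R.
  by rewrite /ip; under eq_Rintegral do rewrite mulr0; rewrite Rintegral_cst// mul0r.
rewrite ip0 addr0 [X in _ + X]big1 ?addr0 in E; last by move=> k _; rewrite ip0 mulr0 mul0r.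
by rewrite -E; apply: eq_Rintegral => x _; rewrite subr0.
Qed.

Context (g : nat -> R) (N : nat -> nat) (h : nat -> nat)
  (hN : forall i, (0 < h i)%N /\ N i.+1 = (2 * h i)%N).

Lemma estimator_weights n x w :
  estimator X g N n x w = \sum_(i < n) weight g n i *
    \sum_(k < (2 * h i)%N) \1_(cell (2 * h i) k) (X i.+1 w) * zpoly (h i) k x.
Proof.
elim: n => [|n IH]; first by rewrite big_ord0.
have [h0 hE] := hN n.
have := weightS_sum g (fun i => \sum_(k < (2 * h i)%N) \1_(cell (2 * h i) k) (X i.+1 w) * zpoly (h i) k x) 1 n.
rewrite expr1; under eq_bigr do rewrite expr1; move=> ->.
rewrite /= IH hE Zker_cells//. 
Qed.

Definition mise_bias n x : R := \sum_(i < n) weight g n i * zmean f (h i) x - f x.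

Definition mise_var n : R := \sum_(i < n) weight g n i ^+ 2 * zvar (h i).

Lemma MISE_bias_var n :
  MISE X f g N n = (\int[mu]_(x in `[0, 1]) mise_bias n x ^+ 2 + mise_var n)%:E.
Proof.
(* The estimator is a linear combination of indicators indexed by an observation i and a cell k of
   the mesh used for it. *)
pose S := [seq (i, k) | i <- index_iota 0 n, k <- index_iota 0 (2 * h i)].
pose A (s : nat * nat) := X s.1.+1 @^-1` cell (2 * h s.1) s.2.
pose u (s : nat * nat) x := weight g n s.1 * zpoly (h s.1) s.2 x.
have mA s : measurable (A s).
  by rewrite -[A s]setTI; apply: measurable_funP => //; exact: measurable_cell.
have cu s : {within `[0, 1], continuous (u s)}.
  by apply: continuous_subspaceT; apply: continuous_scalef; exact: continuous_zpoly.
have sumS (G : nat -> nat -> R) :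
    \sum_(s <- S) G s.1 s.2 = \sum_(i < n) \sum_(k < (2 * h i)%N) G i k.
  rewrite big_allpairs_dep big_mkord; apply: eq_bigr => i _; by rewrite big_mkord.
have EE : ISE X f g N n = (fun w => \int[mu]_(x in `[0, 1]) (\sum_(s <- S) \1_(A s) w * u s x - f x) ^+ 2).
  apply: funext => w; apply: eq_Rintegral => x _; congr ((_ - _) ^+ 2).
  rewrite estimator_weights.
  rewrite (sumS (fun i k => \1_(X i.+1 @^-1` cell (2 * h i) k) w * (weight g n i * zpoly (h i) k x))).
  apply: eq_bigr => i _; rewrite mulr_sumr; apply: eq_bigr => k _.
  by rewrite mulrCA.
rewrite /MISE EE (expectation_quadratic P S mA cu (continuous_density f_C4))//.
have pA s : fine (P (A s)) = mass f (cell (2 * h s.1) s.2).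
  by rewrite prob_mass//; exact: measurable_cell.
congr (_ + _)%:E.
  apply: eq_Rintegral => x _; congr ((_ - _) ^+ 2).
  under eq_bigr do rewrite pA.
  rewrite (sumS (fun i k => mass f (cell (2 * h i) k) * (weight g n i * zpoly (h i) k x))).
  apply: eq_bigr => i _; rewrite mulr_sumr; apply: eq_bigr => k _.
  by rewrite mulrCA.
pose C s t := ip (u s) (u t) * (fine (P (A s `&` A t)) - fine (P (A s)) * fine (P (A t))).
have sumSS (G : nat * nat -> R) :
    \sum_(s <- S) G s = \sum_(i < n) \sum_(k < (2 * h i)%N) G (val i, val k).
  by rewrite -(sumS (fun i k => G (i, k))); apply: eq_bigr => -[].
rewrite -/(\sum_(s <- S) \sum_(t <- S) C s t) sumSS; apply: eq_bigr => i _.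
(* Independence cancels the covariances between different observations. *)
have Cij (k : nat) (j : 'I_n) (l : nat) : j != i -> C (val i, k) (val j, l) = 0.
  move=> ji; rewrite /C !pA /= prob_pair ?subrr ?mulr0//; try exact: measurable_cell.
  by rewrite eq_sym.
(* For a single observation the cells are disjoint, so joint probabilities vanish off the
   diagonal. *)
have Cii (k l : nat) : C (val i, k) (val i, l) = weight g n i ^+ 2 *
    (ip (zpoly (h i) k) (zpoly (h i) l) * ((k == l)%:R * mass f (cell (2 * h i) k))
     - ip (zpoly (h i) k) (zpoly (h i) l) * (mass f (cell (2 * h i) k) * mass f (cell (2 * h i) l))).
  rewrite /C !pA /= -mulrBr mulrA; congr (_ * (_ - _)).
    rewrite /ip /u /=.
    under eq_Rintegral do rewrite mulrACA -expr2.
    rewrite RintegralZl//; apply: integrable_continuous; apply: continuous_mulf;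
      exact: continuous_zpoly.
  rewrite -preimage_setI; have [<-|kl] := eqVneq k l.
    by rewrite setIid mul1r prob_mass//; exact: measurable_cell.
  rewrite mul0r (_ : cell (2 * h i) k `&` cell (2 * h i) l = set0).
    by rewrite preimage_set0 measure0.
  apply/seteqP; split => // y [yk yl].
  have m0 : (0 < 2 * h i)%N by have [h0 _] := hN i; rewrite muln_gt0.
  by move/eqP: kl; apply; apply: (@cell_uniq R _ _ _ y m0); rewrite inE.
rewrite /zvar mulrBr zmean_sqr !mulr_sumr -sumrB; apply: eq_bigr => k _.
rewrite sumSS (bigD1 i)//= [X in _ + X]big1 ?addr0; last first.
  by move=> j ji; rewrite big1// => l _; exact: Cij.
under eq_bigr do rewrite Cii mulrBr.
rewrite sumrB -!mulr_sumr; congr (_ - _).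
rewrite (bigD1 k)//= eqxx mul1r big1 ?addr0; last first.
  by move=> l lk; rewrite (_ : (_ == _) = false) ?mul0r ?mulr0//; apply/negbTE; rewrite eq_sym.
by rewrite /zsq [ip _ _ * _]mulrC /ip; do 2 congr (_ * _); apply: eq_Rintegral => y _; rewrite expr2.
Qed.

End MeanSquare.

Section UnitInterval.
Context {R : realType}.
Local Notation mu := (@lebesgue_measure R).
Implicit Types (u v : R -> R) (x : R).

Lemma Rintegral_dist01 u v (c : R) :
  {within `[0, 1], continuous u} -> {within `[0, 1], continuous v} ->
  (forall x, 0 <= x <= 1 -> `|u x - v x| <= c) ->
  `|\int[mu]_(x in `[0, 1]) u x - \int[mu]_(x in `[0, 1]) v x| <= c.
Proof.
move=> cu cv H.
have iu := continuous_integrable_itv cu; have iv := continuous_integrable_itv cv.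
have ib : mu.-integrable `[0, 1] (EFin \o (fun x => u x - v x)).
  by apply: continuous_integrable_itv => x; apply: cvgB; [exact: cu | exact: cv].
rewrite -RintegralB//; apply: le_trans (le_normr_Rintegral _ ib) _ => //.
have ic : mu.-integrable `[0, 1] (EFin \o (fun _ : R => c)).
  by apply: continuous_integrable_itv; apply: continuous_subspaceT => y; exact: cvg_cst.
apply: le_trans (_ : \int[mu]_(x in `[0, 1]) c <= _).
  apply: le_Rintegral => //; first by have := integrable_norm ib.
by rewrite Rintegral_cst//= lebesgue_measure_itv/= lte_fin ltr01 oppr0 adde0 mulr1.
Qed.

Lemma within_sqr u : {within `[0, 1], continuous u} ->
  {within `[0, 1], continuous (fun x => u x ^+ 2)}.
Proof. by move=> cu; exact: (within_continuousM cu cu). Qed.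

Lemma within_scale u (c : R) : {within `[0, 1], continuous u} ->
  {within `[0, 1], continuous (fun x => c * u x)}.
Proof. by move=> cu x; apply: cvgM; [exact: cvg_cst | exact: cu]. Qed.

(** The supremum over A serves as modulus; the first hypothesis makes it an actual upper bound for
    every positive n. *)
Lemma uniform_modulus (r : nat -> R -> R) (A : set R) :
  (forall n, (0 < n)%N -> exists M : R, forall x, A x -> `|r n x| <= M) ->
  (forall e : R, 0 < e -> exists n0, forall n x, (n0 <= n)%N -> A x -> `|r n x| <= e) ->
  exists2 eps : nat -> R, eps @ \oo --> 0 &
    forall n x, (0 < n)%N -> A x -> `|r n x| <= eps n.
Proof.
move=> rb r0.
have ub n x : (0 < n)%N -> A x -> `|r n x| <= sup [set `|r n z| | z in A].
  move=> n0 Ax; apply: ub_le_sup; last by exists x.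
  by have [M hM] := rb n n0; exists M => _ [z Az <-]; exact: hM.
exists (fun n => sup [set `|r n z| | z in A]); last by move=> n x; exact: ub.
have [A0|/set0P/negP/negPn/eqP A0] := pselect (A !=set0); last first.
  apply: (near_cvg (cvg_cst (0 : R))); apply: nearW => n.
  by rewrite A0 image_set0 sup0.
apply/cvgrPdist_le => e e0; have [n0 hn0] := r0 e e0.
near=> n.
have n1 : (0 < n)%N by near: n; exact: near_gt0n.
have n2 : (n0 <= n)%N by near: n; exists n0.
rewrite sub0r normrN ger0_norm.
  apply: ge_sup; first by have [x Ax] := A0; exists `|r n x|, x.
  by move=> _ [z Az <-]; exact: hn0.
by have [x Ax] := A0; apply: le_trans (ub n x n1 Ax).
Unshelve. all: by end_near. Qed.

End UnitInterval.

Section Cells.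
Context {R : realType}.
Local Notation mu := (@lebesgue_measure R).
Context (f : R -> R) (f_density : density01 f) (f_C4 : C4_01 f).
Implicit Types (x y : R) (h k : nat).

Lemma within_Delta2 : {within `[0, 1], continuous (Delta2 f)}.
Proof.
have cX : continuous (fun x : R => x) by move=> x; exact: cvg_id.
have c1X : continuous (fun x : R => 1 - x) by move=> x; apply: cvgB; [exact: cvg_cst | exact: cvg_id].
have cc (c : R) : continuous (fun _ : R => c) by move=> x; exact: cvg_cst.
have c2 := continuous_dern f_C4 (isT : (2 <= 4)%N).
have c3 := continuous_dern f_C4 (isT : (3 <= 4)%N).
have c4 := continuous_dern f_C4 (isT : (4 <= 4)%N).
have p2 : continuous (fun x : R => 6^-1 * (1 - 6 * x * (1 - x))).
  apply: continuous_scalef; apply: continuous_subf; first exact: cc.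
  by apply: continuous_mulf => //; exact: continuous_scalef.
have p3 : continuous (fun x : R => 5 / 12 * x * (1 - x) * (1 - 2 * x)).
  apply: continuous_mulf; last by apply: continuous_subf; [exact: cc | exact: continuous_scalef].
  by apply: continuous_mulf => //; exact: continuous_scalef.
have p4 : continuous (fun x : R => 8^-1 * x ^+ 2 * (1 - x) ^+ 2).
  by apply: continuous_mulf; [apply: continuous_scalef |]; exact: continuous_sqrf.
move=> x; apply: cvgD; first apply: cvgD.
- exact: (within_continuousM (continuous_subspaceT p2) c2).
- exact: (within_continuousM (continuous_subspaceT p3) c3).
- exact: (within_continuousM (continuous_subspaceT p4) c4).
Qed.

Lemma continuous_sumf (I : Type) (s : seq I) (F : I -> R -> R) :
  (forall i, continuous (F i)) -> continuous (fun x => \sum_(i <- s) F i x).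
Proof.
move=> cF; elim: s => [|i s IH] x.
  by under eq_fun do rewrite big_nil; exact: cvg_cst.
by under eq_fun do rewrite big_cons; apply: cvgD; [exact: cF | exact: IH].
Qed.

Lemma continuous_zmean h : continuous (zmean f h).
Proof.
apply: continuous_sumf => k; apply: continuous_scalef; exact: continuous_zpoly.
Qed.

Lemma primitive01_0 : primitive01 f 0 = 0.
Proof. by rewrite /primitive01 set_itv1 Rintegral_set1. Qed.

Lemma primitive01_1 : primitive01 f 1 = 1.
Proof.
rewrite -[RHS](mass_open f_density) /primitive01 /mass /Rintegral integral_itv_bndoo//.
by apply/measurable_EFinP; apply: measurable_funTS; exact: density_measurable.
Qed.

Lemma sum_mass_cell m : (0 < m)%N -> \sum_(k < m) mass f (cell m k) = 1.
Proof.
move=> m0; under eq_bigr => k _ do rewrite mass_cell//.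
rewrite -(big_mkord xpredT (fun k => primitive01 f (k.+1%:R / m%:R) - primitive01 f (k%:R / m%:R))).
rewrite (telescope_sumr (fun k => primitive01 f (k%:R / m%:R)))//.
by rewrite mul0r primitive01_0 divff ?pnatr_eq0 -?lt0n// primitive01_1 subr0.
Qed.

(** Because the masses sum to 1, this is the mass-weighted mean of the integrals of ([zpoly] -
    [zmean])^2. *)
Lemma zvar_ge0 h : (0 < h)%N -> 0 <= zvar f h.
Proof.
move=> h0; have iz k : mu.-integrable `[0, 1] (EFin \o (fun x => zpoly h k x ^+ 2)).
  by apply: integrable_continuous; apply: continuous_sqrf; exact: continuous_zpoly.
pose q k x : R := (zpoly h k x - zmean f h x) ^+ 2.
have cq k : continuous (q k).
  apply: continuous_sqrf; apply: continuous_subf; [exact: continuous_zpoly | exact: continuous_zmean].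
suff -> : zvar f h = \sum_(k < (2 * h)%N) mass f (cell (2 * h) k) * \int[mu]_(x in `[0, 1]) q k x.
  apply: sumr_ge0 => k _; rewrite mulr_ge0// ?Rintegral_ge0//.
    by move=> y _; exact: density_ge0.
  by move=> x _; exact: sqr_ge0.
have iq k : mu.-integrable `[0, 1] (EFin \o (fun x => mass f (cell (2 * h) k) * q k x)).
  by apply: integrable_scale => //; exact: integrable_continuous.
transitivity (\int[mu]_(x in `[0, 1])
    (\sum_(k < (2 * h)%N) mass f (cell (2 * h) k) * zpoly h k x ^+ 2 - zmean f h x ^+ 2)).
  rewrite RintegralB//; last 2 first.
  - apply: integrable_continuous; apply: continuous_sumf => k; apply: continuous_scalef.
    by apply: continuous_sqrf; exact: continuous_zpoly.
  - by apply: integrable_continuous; apply: continuous_sqrf; exact: continuous_zmean.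
  rewrite /zvar Rintegral_sum//; last by move=> k; exact: integrable_scale.
  by congr (_ - _); apply: eq_bigr => k _; rewrite RintegralZl.
rewrite (eq_bigr (fun k : 'I_(2 * h) => \int[mu]_(x in `[0, 1]) (mass f (cell (2 * h) k) * q k x))); last first.
  by move=> k _; rewrite RintegralZl//; exact: integrable_continuous.
rewrite -Rintegral_sum//; apply: eq_Rintegral => x _.
transitivity (\sum_(k < (2 * h)%N) (mass f (cell (2 * h) k) * zpoly h k x ^+ 2
    + (- 2 * zmean f h x) * (mass f (cell (2 * h) k) * zpoly h k x)
    + zmean f h x ^+ 2 * mass f (cell (2 * h) k))); last by apply: eq_bigr => k _; rewrite /q; ring.
rewrite !big_split/= -!mulr_sumr -/(zmean f h x) sum_mass_cell ?muln_gt0//.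
by ring.
Qed.

(** Makes the squared mean negligible against the second moment, which is of order sqrt h. *)
Lemma zmean_sqr_bounded : exists M : R, \forall h \near \oo,
  `|\int[mu]_(x in `[0, 1]) zmean f h x ^+ 2| <= M.
Proof.
have [h0 hh] := zmean_expansion f_density f_C4 (@ltr01 R).
have [Mf Mf0 hMf] := continuous01_bounded (continuous_density f_C4).
have [MD MD0 hMD] := continuous01_bounded within_Delta2.
pose K := Mf + 2 * MD + 1; exists (K ^+ 2); near=> h.
have hh0 : (h0 <= h)%N by near: h; exists h0.
have h1 : (0 < h)%N by near: h; exact: near_gt0n.
have c0 : {within `[0, 1], continuous (fun _ : R => 0 : R)}.
  by apply: continuous_subspaceT => y; exact: cvg_cst.
have cz : {within `[0, 1], continuous (fun x => zmean f h x ^+ 2)}.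
  by apply: continuous_subspaceT; apply: continuous_sqrf; exact: continuous_zmean.
have := @Rintegral_dist01 _ _ _ (K ^+ 2) cz c0.
rewrite [X in _ - X]Rintegral_cst// mul0r subr0; apply => x x01.
rewrite subr0 normrX ler_sqr ?nnegrE// ?addr_ge0 ?mulr_ge0//.
have := hh h x hh0 x01; have := hMf x x01; have := hMD x x01.
set t : R := (2 * h)%:R ^+ 2; move=> D1 F1 Z1.
have t1 : 1 <= t by rewrite exprn_ege1// -[1]/(1%:R) ler_nat muln_gt0.
have t0 : 0 < t by exact: lt_le_trans t1.
have tV : t^-1 <= 1 by rewrite invf_le1.
have -> : zmean f h x = (zmean f h x - f x + 2 * Delta2 f x / t) + (f x - 2 * Delta2 f x / t) by ring.
apply: le_trans (ler_normD _ _) _; rewrite /K [leRHS]addrC; apply: lerD.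
  by apply: le_trans Z1 _; rewrite mul1r.
apply: le_trans (ler_normB _ _) _; apply: lerD => //.
have tV0 : 0 <= t^-1 by rewrite invr_ge0 ltW.
rewrite !normrM (ger0_norm tV0) (ger0_norm (ler0n R 2)) -mulrA ler_pM2l// -[leRHS]mulr1.
by apply: ler_pM.
Unshelve. all: by end_near. Qed.

Lemma zvar_cvg : zvar f h / Num.sqrt (2 * h)%:R @[h --> \oo] --> C3 * C1 f.
Proof.
have [M M0 hM] := density_bounded f_C4.
have c1 := cell_variance_cvg (density_measurable f_density) (density_ge0 f_density)
  (density_integrable f_density) hM.
have s2 : Num.sqrt 2 != 0 :> R by rewrite gt_eqF// sqrtr_gt0.
have [K hK] := zmean_sqr_bounded.
have i0 : (Num.sqrt h%:R)^-1 @[h --> \oo] --> (0 : R).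
  have := sqrt_cvg (@invn_cvg0 R); rewrite sqrtr0 => i0.
  by apply: (near_cvg i0); apply: nearW => h; rewrite sqrtrV.
have c2 : (\int[mu]_(x in `[0, 1]) zmean f h x ^+ 2) / Num.sqrt h%:R @[h --> \oo] --> (0 : R).
  have b1 : (K * (Num.sqrt h%:R)^-1) @[h --> \oo] --> (0 : R).
    by rewrite -[X in _ --> X](mulr0 K); apply: cvgM => //; exact: cvg_cst.
  have b2 : (- (K * (Num.sqrt h%:R)^-1)) @[h --> \oo] --> (0 : R).
    by rewrite -[X in _ --> X]oppr0; exact: cvgN.
  apply: (squeeze_cvgr _ b2 b1); near=> h.
  rewrite -ler_norml normrM [X in _ * X]ger0_norm ?invr_ge0 ?sqrtr_ge0//.
  by rewrite ler_wpM2r ?invr_ge0 ?sqrtr_ge0//; near: h.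
(* Passing from sqrt h to sqrt (2 h) removes the factor sqrt 2 of [cell_variance_cvg]. *)
have -> : C3 * C1 f = (Num.sqrt 2 * (C3 * C1 f) - 0) / Num.sqrt 2 by rewrite subr0 mulrAC divff ?mul1r.
apply: (near_cvg (cvgM (cvgB c1 c2) (cvg_cst (Num.sqrt 2)^-1))); near=> h.
rewrite !fctE /= /zvar natrM sqrtrM// invfM [X in _ = _ * X]mulrC -!mulrBl mulrA//.
Unshelve. all: by end_near. Qed.

End Cells.

(** * Limits of the integrated variance and of the squared bias *)

Section Asymptotics.
Context {R : realType}.
Local Notation mu := (@lebesgue_measure R).
Context (f : R -> R) (f_density : density01 f) (f_C4 : C4_01 f).
Context (al a xi k : R) (g m : nat -> R) (h : nat -> nat).
Context (al0 : 0 < al) (a0 : 0 < a) (gg : GS (- al) g) (gm : GS a m)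
  (k0 : 0 < k) (gxi : (n%:R * g n)^-1 @[n --> \oo] --> xi)
  (gk : \forall n \near \oo, k <= n%:R * g n)
  (h0 : forall i, (0 < h i)%N)
  (hm : asymp_equiv (fun n => (2 * h n.-1)%:R) m).
Implicit Types (x y : R) (n : nat).

Lemma m_gt0 n : (0 < n)%N -> 0 < m n.
Proof. by case: gm => + _; apply. Qed.

Lemma g_gt0 n : (0 < n)%N -> 0 < g n.
Proof. by case: gg => + _; apply. Qed.

Lemma h_cvg_infty : (fun n => h n.-1) @ \oo --> \oo.
Proof.
move=> A [B _ BA]; suff : \forall n \near \oo, (B <= h n.-1)%N by apply: filterS => n; exact: BA.
have m0 : m n `^ (-1) @[n --> \oo] --> (0 : R).
  by apply: (GS_cvg0 _ (GS_powR (-1) gm)); rewrite mulN1r oppr_lt0.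
have B0 : (0 : R) < (4 * B.+1%:R)^-1 by rewrite invr_gt0 mulr_gt0.
have n1 : \forall n \near \oo, m n `^ (-1) <= (4 * B.+1%:R)^-1 by apply: (cvgr_le 0 m0).
have n2 : \forall n \near \oo, 1 / 2 <= (2 * h n.-1)%:R / m n by apply: (cvgr_ge _ hm); lra.
near=> n; have n0 : (0 < n)%N by near: n; exact: near_gt0n.
have mn := m_gt0 n0.
have : m n `^ (-1) <= (4 * B.+1%:R)^-1 by near: n.
have : 1 / 2 <= (2 * h n.-1)%:R / m n by near: n.
rewrite ler_pdivlMr// natrM => H1; rewrite powR_inv1 ?(ltW mn)// lef_pV2 ?posrE ?mulr_gt0// => H2.
have : B.+1%:R <= (h n.-1)%:R :> R by lra.
by rewrite ler_nat => /ltnW.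
Unshelve. all: by end_near. Qed.

Lemma mise_var_cvg : (al - a / 2) * xi < 2 ->
  mise_var f g h n / (g n * m n `^ (1 / 2)) @[n --> \oo] --> C3 * C1 f / (2 - (al - a / 2) * xi).
Proof.
move=> c2.
have gv : GS (- (al - a / 2)) (fun n => g n * m n `^ (1 / 2)).
  rewrite (_ : - _ = - al + 1 / 2 * a); last by field.
  by apply: GS_mul => //; exact: GS_powR.
(* J = 2 and c = al - a / 2. One of the two factors g n of the variance increment is moved into the
   forcing term y. *)
apply: (@GS_recursion _ _ 2 _ _ _ _ 2 g _ _ (fun n => g n * zvar f (h n.-1)) erefl _ gg k0 gxi gk c2 gv).
- by rewrite oppr_lt0.
- near=> n; have n0 : (0 < n)%N by near: n; exact: near_gt0n.
  rewrite -(prednK n0) /mise_var (weightS_sum g (fun i => zvar f (h i))) /=; ring.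
- have z1 : zvar f (h n.-1) / Num.sqrt (2 * h n.-1)%:R @[n --> \oo] --> C3 * C1 f.
    apply: (@cvg_comp _ _ _ (fun n => h n.-1) (fun h => zvar f h / Num.sqrt (2 * h)%:R)).
      exact: h_cvg_infty.
    exact: zvar_cvg.
  have sh := sqrt_cvg hm; rewrite sqrtr1 in sh.
  rewrite -[X in _ --> X]mulr1; apply: (near_cvg (cvgM z1 sh)); near=> n.
  have n0 : (0 < n)%N by near: n; exact: near_gt0n.
  have mn := m_gt0 n0; have gn := g_gt0 n0; have hn := h0 n.-1.
  rewrite /= sqrtrM// sqrtrV ?ltW// -[m n `^ _]/(m n `^ (1 / 2)) div1r powR12_sqrt ?ltW//.
  have s1 : Num.sqrt (m n) != 0 by rewrite gt_eqF// sqrtr_gt0.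
  have s2 : Num.sqrt (2 * h n.-1)%:R != 0 :> R by rewrite gt_eqF// sqrtr_gt0 ltr0n muln_gt0.
  by field; rewrite s1 s2 gt_eqF.
Unshelve. all: by end_near. Qed.

(** Scalar majorant, independent of x, for the distance from the bias to a multiple of [Delta2]. It
    starts from a bound on f because f_0 = 0. *)
Fixpoint error_bound (E : nat -> R) (c : R) n : R :=
  if n is n'.+1 then `|1 - g n| * error_bound E c n' + `|g n| * E n' else c.

(** The bias is b n * [Delta2] plus a remainder that is uniformly o(m^(-2)). The scalars [b] and
    [Rb] obey recursions covered by [GS_recursion], with J = 1 and c = 2 a. *)
Lemma mise_bias_cvg : 2 * a * xi < 1 ->
  (\int[mu]_(x in `[0, 1]) mise_bias f g h n x ^+ 2) / (m n `^ (-4)) @[n --> \oo]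
  --> 4 * C2 f / (1 - 2 * a * xi) ^+ 2.
Proof.
move=> c1.
have gv : GS (- (2 * a)) (fun n => m n `^ (-2)) by rewrite -mulNr; exact: GS_powR.
pose b n : R := \sum_(i < n) weight g n i * (- 2 / (2 * h i)%:R ^+ 2).
have bS n : b n.+1 = (1 - g n.+1) * b n + g n.+1 * (- 2 / (2 * h n)%:R ^+ 2).
  have := weightS_sum g (fun i => - 2 / (2 * h i)%:R ^+ 2) 1 n.
  by under eq_bigr do rewrite expr1; under [in X in _ = X -> _]eq_bigr do rewrite expr1; rewrite !expr1.
have BS n x : mise_bias f g h n.+1 x = (1 - g n.+1) * mise_bias f g h n x + g n.+1 * (zmean f (h n) x - f x).
  have := weightS_sum g (fun i => zmean f (h i) x) 1 n.
  under eq_bigr do rewrite expr1; under [in X in _ = X -> _]eq_bigr do rewrite expr1.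
  by rewrite !expr1 /mise_bias => ->; ring.
(* A single null sequence bounding the scaled expansion error uniformly in x; only then can the
   error be propagated through a scalar recursion. *)
have [eps eps0 heps] : exists2 eps : nat -> R, eps @ \oo --> 0 &
    forall n x, (0 < n)%N -> `[0, 1]%classic x ->
    `|(zmean f n x - f x + 2 * Delta2 f x / (2 * n)%:R ^+ 2) * (2 * n)%:R ^+ 2| <= eps n.
  apply: uniform_modulus => [n n0|e e0].
    have cr : {within `[0, 1], continuous (fun x =>
        (zmean f n x - f x + 2 / (2 * n)%:R ^+ 2 * Delta2 f x) * (2 * n)%:R ^+ 2)}.
      have cr1 : {within `[0, 1], continuous (zmean f n)}.
        by apply: continuous_subspaceT; exact: continuous_zmean.
      have cr2 : {within `[0, 1], continuous (fun x => 2 / (2 * n)%:R ^+ 2 * Delta2 f x)}.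
        by apply: within_scale; exact: within_Delta2.
      move=> x; apply: cvgM; last exact: cvg_cst.
      apply: cvgD; last exact: cr2.
      by apply: cvgB; [exact: cr1 | exact: continuous_density].
    have [M _ hM] := continuous01_bounded cr.
    by exists M => x x01; rewrite -[2 * _ / _]mulrAC; exact: hM.
  have [n0 hn0] := zmean_expansion f_density f_C4 e0.
  exists n0.+1 => n x nn /=; rewrite in_itv/= => x01.
  have t0 : (0 : R) < (2 * n)%:R ^+ 2 by rewrite exprn_gt0// ltr0n muln_gt0 (leq_trans _ nn).
  rewrite normrM (ger0_norm (ltW t0)) -ler_pdivlMr//.
  by apply: hn0 => //; exact: ltnW.
have [Mf Mf0 hMf] := continuous01_bounded (continuous_density f_C4).
have [MD MD0 hMD] := continuous01_bounded (within_Delta2 f_C4).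
pose E n := eps (h n) / (2 * h n)%:R ^+ 2.
pose Rb := error_bound E Mf.
have rhob n x : 0 <= x <= 1 -> `|mise_bias f g h n x - b n * Delta2 f x| <= Rb n.
  move=> x01; elim: n => [|n IH].
    by rewrite /mise_bias /b !big_ord0 mul0r subr0 add0r normrN; exact: hMf.
  have t0 : (0 : R) < (2 * h n)%:R ^+ 2 by rewrite exprn_gt0// ltr0n muln_gt0 h0.
  have -> : mise_bias f g h n.+1 x - b n.+1 * Delta2 f x =
      (1 - g n.+1) * (mise_bias f g h n x - b n * Delta2 f x) +
      g n.+1 * (zmean f (h n) x - f x + 2 * Delta2 f x / (2 * h n)%:R ^+ 2).
    by rewrite BS bS; ring.
  apply: le_trans (ler_normD _ _) _; rewrite !normrM /Rb /=; apply: lerD.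
    by rewrite ler_wpM2l.
  rewrite ler_wpM2l// /E ler_pdivlMr//.
  have := heps _ x (h0 n); rewrite normrM (ger0_norm (ltW t0)); apply.
  by rewrite /= in_itv.
have hm2 : (m n / (2 * h n.-1)%:R) ^+ 2 @[n --> \oo] --> (1 : R).
  have hmV : ((2 * h n.-1)%:R / m n)^-1 @[n --> \oo] --> (1 : R)^-1.
    by apply: cvgV; [exact: oner_neq0 | exact: hm].
  rewrite invr1 in hmV.
  have hm1 : m n / (2 * h n.-1)%:R @[n --> \oo] --> (1 : R).
    by apply: (near_cvg hmV); apply: nearW => n /=; rewrite invf_div.
  by have := cvg_exprn (k := 2) hm1; rewrite expr1n.
have vE n : (0 < n)%N -> m n `^ (-2) = (m n ^+ 2)^-1.
  by move=> n0; rewrite powRN powR_mulrn ?ltW ?m_gt0.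
have nal : - al < 0 by rewrite oppr_lt0.
have bv : b n / m n `^ (-2) @[n --> \oo] --> - 2 / (1 - 2 * a * xi).
  apply: (@GS_recursion _ _ 1 _ _ _ _ 1 g _ _ (fun n => - 2 / (2 * h n.-1)%:R ^+ 2) erefl nal gg k0 gxi gk c1 gv).
  - near=> n; have n0 : (0 < n)%N by near: n; exact: near_gt0n.
    by rewrite -(prednK n0) bS expr1.
  - have hm3 : - 2 * (m n / (2 * h n.-1)%:R) ^+ 2 @[n --> \oo] --> (- 2 * 1 : R).
      by apply: cvgM => //; exact: cvg_cst.
    rewrite mulr1 in hm3; apply: (near_cvg hm3); near=> n.
    have n0 : (0 < n)%N by near: n; exact: near_gt0n.
    rewrite vE// invrK expr_div_n; ring.
(* The recursion lemma with t = 0: the forcing is eps times a sequence equivalent to m^(-2), and the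
   initial bound on f is forgotten. *)
have Rv : Rb n / m n `^ (-2) @[n --> \oo] --> (0 : R).
  rewrite -[X in _ --> X](mul0r (1 - 2 * a * xi)^-1).
  apply: (@GS_recursion _ _ 1 _ _ _ _ 1 g _ _ (fun n => E n.-1) erefl nal gg k0 gxi gk c1 gv).
  - have g1 : \forall n \near \oo, g n <= 1 by apply: (cvgr_le _ (GS_cvg0 nal gg)).
    near=> n; have n0 : (0 < n)%N by near: n; exact: near_gt0n.
    have gn1 : g n <= 1 by near: n.
    have gn0 := g_gt0 n0.
    by move: gn1 gn0; rewrite -(prednK n0) => gn1 gn0; rewrite /Rb /= ger0_norm ?subr_ge0// expr1 (ger0_norm (ltW gn0)).
  - have e1 : eps (h n.-1) @[n --> \oo] --> (0 : R).
      by apply: (@cvg_comp _ _ _ (fun n => h n.-1) eps); [exact: h_cvg_infty | exact: eps0].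
    have e2 : eps (h n.-1) * (m n / (2 * h n.-1)%:R) ^+ 2 @[n --> \oo] --> (0 * 1 : R) by exact: cvgM.
    rewrite mul0r in e2; apply: (near_cvg e2); near=> n.
    have n0 : (0 < n)%N by near: n; exact: near_gt0n.
    rewrite vE// invrK expr_div_n /E; ring.
(* The error in replacing the bias by b n * [Delta2] inside the squared norm. *)
pose D n : R := \int[mu]_(x in `[0, 1]) mise_bias f g h n x ^+ 2 - b n ^+ 2 * C2 f.
have cB n : {within `[0, 1], continuous (mise_bias f g h n)}.
  move=> x; apply: cvgB; last exact: continuous_density.
  apply: continuous_subspaceT; apply: continuous_sumf => i; apply: continuous_scalef.
  exact: continuous_zmean.
have DL n : `|D n| <= 2 * `|b n| * MD * Rb n + Rb n ^+ 2.
  have cD : {within `[0, 1], continuous (fun x => b n ^+ 2 * Delta2 f x ^+ 2)}.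
    by apply: within_scale; apply: within_sqr; exact: within_Delta2.
  have cB2 : {within `[0, 1], continuous (fun x => mise_bias f g h n x ^+ 2)}.
    exact: within_sqr.
  rewrite /D /C2 -RintegralZl//; last first.
    by apply: continuous_integrable_itv; apply: within_sqr; exact: within_Delta2.
  apply: Rintegral_dist01 => // x x01.
  have := rhob n x x01; have := hMD x x01; have R0 : 0 <= Rb n by apply: le_trans (rhob n x x01).
  set B := mise_bias _ _ _ _ _; set d := Delta2 f x => d1 B1.
  have -> : B ^+ 2 - b n ^+ 2 * d ^+ 2 = 2 * b n * d * (B - b n * d) + (B - b n * d) ^+ 2 by ring.
  apply: le_trans (ler_normD _ _) _; rewrite normrX !normrM (ger0_norm (ler0n R 2)); apply: lerD.
    by do 2 (apply: ler_pM => //); rewrite ?mulr_ge0.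
  by rewrite ler_sqr ?nnegrE.
have Dv : D n / (m n `^ (-2)) ^+ 2 @[n --> \oo] --> (0 : R).
  have u1 : 2 * `|b n / m n `^ (-2)| * MD * (Rb n / m n `^ (-2)) + (Rb n / m n `^ (-2)) ^+ 2 @[n --> \oo] --> (0 : R).
    have u2 : 2 * `|b n / m n `^ (-2)| * MD * (Rb n / m n `^ (-2)) @[n --> \oo]
        --> 2 * `|- 2 / (1 - 2 * a * xi)| * MD * 0.
      apply: cvgM => //; apply: cvgM; last exact: cvg_cst.
      by apply: cvgM; [exact: cvg_cst | exact: cvg_norm].
    have u3 := cvg_exprn (k := 2) Rv; rewrite expr0n /= in u3; rewrite mulr0 in u2.
    by rewrite -[X in _ --> X](addr0 0); exact: cvgD.
  have u2 : - (2 * `|b n / m n `^ (-2)| * MD * (Rb n / m n `^ (-2)) + (Rb n / m n `^ (-2)) ^+ 2)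
      @[n --> \oo] --> (0 : R) by rewrite -[X in _ --> X]oppr0; exact: cvgN.
  apply: (squeeze_cvgr _ u2 u1); near=> n.
  have n0 : (0 < n)%N by near: n; exact: near_gt0n.
  have v0 : 0 < m n `^ (-2) by rewrite powR_gt0 ?m_gt0.
  rewrite -ler_norml normrM normfV (ger0_norm (sqr_ge0 _)) ler_pdivrMr ?exprn_gt0//.
  apply: le_trans (DL n) _; rewrite normrM normfV (gtr0_norm v0).
  by rewrite le_eqVlt; apply/orP; left; apply/eqP; field; rewrite gt_eqF.
have e1 : (b n / m n `^ (-2)) ^+ 2 * C2 f + D n / (m n `^ (-2)) ^+ 2 @[n --> \oo]
    --> (- 2 / (1 - 2 * a * xi)) ^+ 2 * C2 f + 0.
  by apply: cvgD => //; apply: cvgM; [exact: cvg_exprn | exact: cvg_cst].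
have -> : 4 * C2 f / (1 - 2 * a * xi) ^+ 2 = (- 2 / (1 - 2 * a * xi)) ^+ 2 * C2 f + 0.
  by field; rewrite gt_eqF// subr_gt0.
apply: (near_cvg e1); near=> n.
have n0 : (0 < n)%N by near: n; exact: near_gt0n.
have mn := m_gt0 n0.
rewrite vE// powRN powR_mulrn ?ltW// /D; field; rewrite gt_eqF//.
Unshelve. all: by end_near. Qed.

End Asymptotics.

(** * Optimal order *)

Section Tradeoff.
Context {R : realType}.
Implicit Types (t e L : R).

(* With t = (m / m_opt)^(1/2), the leading terms of the MISE (variance of order
   m^(1/2), squared bias of order m^(-4)) are proportional to 8 t + t^(-8). *)
Lemma tradeoff_ge t : 0 < t -> 8 * (t - 1) ^+ 2 / t <= 8 * t + t ^- 8 - 9.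
Proof.
move=> t0; rewrite -subr_ge0.
have -> : 8 * t + t ^- 8 - 9 - 8 * (t - 1) ^+ 2 / t = (t - 1) ^+ 2 *
    (7 * t ^+ 6 + 6 * t ^+ 5 + 5 * t ^+ 4 + 4 * t ^+ 3 + 3 * t ^+ 2 + 2 * t + 1) / t ^+ 8.
  by field; rewrite gt_eqF.
apply: divr_ge0; last by rewrite exprn_ge0// ltW.
apply: mulr_ge0; first exact: sqr_ge0.
by rewrite !addr_ge0// ?mulr_ge0// ?exprn_ge0// ltW.
Qed.

Lemma tradeoff_ge9 t : 0 < t -> 9 <= 8 * t + t ^- 8.
Proof.
move=> t0; rewrite -subr_ge0; apply: le_trans (tradeoff_ge t0).
by apply: divr_ge0; [rewrite mulr_ge0 ?sqr_ge0 | exact: ltW].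
Qed.

Context (L : R) (uo ua ub t : nat -> R).
Context (L0 : 0 < L) (t0 : \forall n \near \oo, 0 < t n)
  (uoL : uo @ \oo --> 9 / 8 * L) (uaL : ua @ \oo --> L) (ubL : ub @ \oo --> L / 8).
(** In the application, [uo] and [u] are the MISE over g^(8/9) for the optimal and for a competing
    order; L and L / 8 are the variance and bias parts at the optimum. *)
Let u n := ua n * t n + ub n * t n ^- 8.

Lemma tradeoff_lower (d : R) : 0 < d -> \forall n \near \oo,
  (1 - d) * (L / 8) * (8 * t n + t n ^- 8) <= u n.
Proof.
move=> d0; have dL : 0 < d * L by rewrite mulr_gt0.
have na : \forall n \near \oo, (1 - d) * L <= ua n by apply: (cvgr_ge _ uaL); lra.
have nb : \forall n \near \oo, (1 - d) * (L / 8) <= ub n by apply: (cvgr_ge _ ubL); lra.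
near=> n; have tn : 0 < t n by near: n.
have an : (1 - d) * L <= ua n by near: n.
have bn : (1 - d) * (L / 8) <= ub n by near: n.
have s0 : 0 < t n ^- 8 by rewrite invr_gt0 exprn_gt0.
rewrite /u mulrDr; apply: lerD; last by rewrite ler_pM2r.
apply: le_trans (_ : (1 - d) * L * t n <= _); last by rewrite ler_pM2r.
by rewrite le_eqVlt; apply/orP; left; apply/eqP; field.
Unshelve. all: by end_near. Qed.

Lemma tradeoff_le e : 0 < e -> \forall n \near \oo, uo n <= (1 + e) * u n.
Proof.
(* Chosen so that (1 + d) / (1 - d) = 1 + e. *)
move=> e0; pose d := e / (2 + e).
have e2 : 0 < 2 + e by lra.
have d0 : 0 < d by rewrite divr_gt0.
have d1 : 0 < 1 - d by rewrite subr_gt0 ltr_pdivrMr// mul1r; lra.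
have dL : 0 < d * L by rewrite mulr_gt0.
have no : \forall n \near \oo, uo n <= (1 + d) * (9 / 8 * L) by apply: (cvgr_le _ uoL); lra.
have nl := tradeoff_lower d0.
near=> n; have tn : 0 < t n by near: n.
have un : (1 - d) * (L / 8) * (8 * t n + t n ^- 8) <= u n by near: n.
apply: le_trans (_ : (1 + e) * ((1 - d) * (L / 8) * 9) <= _).
  apply: le_trans (_ : (1 + d) * (9 / 8 * L) <= _); first by near: n.
  by rewrite le_eqVlt; apply/orP; left; apply/eqP; rewrite /d; field; rewrite gt_eqF.
rewrite ler_pM2l; last by lra.
apply: le_trans un; rewrite ler_pM2l ?tradeoff_ge9//.
by rewrite !mulr_gt0// divr_gt0.
Unshelve. all: by end_near. Qed.

Lemma tradeoff_cvg1 : (forall e, 0 < e -> \forall n \near \oo, u n <= (1 + e) * uo n) ->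
  t @ \oo --> (1 : R).
Proof.
move=> H; apply/cvgrPdist_le => e e0.
(* w <= 7 forces t n <= 2 through 8 t n <= 9 + w; then 8 (t n - 1)^2 <= 2 w <= 8 e^2. *)
pose w := Num.min 7 (4 * e ^+ 2).
have w0 : 0 < w by rewrite lt_min ltr0n/= mulr_gt0// exprn_gt0.
have [w7 we] : w <= 7 /\ w <= 4 * e ^+ 2 by rewrite !ge_min !lexx orbT.
(* For d <= 1/2 one has (1 + d)^2 <= (1 - d) (1 + 8 d), and 9 * 8 d <= w because d <= w / 72. *)
pose d := Num.min 2^-1 (w / 72).
have d0 : 0 < d by rewrite lt_min invr_gt0 ltr0n/= divr_gt0.
have [d2 dw] : d <= 2^-1 /\ d <= w / 72 by rewrite !ge_min !lexx orbT.
have dL : 0 < d * L by rewrite mulr_gt0.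
have no : \forall n \near \oo, uo n <= (1 + d) * (9 / 8 * L) by apply: (cvgr_le _ uoL); lra.
have nl := tradeoff_lower d0.
have nu := H d d0.
near=> n; have tn : 0 < t n by near: n.
have h1 : (1 - d) * (L / 8) * (8 * t n + t n ^- 8) <= u n by near: n.
have h2 : u n <= (1 + d) * uo n by near: n.
have h3 : uo n <= (1 + d) * (9 / 8 * L) by near: n.
have h4 : (1 - d) * (L / 8) * (8 * t n + t n ^- 8) <= (1 + d) * ((1 + d) * (9 / 8 * L)).
  by apply: le_trans h1 _; apply: le_trans h2 _; rewrite ler_pM2l//; lra.
have h5 : 8 * t n + t n ^- 8 <= 9 + w.
  have L8 : 0 < L / 8 by rewrite divr_gt0.
  have d1 : 0 < (1 - d) * (L / 8) by rewrite mulr_gt0//; lra.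
  rewrite -(ler_pM2l d1); apply: le_trans h4 _.
  have -> : (1 + d) * ((1 + d) * (9 / 8 * L)) = (L / 8) * (9 * (1 + d) ^+ 2) by field.
  rewrite [leRHS]mulrAC [leRHS]mulrC ler_pM2l//.
  have : (1 + d) ^+ 2 <= (1 - d) * (1 + 8 * d) by nra.
  have : (1 - d) * (1 + 8 * d) * 9 <= (1 - d) * (9 + w) by rewrite -mulrA ler_pM2l; lra.
  by lra.
have h6 := tradeoff_ge tn.
have h7 : 8 * (t n - 1) ^+ 2 / t n <= w by lra.
have s0 : 0 < t n ^- 8 by rewrite invr_gt0 exprn_gt0.
have t2 : t n <= 2 by lra.
rewrite ler_pdivrMr// in h7.
have h8 : (t n - 1) ^+ 2 <= e ^+ 2.
  have : w * t n <= w * 2 by rewrite ler_pM2l.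
  by lra.
by rewrite distrC -ler_sqr ?nnegrE ?normr_ge0 ?(ltW e0)// real_normK ?num_real.
Unshelve. all: by end_near. Qed.

End Tradeoff.

Section Orders.
Context {R : realType}.
Local Notation mu := (@lebesgue_measure R).
Context (d : measure_display) (T : measurableType d) (P : probability T R)
  (X : nat -> {RV P >-> R}) (f : R -> R) (f_density : density01 f)
  (X_iid : iid_with_density (fun n => X n.+1) f) (f_C4 : C4_01 f) (C2_gt0 : 0 < C2 f).
Implicit Types (g m : nat -> R) (N : nat -> nat).

Lemma C1_gt0 : 0 < C1 f.
Proof.
have [M M0 hM] := density_bounded f_C4.
apply: lt_le_trans (C1_ge (density_measurable f_density) (density_ge0 f_density)
  (density_integrable f_density) hM).
by rewrite (mass_open f_density) mulr1 sqrtr_gt0 invr_gt0 pi_gt0.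
Qed.

(** Only the minimum of the two thresholds is assumed below L, so each limit is stated under its own
    threshold. *)
Lemma mise_decomposition (alpha a : R) g m N (L : \bar R) :
  1 / 2 < alpha <= 1 -> 0 < a < 1 -> GS (- alpha) g -> GS a m -> integer_order N m ->
  (n%:R * g n)%:E @[n --> \oo] --> L ->
  ((Num.min (2 * a) ((2 * alpha - a) / 4))%:E < L)%E ->
  exists bs vs xi, [/\
    forall n, [/\ MISE X f g N n = (bs n + vs n)%:E, 0 <= bs n & 0 <= vs n],
    (n%:R * g n)^-1 @[n --> \oo] --> xi,
    ((2 * a)%:E < L)%E -> 0 < 1 - 2 * a * xi /\
      bs n / m n `^ (-4) @[n --> \oo] --> 4 * C2 f / (1 - 2 * a * xi) ^+ 2
  & (((2 * alpha - a) / 4)%:E < L)%E -> 0 < 2 - (alpha - a / 2) * xi /\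
      vs n / (g n * m n `^ (1 / 2)) @[n --> \oo] --> C3 * C1 f / (2 - (alpha - a / 2) * xi)].
Proof.
move=> /andP[al2 al1] /andP[a0 a1] gg gm [Npos Nm] gL cL.
have c0 : 0 <= Num.min (2 * a) ((2 * alpha - a) / 4) by rewrite le_min; apply/andP; split; lra.
have [xi [gxi xi0 [k k0 gk] hxi]] := stepsize_inv_cvg c0 cL gL.
pose h i := (N i.+1)./2.
have hN i : (0 < h i)%N /\ N i.+1 = (2 * h i)%N.
  have /andP[n1 n2] := Npos i.+1 isT.
  have E : N i.+1 = (2 * h i)%N by rewrite mul2n -[LHS]odd_double_half (negPf n2).
  by split => //; move: n1; rewrite E muln_gt0.
have h0 i : (0 < h i)%N by have [] := hN i.
have hm : asymp_equiv (fun n => (2 * h n.-1)%:R) m.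
  apply: (near_cvg Nm); near=> n; have n0 : (0 < n)%N by near: n; exact: near_gt0n.
  by have [_ <-] := hN n.-1; rewrite prednK.
have al0 : 0 < alpha by lra.
exists (fun n => \int[mu]_(x in `[0, 1]) mise_bias f g h n x ^+ 2), (mise_var f g h), xi; split => //.
- move=> n; split; first exact: MISE_bias_var.
    by apply: Rintegral_ge0 => x _; exact: sqr_ge0.
  by apply: sumr_ge0 => i _; rewrite mulr_ge0 ?sqr_ge0 ?zvar_ge0.
- move=> /hxi c1; split; first by rewrite subr_gt0.
  exact: (@mise_bias_cvg _ f f_density f_C4 alpha a xi k).
- move=> /hxi c1; have c2 : (alpha - a / 2) * xi < 2.
    by rewrite (_ : (alpha - _) * xi = 2 * ((2 * alpha - a) / 4 * xi)); [lra | field].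
  split; first by rewrite subr_gt0.
  exact: (@mise_var_cvg _ f f_density f_C4 alpha a xi k).
Unshelve. all: by end_near. Qed.

Lemma cvg_half_lower (u w : nat -> R) (l : R) : 0 < l ->
  (\forall n \near \oo, 0 < w n) -> u n / w n @[n --> \oo] --> l ->
  \forall n \near \oo, l / 2 * w n <= u n.
Proof.
move=> l0 w0 uw; have H : \forall n \near \oo, l / 2 <= u n / w n by apply: (cvgr_ge _ uw); lra.
near=> n; have wn : 0 < w n by near: n.
have : l / 2 <= u n / w n by near: n.
by rewrite ler_pdivlMr.
Unshelve. all: by end_near. Qed.

(** If a <= 2 alpha / 9, the bias threshold is the available one and the squared bias has exponent 4
    a. Otherwise the variance has exponent alpha - a / 2. Both exponents are at most 8/9, and 8/9 is
    reached only at alpha = 1, a = 2/9. *)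
Lemma mise_lower_bound (alpha a : R) g m N : admissible alpha a g m -> integer_order N m ->
  exists q c w, [/\ GS (- q) w, 0 < c,
    \forall n \near \oo, ((c * w n)%:E <= MISE X f g N n)%E &
    q < 8 / 9 \/ (alpha = 1 /\ a = 2 / 9)].
Proof.
move=> [al a01 gg gm [L gL cL]] Nm.
have [bs [vs [xi [Mbv _ Hb Hv]]]] := mise_decomposition al a01 gg gm Nm gL cL.
have /andP[al2 al1] := al; have /andP[a0 a1] := a01.
have [aal|aal] := leP a (2 / 9 * alpha).
- have m2a : Num.min (2 * a) ((2 * alpha - a) / 4) = 2 * a.
    by apply/min_idPl; lra.
  rewrite m2a in cL; have [D0 bl] := Hb cL.
  have gw : GS (- (4 * a)) (fun n => m n `^ (-4)) by rewrite -mulNr; exact: GS_powR.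
  have l0 : 0 < 4 * C2 f / (1 - 2 * a * xi) ^+ 2 by rewrite divr_gt0 ?exprn_gt0 ?mulr_gt0.
  exists (4 * a), (4 * C2 f / (1 - 2 * a * xi) ^+ 2 / 2), (fun n => m n `^ (-4)); split => //.
  + by rewrite divr_gt0.
  + have w0 : \forall n \near \oo, 0 < m n `^ (-4).
      by near=> n; apply: gw.1; near: n; exact: near_gt0n.
    have lb := cvg_half_lower l0 w0 bl.
    near=> n; have [-> b0 v0] := Mbv n; rewrite lee_fin.
    by apply: le_trans (_ : bs n <= _); [near: n | rewrite lerDl].
  + have [al1'|al1'] := ltP alpha 1; first by left; lra.
    have [a29|a29] := ltP a (2 / 9); first by left; lra.
    by right; split; lra.
- have m2a : Num.min (2 * a) ((2 * alpha - a) / 4) = (2 * alpha - a) / 4.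
    by apply/min_idPr; lra.
  rewrite m2a in cL; have [D0 bl] := Hv cL.
  have gw : GS (- (alpha - a / 2)) (fun n => g n * m n `^ (1 / 2)).
    rewrite (_ : - _ = - alpha + 1 / 2 * a); last by field.
    by apply: GS_mul => //; exact: GS_powR.
  have l0 : 0 < C3 * C1 f / (2 - (alpha - a / 2) * xi).
    by rewrite divr_gt0 ?mulr_gt0 ?C1_gt0 ?C3_gt0.
  exists (alpha - a / 2), (C3 * C1 f / (2 - (alpha - a / 2) * xi) / 2),
    (fun n => g n * m n `^ (1 / 2)); split => //.
  + by rewrite divr_gt0.
  + have w0 : \forall n \near \oo, 0 < g n * m n `^ (1 / 2).
      by near=> n; apply: gw.1; near: n; exact: near_gt0n.
    have lb := cvg_half_lower l0 w0 bl.
    near=> n; have [-> b0 v0] := Mbv n; rewrite lee_fin.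
    by apply: le_trans (_ : vs n <= _); [near: n | rewrite lerDr].
  + by left; lra.
Unshelve. all: by end_near. Qed.

End Orders.

Section NinthRoots.
Context {R : realType}.
Implicit Types x : R.

(** Every exponent in the optimal constants is a multiple of 1/9. In terms of ninth roots,
    identities between powers become identities for [field]. *)
Lemma powR_ninth x (k : nat) : 0 <= x -> x `^ (k%:R / 9) = (x `^ (1 / 9)) ^+ k.
Proof. by move=> x0; rewrite -powR_mulrn ?powR_ge0// -powRrM; congr (_ `^ _); ring. Qed.

Lemma powR_ninthK x : 0 <= x -> (x `^ (1 / 9)) ^+ 9 = x.
Proof. by move=> x0; rewrite -powR_ninth// divff ?powRr1. Qed.

Lemma ninthX x (k : nat) : 0 <= x -> (x ^+ k) `^ (1 / 9) = (x `^ (1 / 9)) ^+ k.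
Proof. by move=> x0; rewrite -powR_ninth// -powR_mulrn// -powRrM; congr (_ `^ _); ring. Qed.

Lemma powR_half_sqr x : 0 <= x -> (x ^+ 2) `^ (1 / 2) = x.
Proof. by move=> x0; rewrite -powR_mulrn// -powRrM mulrC mul1r mulVf ?powRr1. Qed.

Lemma powR_N4_sqr x : 0 <= x -> (x ^+ 2) `^ (-4) = x ^- 8.
Proof. by move=> x0; rewrite powRN powR_mulrn ?exprn_ge0// -exprM. Qed.

Lemma expansion_of_ratio (u : nat -> \bar R) (r w : nat -> R) (K : R) :
  (forall n, u n = (r n)%:E) -> (\forall n \near \oo, 0 < w n) ->
  r n / w n @[n --> \oo] --> K -> expansion u K w.
Proof.
move=> ur w0 rK; exists (fun n => r n - K * w n); last by move=> n; rewrite ur subrKC.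
apply/eqoP => e e0; have H : \forall n \near \oo, `|K - r n / w n| <= e.
  by move/cvgrPdist_le : rK; exact.
near=> n; have wn : 0 < w n by near: n.
have : `|K - r n / w n| <= e by near: n.
rewrite (gtr0_norm wn) -(ler_pM2r wn) -{2}(gtr0_norm wn) -normrM distrC; congr (_ <= _).
by rewrite mulrBl divfK ?gt_eqF.
Unshelve. all: by end_near. Qed.

End NinthRoots.

Section Optimal.
Context {R : realType}.
Context (d : measure_display) (T : measurableType d) (P : probability T R)
  (X : nat -> {RV P >-> R}) (f : R -> R) (f_density : density01 f)
  (X_iid : iid_with_density (fun n => X n.+1) f) (f_C4 : C4_01 f) (C2_gt0 : 0 < C2 f).
Context (g : nat -> R) (gg : GS (-1) g) (gs : stepsize_limit 1 (2 / 9) g).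
Implicit Types (m : nat -> R) (N : nat -> nat) (n : nat).

Let D : R := 1 - 4 / 9 * xi_of g.

(** Square root of the constant in [m_opt], with 2^(12/9) collecting the factors 2^(2/9) and
    32^(2/9); the square root of the optimal order is q / g^(1/9). *)
Let q : R := (2 `^ (1 / 9)) ^+ 6 * C2 f `^ (1 / 9)
  / (D `^ (1 / 9) * C1 f `^ (1 / 9) * C3 `^ (1 / 9)).

(** Limit of the variance part of MISE / g^(8/9) at the optimal order. *)
Let L : R := C3 * C1 f / (2 * D) * q.

Lemma min29 : Num.min (2 * (2 / 9)) ((2 * 1 - 2 / 9) / 4) = 4 / 9 :> R.
Proof.
have -> : (2 * 1 - 2 / 9) / 4 = 2 * (2 / 9) :> R by field.
by rewrite minxx; field.
Qed.

Lemma gap_gt0 : 0 < D.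
Proof.
have [l gl cl] := gs; rewrite min29 in cl.
have c0 : 0 <= 4 / 9 :> R by lra.
have [xi [gxi _ _ /(_ _ cl) H]] := stepsize_inv_cvg c0 cl gl.
by rewrite /D /xi_of (cvg_lim _ gxi)// subr_gt0.
Qed.

Lemma ninth_gt0 (x : R) : 0 < x -> 0 < x `^ (1 / 9).
Proof. exact: powR_gt0. Qed.

Lemma q_gt0 : 0 < q.
Proof.
have C10 := C1_gt0 f_density f_C4.
by rewrite /q divr_gt0 ?mulr_gt0 ?exprn_gt0 ?ninth_gt0 ?gap_gt0 ?C3_gt0.
Qed.

Lemma L_gt0 : 0 < L.
Proof.
have C10 := C1_gt0 f_density f_C4.
by rewrite /L mulr_gt0 ?q_gt0// divr_gt0 ?mulr_gt0 ?gap_gt0 ?C3_gt0.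
Qed.

Lemma m_optE n : m_opt f g n = q ^+ 2 * g n `^ (- (2 / 9)).
Proof.
have C10 := C1_gt0 f_density f_C4; have C30 := @C3_gt0 R; have D0 := gap_gt0.
rewrite /m_opt; congr (_ * _).
have E32 : 32 = 2 ^+ 5 :> R by ring.
have C20 := C2_gt0.
have -> : 32 * C2 f / (C1 f * C3) = 2 ^+ 5 * C2 f * (C1 f * C3)^-1 by rewrite E32.
have X0 : 0 <= 2 ^+ 5 * C2 f * (C1 f * C3)^-1 by rewrite ltW// !mulr_gt0// ?exprn_gt0// invr_gt0 mulr_gt0.
rewrite -/D powRN (@powR_ninth _ 2 2)// (@powR_ninth _ D 2) ?ltW// (@powR_ninth _ _ 2 X0).
rewrite !powRM ?invr_ge0 ?mulr_ge0 ?exprn_ge0 ?ltW// powRV ?mulr_ge0 ?ltW// powRM ?ltW//.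
rewrite /q.
have p0 := @ninth_gt0 2 ltac:(by []); have p1 := ninth_gt0 D0; have p2 := ninth_gt0 C10.
have p3 := ninth_gt0 C30.
move: p0 p1 p2 p3; move: (2 `^ _) (D `^ _) (C1 f `^ _) (C3 `^ _) (C2 f `^ _).
by move=> u1 u2 u3 u4 u5 p0 p1 p2 p3; field; rewrite !gt_eqF.
Qed.

Lemma m_opt_gt0 n : (0 < n)%N -> 0 < m_opt f g n.
Proof. by move=> n0; rewrite m_optE mulr_gt0 ?exprn_gt0 ?q_gt0// powR_gt0//; exact: gg.1. Qed.

Lemma GS_m_opt : GS (2 / 9) (m_opt f g).
Proof.
have -> : m_opt f g = (fun n => q ^+ 2 * g n `^ (- (2 / 9))) by apply: funext => n; exact: m_optE.
apply: GS_scale; first by rewrite exprn_gt0// q_gt0.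
by have := GS_powR (- (2 / 9)) gg; rewrite mulrNN mulr1.
Qed.

Lemma q_ninth : q ^+ 9 = 64 * C2 f / (D * C1 f * C3).
Proof.
have C10 := C1_gt0 f_density f_C4; have C30 := @C3_gt0 R; have D0 := gap_gt0.
have E (a b c e z : R) : (a ^+ 6 * b / (c * e * z)) ^+ 9
    = (a ^+ 9) ^+ 6 * b ^+ 9 / (c ^+ 9 * e ^+ 9 * z ^+ 9).
  by rewrite expr_div_n exprMn [(a ^+ 6) ^+ 9]exprAC [(c * e * z) ^+ 9]exprMn [(c * e) ^+ 9]exprMn.
transitivity (2 ^+ 6 * C2 f / (D * C1 f * C3)); last by congr (_ * _ / _); ring.
by rewrite /q E; congr (_ ^+ 6 * _ / (_ * _ * _)); apply: powR_ninthK => //; exact: ltW.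
Qed.

(** Stationarity of A m^(1/2) + B m^(-4) in m: at the optimum the squared bias is one eighth of the
    variance. *)
Lemma bias_constant : 4 * C2 f / D ^+ 2 / q ^+ 8 = L / 8.
Proof.
have C10 := C1_gt0 f_density f_C4; have C30 := @C3_gt0 R; have D0 := gap_gt0.
have E : C2 f = q ^+ 9 * (D * C1 f * C3) / 64.
  by rewrite q_ninth; field; rewrite !gt_eqF.
rewrite /L; move: E q_gt0; move: (q) => r E r0; rewrite E.
by field; rewrite !gt_eqF.
Qed.

Lemma mise_constant :
  9 / 8 * L = 9 * (32 * C1 f ^+ 8 * C3 ^+ 8 * C2 f) `^ (1 / 9) / 8
    * (1 / (2 `^ (8 / 9) * (1 - 4 / 9 * xi_of g) `^ (10 / 9))).
Proof.
have C10 := C1_gt0 f_density f_C4; have C30 := @C3_gt0 R; have D0 := gap_gt0.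
have p0 := @ninth_gt0 2 ltac:(by []); have p1 := ninth_gt0 D0; have p2 := ninth_gt0 C10.
have p3 := ninth_gt0 C30.
have e : C3 * C1 f / (2 * D) = (C3 `^ (1 / 9)) ^+ 9 * (C1 f `^ (1 / 9)) ^+ 9
    / ((2 `^ (1 / 9)) ^+ 9 * (D `^ (1 / 9)) ^+ 9) by rewrite !powR_ninthK ?ltW.
rewrite -/D (@powR_ninth _ 2 8)// (@powR_ninth _ D 10) ?ltW// /L e /q.
have -> : (32 * C1 f ^+ 8 * C3 ^+ 8 * C2 f) `^ (1 / 9) = (2 `^ (1 / 9)) ^+ 5
    * (C1 f `^ (1 / 9)) ^+ 8 * (C3 `^ (1 / 9)) ^+ 8 * C2 f `^ (1 / 9).
  have -> : 32 = 2 ^+ 5 :> R by ring.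
  by rewrite !powRM ?mulr_ge0 ?exprn_ge0 ?ltW// !ninthX ?ltW.
move: p0 p1 p2 p3; move: (2 `^ _) (D `^ _) (C1 f `^ _) (C3 `^ _) (C2 f `^ _).
by move=> u1 u2 u3 u4 u5 p0 p1 p2 p3; field; rewrite !gt_eqF.
Qed.

Definition order_ratio m n : R := Num.sqrt (m n / m_opt f g n).

(** Brings the MISE of any order in [GS (2 / 9)] into the form treated in the trade-off lemmas.
    Index 0 is excluded because g and m are unconstrained there. *)
Lemma mise_ratio m N : GS (2 / 9) m -> integer_order N m ->
  exists ua ub, [/\ ua @ \oo --> L, ub @ \oo --> L / 8 &
    forall n, exists2 r, MISE X f g N n = r%:E & (0 < n)%N ->
     r = (ua n * order_ratio m n + ub n * order_ratio m n ^- 8) * g n `^ (8 / 9)].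
Proof.
move=> gm Nm; have [l gl cl] := gs.
have al : 1 / 2 < (1 : R) <= 1 by apply/andP; split; lra.
have a01 : (0 : R) < (2 / 9 : R) < (1 : R) by apply/andP; split; lra.
have [bs [vs [xi [Mbv gxi Hb Hv]]]] := mise_decomposition f_density X_iid f_C4 al a01 gg gm Nm gl cl.
have cl' := cl; rewrite min29 in cl'.
have xiE : xi_of g = xi by rewrite /xi_of (cvg_lim _ gxi).
have E1 : 2 * (2 / 9) = 4 / 9 :> R by field.
have E2 : (2 * 1 - 2 / 9) / 4 = 4 / 9 :> R by field.
rewrite E1 in Hb; rewrite E2 in Hv.
have DE : 1 - 4 / 9 * xi = D by rewrite /D xiE.
have [_ bl] := Hb cl'; have [_ vl] := Hv cl'.
rewrite DE in bl; rewrite (_ : 2 - (1 - 2 / 9 / 2) * xi = 2 * D) in vl; last by rewrite /D xiE; field.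
exists (fun n => vs n / (g n * m n `^ (1 / 2)) * q), (fun n => bs n / m n `^ (-4) / q ^+ 8); split.
- by apply: cvgM => //; exact: cvg_cst.
- by rewrite -bias_constant; apply: cvgM => //; exact: cvg_cst.
move=> n; have [Mn _ _] := Mbv n; exists (bs n + vs n) => // n0.
have mo := m_opt_gt0 n0; have mn : 0 < m n by exact: gm.1.
have gn : 0 < g n by exact: gg.1.
have t0 : 0 < order_ratio m n by rewrite sqrtr_gt0 divr_gt0.
have y0 : 0 < g n `^ (1 / 9) by exact: powR_gt0.
have q0 := q_gt0.
have mE : m n = (q / g n `^ (1 / 9) * order_ratio m n) ^+ 2.
  rewrite exprMn sqr_sqrtr ?divr_ge0 ?ltW// m_optE powRN (@powR_ninth _ _ 2) ?ltW//.
  by field; rewrite !gt_eqF.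
have z0 : 0 <= q / g n `^ (1 / 9) * order_ratio m n by exact: ltW (mulr_gt0 (divr_gt0 q0 y0) t0).
have m1 : m n `^ (1 / 2) = q / g n `^ (1 / 9) * order_ratio m n by rewrite {1}mE powR_half_sqr.
have m4 : m n `^ (-4) = (q / g n `^ (1 / 9) * order_ratio m n) ^- 8 by rewrite {1}mE powR_N4_sqr.
rewrite m1 m4 (@powR_ninth _ _ 8) ?ltW//.
have gE := esym (powR_ninthK (ltW gn)).
move: y0 t0 q0 gE; move: (vs n) (bs n) (g n) (q) (order_ratio m n) (g n `^ (1 / 9)).
by move=> v b G r t y y0 t0 r0 ->; field; rewrite !gt_eqF.
Qed.

Lemma order_ratio_opt n : (0 < n)%N -> order_ratio (m_opt f g) n = 1.
Proof. by move=> n0; rewrite /order_ratio divff ?gt_eqF ?m_opt_gt0// sqrtr1. Qed.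

Lemma mise_opt N : integer_order N (m_opt f g) -> exists2 r : nat -> R,
  (forall n, MISE X f g N n = (r n)%:E) & r n / g n `^ (8 / 9) @[n --> \oo] --> 9 / 8 * L.
Proof.
move=> Nm; have [ua [ub [uaL ubL H]]] := mise_ratio GS_m_opt Nm.
exists (fun n => fine (MISE X f g N n)); first by move=> n; have [r ->] := H n.
rewrite (_ : 9 / 8 * L = L + L / 8); last by field.
apply: (near_cvg (cvgD uaL ubL)); near=> n => /=.
have n0 : (0 < n)%N by near: n; exact: near_gt0n.
have [r -> /(_ n0) ->] := H n.
have gn : 0 < g n `^ (8 / 9) by rewrite powR_gt0//; exact: gg.1.
by rewrite order_ratio_opt// expr1n invr1 !mulr1 mulfK// gt_eqF.
Unshelve. all: by end_near. Qed.

Lemma g_powR_gt0 (p : R) : \forall n \near \oo, 0 < g n `^ p.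
Proof.
near=> n; rewrite powR_gt0//; apply: gg.1; near: n; exact: near_gt0n.
Unshelve. all: by end_near. Qed.

(** The competitor is bounded below by some w in [GS (- p)] with p < 8/9, and the quotient g^(8/9) /
    w has negative index p - 8/9. *)
Lemma mise_negligible N (alpha a : R) (g' m' : nat -> R) N' : integer_order N (m_opt f g) ->
  admissible alpha a g' m' -> integer_order N' m' -> ~ (alpha = 1 /\ a = 2 / 9) ->
  asymp_negligible (MISE X f g N) (MISE X f g' N').
Proof.
move=> Nm adm Nm' ne e e0.
have [r rE rL] := mise_opt Nm.
have [p [c [w [gw c0 lo [p8|//]]]]] := mise_lower_bound f_density X_iid f_C4 C2_gt0 adm Nm'.
have g89 : GS (- (8 / 9)) (fun n => g n `^ (8 / 9)).
  by have := GS_powR (8 / 9) gg; rewrite mulrN1.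
have wV : GS (-1 * - p) (fun n => w n `^ (-1)) := GS_powR (-1) gw.
have gwV := GS_mul g89 wV.
have z : r n / g n `^ (8 / 9) * (g n `^ (8 / 9) * w n `^ (-1)) @[n --> \oo] --> 9 / 8 * L * 0.
  by apply: cvgM rL _; apply: GS_cvg0 gwV; rewrite mulN1r opprK; lra.
rewrite mulr0 in z.
have small : \forall n \near \oo, r n / g n `^ (8 / 9) * (g n `^ (8 / 9) * w n `^ (-1)) <= e * c.
  by apply: (cvgr_le _ z); rewrite mulr_gt0.
have gp := g_powR_gt0 (8 / 9).
near=> n; have n0 : (0 < n)%N by near: n; exact: near_gt0n.
have wn : 0 < w n by exact: gw.1.
have gn : 0 < g n `^ (8 / 9) by near: n.
have sn : r n / g n `^ (8 / 9) * (g n `^ (8 / 9) * w n `^ (-1)) <= e * c by near: n.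
have ln : ((c * w n)%:E <= MISE X f g' N' n)%E by near: n.
apply: le_trans (_ : (e%:E * (c * w n)%:E <= _)%E); last by rewrite lee_pmul2l// lte_fin.
rewrite rE -EFinM lee_fin; move: sn.
by rewrite mulrA divfK ?gt_eqF// (powR_inv1 (ltW wn)) ler_pdivrMr// mulrA.
Unshelve. all: by end_near. Qed.

Lemma optimal_order_m_opt : optimal_order X f g (m_opt f g).
Proof.
move=> N Nm alpha a m' N' adm Nm'.
have [r rE rL] := mise_opt Nm.
have [/eqP ae|ae] := boolP (a == 2 / 9).
  have [al _ gg' gm' _] := adm; rewrite ae in gm'.
  have [ua [ub [uaL ubL H]]] := mise_ratio gm' Nm'.
  have t0 : \forall n \near \oo, 0 < order_ratio m' n.
    near=> n; have n0 : (0 < n)%N by near: n; exact: near_gt0n.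
    by rewrite sqrtr_gt0 divr_gt0 ?m_opt_gt0//; exact: gm'.1.
  have gp := g_powR_gt0 (8 / 9).
  split.
    move=> e e0; have le_u := tradeoff_le L_gt0 t0 rL uaL ubL e0.
    near=> n; have n0 : (0 < n)%N by near: n; exact: near_gt0n.
    have gn : 0 < g n `^ (8 / 9) by near: n.
    have [r' -> /(_ n0) ->] := H n.
    rewrite rE -EFinM lee_fin mulrA -ler_pdivrMr//; near: n; exact: le_u.
  move=> H2; have t1 : order_ratio m' @ \oo --> (1 : R).
    apply: (tradeoff_cvg1 L_gt0 t0 rL uaL ubL) => e e0; have H2e := H2 e e0.
    near=> n; have n0 : (0 < n)%N by near: n; exact: near_gt0n.
    have gn : 0 < g n `^ (8 / 9) by near: n.
    have [r' r'E /(_ n0) r'u] := H n.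
    have : (MISE X f g N' n <= (1 + e)%:E * MISE X f g N n)%E by near: n.
    by rewrite r'E rE -EFinM lee_fin r'u -ler_pdivlMr// mulrA.
  have := cvg_exprn (k := 2) t1; rewrite expr1n => t2.
  apply: (near_cvg t2); near=> n; have n0 : (0 < n)%N by near: n; exact: near_gt0n.
  by rewrite sqr_sqrtr// divr_ge0// ltW ?m_opt_gt0//; exact: gm'.1.
have ne : ~ (alpha = 1 /\ a = 2 / 9) by move=> [_ /eqP]; rewrite (negPf ae).
have neg := mise_negligible Nm adm Nm' ne.
have [p [c [w [gw c0 lo _]]]] := mise_lower_bound f_density X_iid f_C4 C2_gt0 adm Nm'.
have pos : \forall n \near \oo, (0 < MISE X f g N' n)%E.
  near=> n; have n0 : (0 < n)%N by near: n; exact: near_gt0n.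
  apply: lt_le_trans (_ : ((c * w n)%:E <= _)%E); last by near: n.
  by rewrite lte_fin mulr_gt0//; exact: gw.1.
split=> [e e0|H2].
  have ne1 := neg 1 ltr01.
  near=> n; have pn : (0 < MISE X f g N' n)%E by near: n.
  apply: le_trans (_ : (1%:E * MISE X f g N' n <= _)%E); first by near: n.
  by apply: lee_wpmul2r; [exact: ltW | rewrite lee_fin; lra].
(* For a different from 2/9 the premise of uniqueness fails: negligibility with 1/4 and comparison
   with 1 + 1 would give a positive MISE at most half of itself. *)
exfalso; have q0 : (0 : R) < 1 / 4 by lra.
have n1 := neg (1 / 4) q0; have n2 := H2 1 ltr01.
have [n [[h1 h2] h3]] := filter_ex (filterI (filterI n1 n2) pos).
move: h1 h2 h3; rewrite rE; case: (MISE X f g N' n) => [x| |]//.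
  rewrite -!EFinM !lee_fin lte_fin; lra.
Unshelve. all: by end_near. Qed.

End Optimal.

(** * Stepsizes proportional to 1 / n, for which xi = 1 / g0 *)

Section HarmonicStepsize.
Context {R : realType} (g0 : R).
Local Notation g := (fun n : nat => g0 / n%:R).

Lemma harmonic_near : \forall n \near \oo, n%:R * (g0 / n%:R) = g0.
Proof.
near=> n; have n0 : n%:R != 0 :> R by rewrite pnatr_eq0 -lt0n; near: n; exact: near_gt0n.
by rewrite mulrC divfK.
Unshelve. all: by end_near. Qed.

Lemma harmonic_gt : stepsize_limit 1 (2 / 9) g -> 4 / 9 < g0.
Proof.
move=> [l gl]; rewrite min29 => cl.
have gl' : (n%:R * (g0 / n%:R))%:E @[n --> \oo] --> g0%:E.
  apply: cvg_EFin; first exact: nearW.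
  apply: (near_cvg (cvg_cst g0)); have := harmonic_near.
  by apply: filterS => n /= ->.
by move: cl; rewrite (cvg_unique _ gl gl') ?lte_fin.
Qed.

Lemma harmonic_xi : xi_of g = g0^-1.
Proof.
apply: cvg_lim => //; apply: (near_cvg (cvg_cst g0^-1)); have := harmonic_near.
by apply: filterS => n /= ->.
Qed.

Lemma GS_natr : GS 1 (fun n => n%:R : R).
Proof.
split=> [n n0|]; first by rewrite ltr0n.
apply: (near_cvg (cvg_cst (1 : R))); near=> n.
have n0 : (0 < n)%N by near: n; exact: near_gt0n.
have n0' : n%:R != 0 :> R by rewrite pnatr_eq0 -lt0n.
by rewrite natr_pred//; field.
Unshelve. all: by end_near. Qed.

Lemma GS_harmonic : 0 < g0 -> GS (-1) g.
Proof.
move=> g00; have := GS_scale g00 (GS_powR (-1) GS_natr); rewrite mulr1.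
by congr (GS _ _); apply: funext => n; rewrite powR_inv1.
Qed.

Lemma harmonic_powR (p : R) n : 0 < g0 -> (g0 / n%:R) `^ p = g0 `^ p * n%:R `^ (- p).
Proof.
move=> g00; have i0 : 0 <= (n%:R : R)^-1 by rewrite invr_ge0.
by rewrite (powRM _ (ltW g00) i0) powRV// powRN.
Qed.

Lemma harmonic_gap (p : R) : 4 / 9 < g0 ->
  (1 - 4 / 9 * g0^-1) `^ p = (g0 - 4 / 9) `^ p * (g0 `^ p)^-1.
Proof.
move=> g049; have g00 : 0 < g0 by lra.
have i0 : 0 <= g0^-1 by rewrite invr_ge0 ltW.
have g1 : 0 <= g0 - 4 / 9 by lra.
rewrite -(powRV _ (ltW g00)) -(powRM _ g1 i0).
by congr (_ `^ _); field; rewrite gt_eqF.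
Qed.

End HarmonicStepsize.

Theorem corollary1 (R : realType) (d : measure_display) (T : measurableType d)
    (P : probability T R) (X : nat -> {RV P >-> R}) (f : R -> R)
    (f_density : density01 f)
    (X_iid : iid_with_density (fun n => X n.+1) f)
    (f_C4 : C4_01 f)
    (C2_gt0 : 0 < C2 f) :
  (* general stepsizes *)
  (forall g : nat -> R, GS (-1) g -> stepsize_limit 1 (2 / 9) g ->
    [/\ GS (2 / 9) (m_opt f g),
        (forall N, integer_order N (m_opt f g) ->
         forall alpha a g' m' N', admissible alpha a g' m' ->
           integer_order N' m' -> ~ (alpha = 1 /\ a = 2 / 9) ->
           asymp_negligible (MISE X f g N) (MISE X f g' N')),
        optimal_order X f g (m_opt f g)
      & forall N, integer_order N (m_opt f g) ->
          expansion (MISE X f g N)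
            (9 * (32 * C1 f ^+ 8 * C3 ^+ 8 * C2 f) `^ (1 / 9) / 8
             * (1 / (2 `^ (8 / 9) * (1 - 4 / 9 * xi_of g) `^ (10 / 9))))
            (fun n => g n `^ (8 / 9))]) /\
  (* stepsizes g0 / n *)
  (forall g0 : R, stepsize_limit 1 (2 / 9) (fun n => g0 / n%:R) ->
    let g := fun n : nat => g0 / n%:R in
    let m := fun n : nat =>
      2 `^ (2 / 9) * (g0 - 4 / 9) `^ (- (2 / 9))
      * (32 * C2 f / (C1 f * C3)) `^ (2 / 9) * n%:R `^ (2 / 9) in
    [/\ GS (2 / 9) m,
        optimal_order X f g m
      & forall N, integer_order N m ->
          expansion (MISE X f g N)
            (9 * (8 * C1 f ^+ 8 * C3 ^+ 8 * C2 f) `^ (1 / 9) / 8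
             * (g0 ^+ 2 / (2 `^ (6 / 9) * (g0 - 4 / 9) `^ (10 / 9))))
            (fun n => n%:R `^ (- (8 / 9)))]).
Proof.
have expand g N : GS (-1) g -> stepsize_limit 1 (2 / 9) g -> integer_order N (m_opt f g) ->
    expansion (MISE X f g N)
            (9 * (32 * C1 f ^+ 8 * C3 ^+ 8 * C2 f) `^ (1 / 9) / 8
             * (1 / (2 `^ (8 / 9) * (1 - 4 / 9 * xi_of g) `^ (10 / 9))))
            (fun n => g n `^ (8 / 9)).
  move=> gg gs Nm; have [r rE rL] := mise_opt f_density X_iid f_C4 C2_gt0 gg gs Nm.
  rewrite (mise_constant f_density f_C4 C2_gt0 gs) in rL.
  by apply: expansion_of_ratio rE _ rL; exact: g_powR_gt0.
split=> [g gg gs|g0 gs g m].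
  split; [exact: GS_m_opt | by move=> *; apply: mise_negligible; eassumption
    | exact: optimal_order_m_opt | by move=> N; exact: expand].
have g049 := harmonic_gt gs; have g00 : 0 < g0 by lra.
have gg : GS (-1) g := GS_harmonic g00.
(* The power g0^(2/9) from g n^(-2/9) cancels against the one from 1 - (4/9) / g0 = (g0 - 4/9) /
   g0. *)
have mE : m = m_opt f g.
  apply: funext => n; rewrite /m_opt harmonic_xi harmonic_gap// harmonic_powR// opprK.
  have : 0 < g0 `^ (- (2 / 9)) by exact: powR_gt0.
  rewrite /m; move: (_ `^ (2 / 9)) (2 `^ _) (n%:R `^ _) ((g0 - _) `^ _) (g0 `^ _) => u1 u2 u3 u4 u5 u50.
  by field; rewrite gt_eqF.
rewrite mE; split; [exact: GS_m_opt | exact: optimal_order_m_opt | move=> N Nm].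
have [r rE rL] := mise_opt f_density X_iid f_C4 C2_gt0 gg gs Nm.
rewrite (mise_constant f_density f_C4 C2_gt0 gs) harmonic_xi in rL.
apply: expansion_of_ratio rE _ _.
  near=> n; rewrite powR_gt0// ltr0n; near: n; exact: near_gt0n.
have rL2 : r n / g n `^ (8 / 9) * g0 `^ (8 / 9) @[n --> \oo] -->
    9 * (32 * C1 f ^+ 8 * C3 ^+ 8 * C2 f) `^ (1 / 9) / 8
    * (1 / (2 `^ (8 / 9) * (1 - 4 / 9 * g0^-1) `^ (10 / 9))) * g0 `^ (8 / 9).
  by apply: cvgM rL _; exact: cvg_cst.
rewrite (_ : 9 * (8 * _ * _ * _) `^ _ / _ * _ =
    9 * (32 * C1 f ^+ 8 * C3 ^+ 8 * C2 f) `^ (1 / 9) / 8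
    * (1 / (2 `^ (8 / 9) * (1 - 4 / 9 * g0^-1) `^ (10 / 9))) * g0 `^ (8 / 9)); last first.
  have C10 := C1_gt0 f_density f_C4; have C30 := @C3_gt0 R.
  (* Taking 2^2 out of 32 moves 2^(2/9) out of the ninth root and lowers 2^(8/9) to 2^(6/9). The
     factor g0^2 is g0^(10/9), from [harmonic_gap], times g0^(8/9). *)
  have -> : 32 * C1 f ^+ 8 * C3 ^+ 8 * C2 f = 2 ^+ 2 * (8 * C1 f ^+ 8 * C3 ^+ 8 * C2 f) by ring.
  have Y0 : 0 <= 8 * C1 f ^+ 8 * C3 ^+ 8 * C2 f by rewrite !mulr_ge0 ?exprn_ge0// ltW.
  have E4 : (2 ^+ 2) `^ (1 / 9) = (2 `^ (1 / 9)) ^+ 2 :> R by rewrite ninthX.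
  have g09 : 0 <= g0 by exact: ltW.
  have h09 : 0 < g0 - 4 / 9 by lra.
  rewrite (powRM _ (exprn_ge0 2 (ler0n R 2)) Y0) E4 harmonic_gap//.
  rewrite (@powR_ninth _ 2 8)// (@powR_ninth _ 2 6)// (@powR_ninth _ g0 10)// (@powR_ninth _ g0 8)//.
  have g2 : g0 ^+ 2 = (g0 `^ (1 / 9)) ^+ 18 by rewrite -{1}(powR_ninthK g09) -exprM.
  have u10 : (0 : R) < 2 `^ (1 / 9) by exact: powR_gt0.
  have u20 : 0 < g0 `^ (1 / 9) by exact: powR_gt0.
  have u30 : 0 < (g0 - 4 / 9) `^ (10 / 9) by exact: powR_gt0.
  rewrite g2; move: u10 u20 u30.
  move: (_ `^ _) (2 `^ _) ((g0 - _) `^ _) (g0 `^ _) => u0 u1 u3 u2 u10 u20 u30.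
  by field; rewrite !gt_eqF.
apply: (near_cvg rL2); near=> n.
have n0 : (0 < n)%N by near: n; exact: near_gt0n.
have np : 0 < n%:R `^ (- (8 / 9)) :> R by rewrite powR_gt0// ltr0n.
have gp : 0 < g0 `^ (8 / 9) by exact: powR_gt0.
rewrite /g harmonic_powR//.
by field; rewrite !gt_eqF.
Unshelve. all: by end_near. Qed.
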